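(* Let $N>1$ be square-free and $\Gamma=\Gamma_0(N)$. Then the extended Petersson product on $M_2(\Gamma_0(N))$ (defined in the context) is degenerate, unless $N$ is prime, in which case it is nondegenerate.
   Context: Let $\Gamma$ be a finite index subgroup of $\mathrm{SL}_2(\mathbb{Z})$, $k\ge2$ an integer, $M_k(\Gamma)$ the space of holomorphic modular forms of weight $k$ for $\Gamma$. Let $\Gamma_1=\mathrm{PSL}_2(\mathbb{Z})$, $\overline{\Gamma}$ the image of $\Gamma$ in $\Gamma_1$, $C_\Gamma=[\Gamma_1:\overline\Gamma]$. For $A=\begin{pmatrix}a&b\\c&d\end{pmatrix}$ put $f|_kA(z)=f(Az)(cz+d)^{-k}$, and let $a_0(h)$ denote the constant term of the Fourier expansion at $\infty$ of $h$. For $f,g\in M_k(\Gamma)$ set $\mathrm{tr}(f\overline g)(z)=\sum_A f|_kA(z)\overline{g|_kA(z)}$ and $a_0(f,g)=\sum_A a_0(f|_kA)\overline{a_0(g|_kA)}$, sums over a complete set of representatives $A$ of $\overline\Gamma\backslash\Gamma_1$ (lifted to $\mathrm{SL}_2(\mathbb{Z})$). Let $\mathcal F_T=\{z=x+iy\in\mathbb{H}: |z|\ge1,\ |x|\le1/2,\ y<T\}$ and $d\mu=dx\,dy/y^2$. The extended Petersson product is \[(f,g)=\frac1{C_\Gamma}\lim_{T\to\infty}\Big[\int_{\mathcal F_T}y^k\,\mathrm{tr}(f\overline g)\,d\mu-a_0(f,g)\frac{T^{k-1}}{k-1}\Big].\] It is called nondegenerate if the only $f\in M_k(\Gamma)$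 with $(f,g)=0$ for all $g\in M_k(\Gamma)$ is $f=0$, and degenerate otherwise. *)

(* Defs.v *)
From HB Require Import structures.
From mathcomp Require Import all_boot all_order all_algebra.
From mathcomp Require Import all_classical all_reals all_analysis.
From mathcomp Require Import complex.

Set Implicit Arguments.
Unset Strict Implicit.
Unset Printing Implicit Defensive.

Import Order.TTheory GRing.Theory Num.Theory.
Import numFieldNormedType.Exports.

Local Open Scope classical_set_scope.
Local Open Scope ring_scope.
Local Open Scope complex_scope.

Definition squarefree (n : nat) : Prop :=
  forall d : nat, (d ^ 2 %| n)%N -> d = 1%N.

Definition SL2Z : set 'M[int]_2 := [set A | \det A = 1].

Definition Gamma0 (N : nat) : set 'M[int]_2 :=
  [set A | SL2Z A /\ (N%:Z %| A 1%R 0%R)%Z].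

(* A and B have the same class in \overline{Gamma} \ PSL_2(Z). *)
Definition same_coset (Gamma : set 'M[int]_2) (A B : 'M[int]_2) : Prop :=
  exists2 g, Gamma g & A = g *m B \/ A = - (g *m B).

Definition is_coset_reps (Gamma : set 'M[int]_2) (s : seq 'M[int]_2) : Prop :=
  [/\ uniq s,
      forall A, A \in s -> SL2Z A,
      forall A B, A \in s -> B \in s -> same_coset Gamma A B -> A = B
    & forall A, SL2Z A -> exists2 B, B \in s & same_coset Gamma A B].

(* A chosen complete set of representatives of \overline{Gamma} \ PSL_2(Z);
   meaningful when the index is finite, see coset_reps_Gamma0 below. *)
Definition coset_reps (Gamma : set 'M[int]_2) : seq 'M[int]_2 :=
  xget [::] [set s | is_coset_reps Gamma s].

Definition psl2_index (Gamma : set 'M[int]_2) : nat := size (coset_reps Gamma).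

Section ModularForms.
Variable R : realType.
Local Notation C := R[i].

Definition upper_half_plane : set C := [set z | 0 < complex.Im z].

Definition cexp (z : C) : C :=
  (expR (complex.Re z))%:C * (cos (complex.Im z) +i* sin (complex.Im z)).

(* The regular module C^o carries the topology of C, and the scalars of the
   difference quotient range over C: this is complex differentiability. *)
Definition holomorphic_on (D : set C) (f : C -> C) : Prop :=
  forall z, D z -> derivable (f : C^o -> C^o) z 1.

Definition slash (k : nat) (f : C -> C) (A : 'M[int]_2) (z : C) : C :=
  let num := (A 0 0)%:~R * z + (A 0 1)%:~R in
  let den := (A 1 0)%:~R * z + (A 1 1)%:~R in
  f (num / den) / den ^+ k.

(* h(z) = \sum_(n >= 0) a_n e^(2 pi i n z / w) on the upper half-plane. *)
Definition fourier_expansion (h : C -> C) (w : nat) (a : nat -> C) : Prop :=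
  (0 < w)%N /\
  forall z, upper_half_plane z ->
    series (fun n => a n * cexp ((2 * pi)%:C * 'i%C * n%:R * z / w%:R) : C^o) @ \oo
      --> (h z : C^o).

(* The value does not depend on the period w used in the expansion. *)
Definition a0 (h : C -> C) : C :=
  xget 0 [set c | exists w a, fourier_expansion h w a /\ a 0%N = c].

(* Only the values on the upper half-plane are meaningful: a modular form is
   represented by any extension to C. *)
Definition modular_form (k : nat) (Gamma : set 'M[int]_2) (f : C -> C) : Prop :=
  [/\ holomorphic_on upper_half_plane f,
      forall A z, Gamma A -> upper_half_plane z -> slash k f A z = f z
    & forall A, SL2Z A -> exists w a, fourier_expansion (slash k f A) w a].

Definition tr_prod (k : nat) (Gamma : set 'M[int]_2) (f g : C -> C) (z : C) : C :=
  \sum_(A <- coset_reps Gamma) slash k f A z * (slash k g A z)^*%C.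

Definition a0_prod (k : nat) (Gamma : set 'M[int]_2) (f g : C -> C) : C :=
  \sum_(A <- coset_reps Gamma) a0 (slash k f A) * (a0 (slash k g A))^*%C.

Definition FT (T : R) : set C :=
  [set z | [/\ upper_half_plane z, 1 <= `|z|, `|complex.Re z| <= 2^-1
             & complex.Im z < T]].

(* \int_D F dmu with dmu = dx dy / y^2. *)
Definition hyp_integral (D : set C) (F : C -> C) : C :=
  let area := (@lebesgue_measure R \x @lebesgue_measure R)%E in
  let D2 := [set p : R * R | D (p.1 +i* p.2)] in
  let F2 := fun p : R * R => F (p.1 +i* p.2) / (p.2 ^+ 2)%:C in
  (\int[area]_(p in D2) complex.Re (F2 p))
    +i* (\int[area]_(p in D2) complex.Im (F2 p)).

Definition petersson (k : nat) (Gamma : set 'M[int]_2) (f g : C -> C) : C :=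
  (psl2_index Gamma)%:R^-1 *
  lim ((hyp_integral (FT T) (fun z => (complex.Im z ^+ k)%:C * tr_prod k Gamma f g z)
        - a0_prod k Gamma f g * (T ^+ (k - 1) / (k - 1)%:R)%:C : C^o)
       @[T --> +oo%R]).

Definition petersson_nondegenerate (k : nat) (Gamma : set 'M[int]_2) : Prop :=
  forall f, modular_form k Gamma f ->
    (forall g, modular_form k Gamma g -> petersson k Gamma f g = 0) ->
    forall z, upper_half_plane z -> f z = 0.

Definition petersson_degenerate (k : nat) (Gamma : set 'M[int]_2) : Prop :=
  ~ petersson_nondegenerate k Gamma.

End ModularForms.

Section Gamma0FiniteIndex.

Lemma adj_mx2_10 (A : 'M[int]_2) : (\adj A) 1 0 = - A 1 0.
Proof.
rewrite mxE /cofactor det_mx11 !mxE /= expr1 mulN1r.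
by congr (- A _ _); apply/val_inj.
Qed.

Lemma SL2Z_adj A : SL2Z A -> SL2Z (\adj A).
Proof.
rewrite /SL2Z /= => dA.
have := congr1 determinant (mul_mx_adj A).
by rewrite det_mulmx dA mul1r det1.
Qed.

Lemma Gamma0_mul N A B : Gamma0 N A -> Gamma0 N B -> Gamma0 N (A *m B).
Proof.
move=> [dA NA] [dB NB]; split; first by rewrite /SL2Z /= det_mulmx dA dB mul1r.
rewrite mxE big_ord_recl big_ord1.
have -> : lift ord0 ord0 = 1 :> 'I_2 by apply/val_inj.
by rewrite rpredD // ?(dvdz_mulr _ NA) ?(dvdz_mull _ NB).
Qed.

Lemma Gamma0_adj N A : Gamma0 N A -> Gamma0 N (\adj A).
Proof.
by move=> [dA NA]; split; [exact: SL2Z_adj | rewrite adj_mx2_10 rpredN].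
Qed.

Lemma same_coset_sym N A B :
  same_coset (Gamma0 N) A B -> same_coset (Gamma0 N) B A.
Proof.
move=> [g Gg AB]; exists (\adj g); first exact: Gamma0_adj.
case: AB => ->; [left | right].
  by rewrite mulmxA mul_adj_mx (proj1 Gg) mul1mx.
by rewrite mulmxN opprK mulmxA mul_adj_mx (proj1 Gg) mul1mx.
Qed.

Lemma same_coset_trans N A B D : same_coset (Gamma0 N) A B ->
  same_coset (Gamma0 N) B D -> same_coset (Gamma0 N) A D.
Proof.
move=> [g Gg AB] [h Gh BD]; exists (g *m h); first exact: Gamma0_mul.
by case: AB => ->; case: BD => ->; rewrite ?mulmxN ?opprK -?mulmxA;
  [left | right | right | left].
Qed.

Lemma same_coset_mod N A B : SL2Z A -> SL2Z B ->
  (forall i j, (A i j = B i j %[mod N%:Z])%Z) -> same_coset (Gamma0 N) A B.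
Proof.
move=> dA dB AB; exists (A *m \adj B); last first.
  by left; rewrite -mulmxA mul_adj_mx dB mulmx1.
split; first by rewrite /SL2Z /= det_mulmx dA (SL2Z_adj dB) mul1r.
have -> : (A *m \adj B) 1 0 = ((A - B) *m \adj B) 1 0.
  rewrite mulmxBl mul_mx_adj dB; set M := A *m _.
  have -> : (M - 1%:M) 1 0 = M 1 0 - (1%:M : 'M[int]_2) 1 0 by rewrite !mxE.
  by rewrite [X in _ - X]mxE subr0.
rewrite mxE rpred_sum // => i _; apply: dvdz_mulr.
by rewrite !mxE -eqz_mod_dvd; apply/eqP.
Qed.

Lemma coset_reps_Gamma0 N : (0 < N)%N ->
  is_coset_reps (Gamma0 N) (coset_reps (Gamma0 N)).
Proof.
case: N => // n _; set G := Gamma0 n.+1.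
suff [s hs] : exists s, is_coset_reps G s by exact: (@xgetPex _ [::] _ (ex_intro _ s hs)).
pose key (A : 'M[int]_2) : 'M['I_n.+1]_2 :=
  \matrix_(i, j) inord `|(A i j %% n.+1%:Z)%Z|%N.
have keyP A B : key A = key B -> forall i j, (A i j = B i j %[mod n.+1%:Z])%Z.
  move=> kAB i j; have /(congr1 val) := congr1 (fun M : 'M['I_n.+1]_2 => M i j) kAB.
  have bnd (x : int) : (`|(x %% n.+1%:Z)%Z|%N < n.+1)%N.
    by rewrite -ltz_nat gez0_abs ?modz_ge0 // ltz_pmod.
  rewrite !mxE /= !inordK // => /(congr1 Posz).
  by rewrite !gez0_abs ?modz_ge0.
pose rep x := xget 1%:M [set A | SL2Z A /\ key A = x].
have repS x : SL2Z (rep x).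
  by rewrite /rep; case: xgetP => [y -> []//|_]; rewrite /SL2Z /= det1.
have repK A : SL2Z A -> key (rep (key A)) = key A.
  by move=> dA; rewrite /rep; case: xgetP => [y -> []//|/(_ A)]; case.
have prune (L : seq 'M[int]_2) : exists s, [/\ uniq s, {subset s <= L},
    forall A B, A \in s -> B \in s -> same_coset G A B -> A = B
  & forall A, A \in L -> exists2 B, B \in s & same_coset G A B].
  elim: L => [|x L [s [us sL sU sC]]]; first by exists [::].
  have [[y ys xy]|nx] := pselect (exists2 y, y \in s & same_coset G x y).
    exists s; split => // [A /sL AL|A]; first by rewrite inE AL orbT.
    by rewrite inE => /orP[/eqP->|/sC//]; exists y.
  have xx : same_coset G x x.
    exists 1%:M; last by left; rewrite mul1mx.
    by split; [rewrite /SL2Z /= det1 | rewrite mxE].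
  exists (x :: s); split => [|A|A B|A].
  - by rewrite /= us andbT; apply/negP => xs; apply: nx; exists x.
  - by rewrite !inE => /orP[->//|/sL->]; rewrite orbT.
  - rewrite !inE => /orP[/eqP->|As] /orP[/eqP->|Bs] // AB.
    + by case: nx; exists B.
    + by case: nx; exists A => //; exact: same_coset_sym.
    + exact: sU.
  - rewrite inE => /orP[/eqP->|/sC [B Bs AB]].
      by exists x => //; rewrite inE eqxx.
    by exists B => //; rewrite inE Bs orbT.
have [s [us sL sU sC]] := prune [seq rep x | x <- enum {: 'M['I_n.+1]_2}].
exists s; split => // [A /sL /mapP [x _ ->] //|A dA].
have [B Bs AB] : exists2 B, B \in s & same_coset G (rep (key A)) B.
  by apply: sC; apply: map_f; rewrite mem_enum.
exists B => //; apply: (same_coset_trans _ AB).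
by apply: same_coset_mod => //; apply: keyP; rewrite repK.
Qed.

End Gamma0FiniteIndex.

(* Main.v *)
(** Up to the factor [i], the weight-2 Eisenstein series [gei = zeta(2) - 4 pi^2 sum sigma(n) q^n]
    is the derivative of a function whose real part, corrected by [ge * ln y], is the
    [SL_2(Z)]-invariant function [Hf].  For coefficients [c_d], [d | N], with sum [0], the form
    [f = sum c_d d i gei(d z)] is modular for [Gamma0 N] and is the gradient of
    [h = sum c_d Hf(d z)].  Green's formula on the truncated fundamental domain turns
    [(f, g)] into the boundary term at height [T], so that [(f, g)] is, up to a factor, the sum
    over the cusps of [beta * conj (a0 g)], where [beta] is the constant term of [h].

    If [p q | N] with [p <> q] prime, the coefficients [1, -1, -1, 1] at [1, p, q, p q] make every
    [beta] vanish, while [f <> 0]: the product is degenerate.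

    If [N = p] is prime, take [E] with coefficients [1, -1] at [1, p].  The constant function
    [h = 1] shows that the constant terms of a modular form sum to [0], so subtracting a
    multiple [c E] from [f] leaves a cusp form [f0].  As [(E, f0) = 0], the number [(f, f0)] is
    the integral of [|f0|^2], so [f0 = 0]; and [(E, E) <> 0] gives [c = 0].  Applying the sum rule
    at level 1 to [gei] also shows that [ge] is nonzero. *)

Require Import Defs.
From HB Require Import structures.
From mathcomp Require Import all_boot all_order all_algebra.
From mathcomp Require Import all_classical all_reals all_analysis.
From mathcomp Require Import measurable_realfun complex ring lra zify.

Set Implicit Arguments.
Unset Strict Implicit.
Unset Printing Implicit Defensive.

Import Order.TTheory GRing.Theory Num.Theory.
Import numFieldNormedType.Exports.

Local Open Scope classical_set_scope.
Local Open Scope ring_scope.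
Local Open Scope complex_scope.

(** * Real-valued complex modulus and Taylor estimates for the complex exponential *)

Section ComplexBasics.
Variable R : realType.
Local Notation C := R[i].
Local Notation Re := (@complex.Re R).
Local Notation Im := (@complex.Im R).
Implicit Types (x y z : C).

(** The series of (c z + d)^(-2) converges only conditionally, so exchanging the sums over c and d,
    as the inversion z -> -1/z does, leaves a defect [delta]. It is determined by its scaling law
    delta(n z) = delta(z) / n: this forces z * delta(z) to have derivative 0, hence to be a
    constant, expressed through [ge] = gei(i) (classically pi / 2). The resulting failure of
    modularity of d * gei(d z) under a matrix A does not depend on d, whence the condition that the
    coefficients sum to 0. At a cusp with lower left entry c, gei(d z) is seen at height r_d * y,
    where r_d = gcd(d, c)^2 / d. The constant term of f is linear in the r_d, while beta is linear
    in the ln r_d. Since r_(p q) = r_p r_q for distinct primes, the coefficients 1, -1, -1, 1 give -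
    ln r_p - ln r_q + ln r_(p q) = 0, whereas the constant term at infinity has the factor (1 - p)
    (1 - q). For N = p, ln r and 1 - r have opposite signs at every cusp, so nothing cancels in (E,
    E). *)

Definition nrm (z : C) : R := Num.sqrt (Re z ^+ 2 + Im z ^+ 2).

(** The norm of [R[i]] takes values in [R[i]]. [nrm] is its real form: with it every estimate is an
    inequality between reals, within reach of [lra] and [nra]. *)
Lemma normE z : `|z| = (nrm z)%:C.
Proof. exact: normc_def. Qed.

Lemma ReD x y : Re (x + y) = Re x + Re y. Proof. by case: x; case: y. Qed.
Lemma ImD x y : Im (x + y) = Im x + Im y. Proof. by case: x; case: y. Qed.
Lemma ReN x : Re (- x) = - Re x. Proof. by case: x. Qed.
Lemma ImN x : Im (- x) = - Im x. Proof. by case: x. Qed.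
Lemma ReM x y : Re (x * y) = Re x * Re y - Im x * Im y.
Proof. by case: x; case: y. Qed.
Lemma ImM x y : Im (x * y) = Re x * Im y + Im x * Re y.
Proof. by case: x => a b; case: y => c d /=. Qed.
Lemma ReJ x : Re (x^*)%C = Re x. Proof. by case: x. Qed.
Lemma ImJ x : Im (x^*)%C = - Im x. Proof. by case: x. Qed.
Lemma ReC (a : R) : Re a%:C = a. Proof. by []. Qed.
Lemma ImC (a : R) : Im a%:C = 0. Proof. by []. Qed.
Lemma Re_i : Re 'i%C = 0. Proof. by []. Qed.
Lemma Im_i : Im 'i%C = 1. Proof. by []. Qed.
Lemma Re_pair (a b : R) : Re (a +i* b) = a. Proof. by []. Qed.
Lemma Im_pair (a b : R) : Im (a +i* b) = b. Proof. by []. Qed.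
Lemma natC n : (n%:R : C) = (n%:R : R)%:C.
Proof. by rewrite rmorph_nat. Qed.
Lemma Re_nat n : Re (n%:R : C) = n%:R. Proof. by rewrite natC. Qed.
Lemma Im_nat n : Im (n%:R : C) = 0. Proof. by rewrite natC. Qed.
Lemma intC n : (n%:~R : C) = (n%:~R : R)%:C.
Proof. by rewrite rmorph_int. Qed.
Definition ReImE := (Re_i, Im_i, ReD, ImD, ReN, ImN, ReM, ImM, ReJ, ImJ, ReC, ImC,
  Re_nat, Im_nat, Re_pair, Im_pair).

Lemma complexP x y : Re x = Re y -> Im x = Im y -> x = y.
Proof. by case: x => a b; case: y => c d /= -> ->. Qed.

Lemma CM (a b : R) : (a * b)%:C = a%:C * b%:C. Proof. by rewrite rmorphM. Qed.
Lemma CD (a b : R) : (a + b)%:C = a%:C + b%:C. Proof. by rewrite rmorphD. Qed.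
Lemma CN (a : R) : (- a)%:C = - a%:C. Proof. by rewrite rmorphN. Qed.
Lemma CV (a : R) : (a^-1)%:C = (a%:C)^-1. Proof. by rewrite fmorphV. Qed.
Lemma C_eq0 (a : R) : (a%:C == 0) = (a == 0).
Proof. by rewrite fmorph_eq0. Qed.

Lemma Re_sum I (r : seq I) (P : pred I) (F : I -> C) :
  Re (\sum_(i <- r | P i) F i) = \sum_(i <- r | P i) Re (F i).
Proof. by apply: (big_morph Re ReD). Qed.
Lemma Im_sum I (r : seq I) (P : pred I) (F : I -> C) :
  Im (\sum_(i <- r | P i) F i) = \sum_(i <- r | P i) Im (F i).
Proof. by apply: (big_morph Im ImD). Qed.

Lemma nrm_ge0 z : 0 <= nrm z. Proof. exact: sqrtr_ge0. Qed.

Lemma nrmM x y : nrm (x * y) = nrm x * nrm y.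
Proof. by apply: complexI; rewrite CM -!normE normrM. Qed.

Lemma nrmD x y : nrm (x + y) <= nrm x + nrm y.
Proof. by rewrite -lecR CD -!normE ler_normD. Qed.

Lemma nrmN x : nrm (- x) = nrm x.
Proof. by rewrite /nrm ReN ImN !sqrrN. Qed.

Lemma nrmB x y : nrm (x - y) <= nrm x + nrm y.
Proof. by rewrite -[nrm y]nrmN nrmD. Qed.

Lemma nrmBC x y : nrm (x - y) = nrm (y - x).
Proof. by rewrite -nrmN opprB. Qed.

Lemma nrm_lower x y : nrm x - nrm y <= nrm (x + y).
Proof. by have := nrmB (x + y) y; rewrite addrK; lra. Qed.

Lemma nrmC (a : R) : nrm a%:C = `|a|.
Proof. by rewrite /nrm /= expr0n addr0 sqrtr_sqr. Qed.

Lemma nrm0 : nrm 0 = 0. Proof. by rewrite (nrmC 0) normr0. Qed.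
Lemma nrm1 : nrm 1 = 1. Proof. by rewrite (nrmC 1) normr1. Qed.
Lemma nrm_nat n : nrm n%:R = n%:R. Proof. by rewrite natC nrmC normr_nat. Qed.

Lemma nrm_eq0 z : (nrm z == 0) = (z == 0).
Proof. by rewrite -C_eq0 -normE normr_eq0. Qed.

Lemma nrm_gt0 z : (0 < nrm z) = (z != 0).
Proof. by rewrite lt_neqAle eq_sym nrm_eq0 nrm_ge0 andbT. Qed.

Lemma nrmV z : nrm z^-1 = (nrm z)^-1.
Proof. by apply: complexI; rewrite CV -!normE normfV. Qed.

Lemma nrmX z n : nrm (z ^+ n) = nrm z ^+ n.
Proof. by elim: n => [|n IH]; rewrite ?expr0 ?nrm1 // !exprS nrmM IH. Qed.

Lemma nrmJ z : nrm (z^*)%C = nrm z.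
Proof. by rewrite /nrm ReJ ImJ sqrrN. Qed.

Lemma nrm_sqr z : nrm z ^+ 2 = Re z ^+ 2 + Im z ^+ 2.
Proof. by rewrite /nrm sqr_sqrtr // addr_ge0 // sqr_ge0. Qed.

Lemma nrm_Re z : `|Re z| <= nrm z.
Proof. by rewrite -sqrtr_sqr ler_wsqrtr // lerDl sqr_ge0. Qed.

Lemma nrm_Im z : `|Im z| <= nrm z.
Proof. by rewrite -sqrtr_sqr ler_wsqrtr // lerDr sqr_ge0. Qed.

Lemma nrm_i : nrm 'i%C = 1.
Proof. by rewrite /nrm /= expr0n add0r expr1n sqrtr1. Qed.

Lemma nrm_le_ReIm z : nrm z <= `|Re z| + `|Im z|.
Proof.
rewrite {1}(complexE z); apply: le_trans (nrmD _ _) _.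
by rewrite nrmM nrm_i mul1r !nrmC.
Qed.

Lemma nrm_sum I (r : seq I) (P : pred I) (F : I -> C) :
  nrm (\sum_(i <- r | P i) F i) <= \sum_(i <- r | P i) nrm (F i).
Proof.
elim/big_rec2: _ => [|i y x _ IH]; first by rewrite nrm0.
exact: le_trans (nrmD _ _) (lerD _ _).
Qed.

Lemma cexp0 : cexp (0 : C) = 1.
Proof. by rewrite /cexp /= expR0 cos0 sin0 mul1r. Qed.

Lemma cexpD x y : cexp (x + y) = cexp x * cexp y.
Proof.
rewrite /cexp ReD ImD expRD cosD sinD.
by apply: complexP; rewrite !ReImE; ring.
Qed.

Lemma nrm_cexp z : nrm (cexp z) = expR (Re z).
Proof.
rewrite /cexp nrmM nrmC ger0_norm ?expR_ge0 // /nrm /= cos2Dsin2.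
by rewrite sqrtr1 mulr1.
Qed.

Lemma cexp_neq0 z : cexp z != 0.
Proof. by rewrite -nrm_gt0 nrm_cexp expR_gt0. Qed.

Lemma cexpN z : cexp (- z) = (cexp z)^-1.
Proof.
by apply: (mulfI (cexp_neq0 z)); rewrite -cexpD subrr cexp0 mulfV ?cexp_neq0.
Qed.

Lemma cexpXn z n : cexp (n%:R * z) = cexp z ^+ n.
Proof.
elim: n => [|n IH]; first by rewrite mul0r cexp0 expr0.
by rewrite exprS -IH -cexpD -natr1; congr cexp; ring.
Qed.

Lemma cexp_2pi_nat n : cexp ('i%C * (2 * pi * n%:R)%:C) = 1 :> C.
Proof.
have -> : 'i%C * (2 * pi * n%:R)%:C = n%:R * ('i%C * (pi *+ 2)%:C) :> C.
  by rewrite !CM -natC rmorphMn /= -mulr_natl; ring.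
rewrite cexpXn /cexp !ReImE.
have -> : 0 * (pi *+ 2) - 1 * 0 = 0 :> R by ring.
have -> : 0 * 0 + 1 * (pi *+ 2) = pi *+ 2 :> R by ring.
by rewrite expR0 mul1r cos2pi sin2pi expr1n.
Qed.

Lemma is_derive_Re_cexp x (t : R) :
  is_derive t 1 (fun t : R => Re (cexp (t%:C * x))) (Re (x * cexp (t%:C * x))).
Proof.
have -> : (fun t : R => Re (cexp (t%:C * x))) =
    (fun t => expR (t * Re x) * cos (t * Im x)).
  by apply/funext => s; rewrite /cexp !ReImE !mul0r !subr0 !addr0.
apply: is_derive_eq; rewrite /cexp !ReImE !mul0r !subr0 !addr0 /GRing.scale /=.
by ring.
Qed.

Lemma is_derive_Im_cexp x (t : R) :
  is_derive t 1 (fun t : R => Im (cexp (t%:C * x))) (Im (x * cexp (t%:C * x))).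
Proof.
have -> : (fun t : R => Im (cexp (t%:C * x))) =
    (fun t => expR (t * Re x) * sin (t * Im x)).
  by apply/funext => s; rewrite /cexp !ReImE !mul0r !subr0 !addr0.
apply: is_derive_eq; rewrite /cexp !ReImE !mul0r !subr0 !addr0 /GRing.scale /=.
by ring.
Qed.

Lemma mvt_bound (f df : R -> R) K :
  (forall t : R, 0 <= t <= 1 -> is_derive t 1 f (df t)) ->
  (forall t : R, 0 <= t <= 1 -> `|df t| <= K) -> `|f 1 - f 0| <= K.
Proof.
move=> fd fK.
have [t t01 ->] : exists2 c, c \in `[0, 1] & f 1 - f 0 = df c * (1 - 0).
  apply: MVT_segment => // [c|].
    by rewrite in_itv /= => /andP[a b]; apply: fd; rewrite !ltW.
  apply: derivable_within_continuous => c; rewrite in_itv /= => h.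
  by case: (fd c h).
by rewrite subr0 mulr1 fK.
Qed.

(** The mean value theorem is false for complex-valued functions, so it is applied to the real and
    to the imaginary part. This costs the factor 2, which accumulates to 2, 4, 8 in the three
    exponential bounds below. *)
Lemma path_bound (g q : R -> C) x K :
  (forall t : R, 0 <= t <= 1 ->
     is_derive t 1 (fun t => Re (g t)) (Re (x * q t)) /\
     is_derive t 1 (fun t => Im (g t)) (Im (x * q t))) ->
  (forall t : R, 0 <= t <= 1 -> nrm (q t) <= K) ->
  nrm (g 1 - g 0) <= 2 * (nrm x * K).
Proof.
move=> gd qK.
have xqK t : 0 <= t <= 1 -> nrm (x * q t) <= nrm x * K.
  by move=> t01; rewrite nrmM ler_wpM2l ?nrm_ge0 ?qK.
apply: le_trans (nrm_le_ReIm _) _; rewrite ReD ImD ReN ImN.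
have -> : 2 * (nrm x * K) = nrm x * K + nrm x * K by ring.
apply: lerD.
  apply: (@mvt_bound (fun t => Re (g t)) (fun t => Re (x * q t))) => t t01.
    by have [] := gd t t01.
  exact: le_trans (nrm_Re _) (xqK _ t01).
apply: (@mvt_bound (fun t => Im (g t)) (fun t => Im (x * q t))) => t t01.
  by have [] := gd t t01.
exact: le_trans (nrm_Im _) (xqK _ t01).
Qed.

Lemma nrm_cexp_scale x (t : R) : 0 <= t <= 1 ->
  nrm (cexp (t%:C * x)) <= expR (nrm x).
Proof.
move=> /andP[t0 t1]; rewrite nrm_cexp ler_expR !ReImE mul0r subr0.
apply: le_trans (ler_norm _) _; rewrite normrM (ger0_norm t0).
apply: le_trans (_ : 1 * nrm x <= _); last by rewrite mul1r.
by rewrite ler_pM ?normr_ge0 ?nrm_Re.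
Qed.

Lemma nrm_scale x (t : R) : 0 <= t <= 1 -> nrm (t%:C * x) <= nrm x.
Proof.
move=> /andP[t0 t1]; rewrite nrmM nrmC (ger0_norm t0).
by rewrite ler_piMl ?nrm_ge0.
Qed.

Lemma cexp_sub1 x : nrm (cexp x - 1) <= 2 * (nrm x * expR (nrm x)).
Proof.
have := @path_bound (fun t => cexp (t%:C * x)) (fun t => cexp (t%:C * x)) x
  (expR (nrm x)).
rewrite mul1r mul0r cexp0; apply => t t01; last exact: nrm_cexp_scale.
by split; [exact: is_derive_Re_cexp | exact: is_derive_Im_cexp].
Qed.

(** Along t -> t x the derivative of a Taylor remainder is x times the previous remainder, so each
    bound follows from the preceding one by [path_bound]. *)
Lemma cexp_taylor2 x :
  nrm (cexp x - 1 - x) <= 4 * (nrm x ^+ 2 * expR (nrm x)).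
Proof.
have := @path_bound (fun t => cexp (t%:C * x) - t%:C * x)
  (fun t => cexp (t%:C * x) - 1) x (2 * (nrm x * expR (nrm x))).
rewrite mul1r mul0r cexp0 subr0.
have -> : cexp x - x - 1 = cexp x - 1 - x by ring.
have -> : 2 * (nrm x * (2 * (nrm x * expR (nrm x)))) =
  4 * (nrm x ^+ 2 * expR (nrm x)) by ring.
apply => t t01; last first.
  apply: le_trans (cexp_sub1 _) _; rewrite ler_pM2l //.
  by rewrite ler_pM ?nrm_ge0 ?expR_ge0 ?ler_expR ?nrm_scale.
split.
  under eq_fun do rewrite !ReImE !(mul0r, subr0, addr0).
  have h := is_derive_Re_cexp x t.
  apply: is_derive_eq; rewrite !ReImE /GRing.scale /= !(mul0r, subr0, addr0); ring.
under eq_fun do rewrite !ReImE !(mul0r, subr0, addr0).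
have h := is_derive_Im_cexp x t.
apply: is_derive_eq; rewrite !ReImE /GRing.scale /= !(mul0r, subr0, addr0); ring.
Qed.

Lemma cexp_taylor3 x :
  nrm (cexp x - 1 - x - x ^+ 2 / 2%:R) <= 8 * (nrm x ^+ 3 * expR (nrm x)).
Proof.
have := @path_bound (fun t => cexp (t%:C * x) - t%:C * x - (t ^+ 2 / 2)%:C * x ^+ 2)
  (fun t => cexp (t%:C * x) - 1 - t%:C * x) x (4 * (nrm x ^+ 2 * expR (nrm x))).
rewrite mul1r mul0r cexp0 subr0 expr0n mul0r mul0r subr0 expr1n.
have -> : cexp x - x - (1 / 2)%:C * x ^+ 2 - 1 = cexp x - 1 - x - x ^+ 2 / 2%:R.
  by rewrite mul1r CV -natC; ring.
have -> : 2 * (nrm x * (4 * (nrm x ^+ 2 * expR (nrm x)))) =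
  8 * (nrm x ^+ 3 * expR (nrm x)) by ring.
apply => t t01; last first.
  apply: le_trans (cexp_taylor2 _) _; rewrite ler_pM2l //.
  rewrite ler_pM ?expR_ge0 ?ler_expR ?nrm_scale ?exprn_ge0 ?nrm_ge0 //.
  by rewrite lerXn2r ?nnegrE ?nrm_ge0 ?nrm_scale.
split.
  under eq_fun do rewrite !ReImE !(mul0r, subr0, addr0).
  have h := is_derive_Re_cexp x t.
  apply: is_derive_eq; rewrite !ReImE /GRing.scale /= !(mul0r, subr0, addr0); by field.
under eq_fun do rewrite !ReImE !(mul0r, subr0, addr0).
have h := is_derive_Im_cexp x t.
apply: is_derive_eq; rewrite !ReImE /GRing.scale /= !(mul0r, subr0, addr0); by field.
Qed.

End ComplexBasics.

(** * Convergence of complex sequences and series, with dominated convergence *)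

Section ComplexSequences.
Variable R : realType.
Local Notation C := R[i].
Local Notation Re := (@complex.Re R).
Local Notation Im := (@complex.Im R).
Implicit Types (u v : nat -> C) (l : C) (b : nat -> R).

(** Convergence with a real epsilon; [cvCP] identifies it with convergence in the topology of [C^o],
    in which [fourier_expansion] is stated. *)
Definition cvC u l := forall e : R, 0 < e ->
  exists N, forall n, (N <= n)%N -> nrm (u n - l) <= e.

Definition cser u l := cvC (fun n => \sum_(0 <= k < n) u k) l.

Lemma le_eps_nrm x (K : R) : (forall e, 0 < e -> nrm x <= K + e) -> nrm x <= K.
Proof. by move=> h; apply/ler_addgt0Pr => e e0; apply: h. Qed.

Lemma cvC_unique u l l' : cvC u l -> cvC u l' -> l = l'.
Proof.
move=> ul ul'; apply/eqP; rewrite -subr_eq0 -nrm_eq0 eq_le nrm_ge0 andbT.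
apply: le_eps_nrm => e e0; have e20 : 0 < e / 2 by rewrite divr_gt0.
have [N h] := ul _ e20; have [N' h'] := ul' _ e20.
have := h _ (leq_maxl N N'); have := h' _ (leq_maxr N N').
set w := u _ => a1 a2; have -> : l - l' = (w - l') - (w - l) by ring.
apply: le_trans (nrmB _ _) _; lra.
Qed.

Lemma cvC_cst l : cvC (fun=> l) l.
Proof. by move=> e e0; exists 0%N => n _; rewrite subrr nrm0 ltW. Qed.

Lemma eq_cvC N u v l : (forall n, (N <= n)%N -> u n = v n) -> cvC u l -> cvC v l.
Proof.
move=> uv ul e e0; have [M h] := ul e e0; exists (maxn M N) => n.
by rewrite geq_max => /andP[Mn Nn]; rewrite -uv // h.
Qed.

Lemma cvC_ext u v l : u =1 v -> cvC u l -> cvC v l.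
Proof. by move=> uv; apply: (@eq_cvC 0). Qed.

Lemma cvCD u v l l' : cvC u l -> cvC v l' -> cvC (fun n => u n + v n) (l + l').
Proof.
move=> ul vl e e0; have e20 : 0 < e / 2 by rewrite divr_gt0.
have [N h] := ul _ e20; have [N' h'] := vl _ e20.
exists (maxn N N') => n; rewrite geq_max => /andP[/h a1 /h' a2].
have -> : u n + v n - (l + l') = (u n - l) + (v n - l') by ring.
apply: le_trans (nrmD _ _) _; lra.
Qed.

Lemma cvCZ c u l : cvC u l -> cvC (fun n => c * u n) (c * l).
Proof.
move=> ul e e0; have c1 : 0 < nrm c + 1 by rewrite ltr_wpDl ?nrm_ge0.
have [N h] := ul _ (divr_gt0 e0 c1); exists N => n /h a1.
rewrite -mulrBr nrmM; apply: le_trans (_ : (nrm c + 1) * (e / (nrm c + 1)) <= _).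
  by rewrite ler_pM ?nrm_ge0 // lerDl.
by rewrite mulrC divfK ?gt_eqF.
Qed.

Lemma cvCN u l : cvC u l -> cvC (fun n => - u n) (- l).
Proof.
by move=> /(cvCZ (-1)) h; rewrite -mulN1r; apply: cvC_ext h => n; rewrite mulN1r.
Qed.

Lemma cvCB u v l l' : cvC u l -> cvC v l' -> cvC (fun n => u n - v n) (l - l').
Proof. by move=> ul /cvCN; exact: cvCD. Qed.

Lemma cvC_sum I (r : seq I) (F : I -> nat -> C) (f : I -> C) :
  (forall i, cvC (F i) (f i)) ->
  cvC (fun n => \sum_(i <- r) F i n) (\sum_(i <- r) f i).
Proof.
move=> h; elim: r => [|i r IH].
  rewrite big_nil; apply: cvC_ext (@cvC_cst 0) => n; by rewrite big_nil.
rewrite big_cons; apply: cvC_ext (cvCD (h i) IH) => n; by rewrite big_cons.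
Qed.

Lemma cvC_subseq (s : nat -> nat) u l : (forall n, (n <= s n)%N) ->
  cvC u l -> cvC (fun n => u (s n)) l.
Proof.
move=> hs ul e e0; have [N h] := ul e e0; exists N => n Nn.
by apply: h; exact: leq_trans (hs n).
Qed.

Lemma cvC_shift u l : cvC (fun n => u n.+1) l -> cvC u l.
Proof.
move=> ul e e0; have [N h] := ul e e0; exists N.+1 => -[//|n] Nn; exact: h.
Qed.

Lemma cvC_le u l K : cvC u l -> (forall n, nrm (u n) <= K) -> nrm l <= K.
Proof.
move=> ul uK; apply: le_eps_nrm => e e0; have [N h] := ul e e0.
have := h N (leqnn _); have := uK N; set w := u N => a1 a2.
have -> : l = w - (w - l) by ring.
apply: le_trans (nrmB _ _) _; lra.
Qed.

Lemma cvC_squeeze u l b : (forall n, nrm (u n - l) <= b n) ->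
  (forall e, 0 < e -> exists N, forall n, (N <= n)%N -> b n <= e) -> cvC u l.
Proof.
move=> h hb e /hb [N hN]; exists N => n /hN; exact: le_trans.
Qed.

Lemma cserD u v l l' : cser u l -> cser v l' -> cser (fun n => u n + v n) (l + l').
Proof.
by move=> ul vl; apply: cvC_ext (cvCD ul vl) => n; rewrite big_split.
Qed.

Lemma cserZ c u l : cser u l -> cser (fun n => c * u n) (c * l).
Proof. by move=> ul; apply: cvC_ext (cvCZ c ul) => n; rewrite mulr_sumr. Qed.

Lemma cserN u l : cser u l -> cser (fun n => - u n) (- l).
Proof.
by move=> ul; apply: cvC_ext (cvCN ul) => n; rewrite (big_morph _ (@opprD _) (@oppr0 _)).
Qed.

Lemma cserB u v l l' : cser u l -> cser v l' -> cser (fun n => u n - v n) (l - l').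
Proof. by move=> ul /cserN; exact: cserD. Qed.

Lemma cser_ext u v l : u =1 v -> cser u l -> cser v l.
Proof. by move=> uv; apply: cvC_ext => n; apply: eq_bigr => k _. Qed.

Lemma cser_unique u l l' : cser u l -> cser u l' -> l = l'.
Proof. exact: cvC_unique. Qed.

Lemma cser_shift u l : cser (fun n => u n.+1) l -> cser u (u 0%N + l).
Proof.
move=> h; apply: cvC_shift; apply: cvC_ext (cvCD (cvC_cst (u 0%N)) h) => n.
by rewrite big_nat_recl.
Qed.

Lemma cser_behead u l : cser u l -> cser (fun n => u n.+1) (l - u 0%N).
Proof.
move=> h; have := cvC_subseq (fun n => leqnSn n) h.
move=> /cvCB/(_ (cvC_cst (u 0%N))); apply: cvC_ext => n.
by rewrite big_nat_recl //; ring.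
Qed.

Lemma cser_sum I (r : seq I) (F : I -> nat -> C) (f : I -> C) :
  (forall i, cser (F i) (f i)) ->
  cser (fun n => \sum_(i <- r) F i n) (\sum_(i <- r) f i).
Proof.
by move=> h; apply: cvC_ext (cvC_sum r h) => n; rewrite exchange_big.
Qed.

Lemma cvC_bounded u l : cvC u l -> exists K, forall n, nrm (u n) <= K.
Proof.
move=> /(_ 1 ltr01) [N h].
exists (\sum_(0 <= k < N) nrm (u k) + (nrm l + 1)) => n.
have S0 : 0 <= \sum_(0 <= k < N) nrm (u k) by apply: sumr_ge0 => k _; exact: nrm_ge0.
have [Nn|nN] := leqP N n.
  have := h n Nn; have := nrmD (u n - l) l; rewrite subrK; lra.
rewrite big_mkord (bigD1 (Ordinal nN)) //= -addrA lerDl addr_ge0 //.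
  by apply: sumr_ge0 => k _; exact: nrm_ge0.
by rewrite addr_ge0 ?nrm_ge0.
Qed.

Lemma cser_terms_bounded u l : cser u l -> exists K, forall n, nrm (u n) <= K.
Proof.
move=> /cvC_bounded [K h]; exists (K + K) => n.
have -> : u n = \sum_(0 <= k < n.+1) u k - \sum_(0 <= k < n) u k.
  by rewrite big_nat_recr //=; ring.
exact: le_trans (nrmB _ _) (lerD (h _) (h _)).
Qed.

Definition bsum b := (forall n, 0 <= b n) /\
  exists B, forall n, \sum_(0 <= k < n) b k <= B.

Lemma bsum_tail b : bsum b -> forall e, 0 < e ->
  exists K, forall n, \sum_(K <= k < n) b k <= e.
Proof.
move=> [b0 [B hB]] e e0; pose S n := \sum_(0 <= k < n) b k.
have Smono m n : (m <= n)%N -> S n = S m + \sum_(m <= k < n) b k.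
  by move=> mn; rewrite /S -big_cat_nat.
have Snd : {homo S : m n / (m <= n)%N >-> m <= n}.
  by move=> m n mn; rewrite (Smono _ _ mn) lerDl sumr_ge0.
have Sc : has_sup (range S).
  by split; [exists (S 0%N), 0%N | exists B => _ [n _ <-]; exact: hB].
have [_ [K _ <-]] := sup_adherent e0 Sc.
move=> hK; exists K => n; have [Kn|nK] := leqP K n; last first.
  by rewrite big_geq ?ltW // ltnW.
have : S n <= sup (range S) by apply: sup_upper_bound => //; exists n.
rewrite (Smono _ _ Kn); lra.
Qed.

Lemma bsumZ b c : 0 <= c -> bsum b -> bsum (fun n => c * b n).
Proof.
move=> c0 [b0 [B h]]; split=> [n|]; first by rewrite mulr_ge0.
by exists (c * B) => n; rewrite -mulr_sumr ler_wpM2l.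
Qed.

Lemma le_bsum b b' : (forall n, 0 <= b n <= b' n) -> bsum b' -> bsum b.
Proof.
move=> bb [b0 [B h]]; split=> [n|]; first by have /andP[] := bb n.
exists B => n; apply: le_trans (h n); apply: ler_sum => k _.
by have /andP[] := bb k.
Qed.

Lemma bsum_geo (x : R) : 0 <= x < 1 -> bsum (fun n => x ^+ n).
Proof.
move=> /andP[x0 x1]; split=> [n|]; first exact: exprn_ge0.
exists (1 - x)^-1 => n.
have x1' : 0 < 1 - x by rewrite subr_gt0.
rewrite -(ler_pM2l x1') mulfV ?gt_eqF // big_mkord.
have := subrX1 x n; have := exprn_ge0 n x0; set S := \sum_(_ < _) _; nra.
Qed.

Lemma bsum_le_cser u l b K : (forall n, nrm (u n) <= b n) -> cser u l ->
  (forall n, \sum_(0 <= k < n) b k <= K) -> nrm l <= K.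
Proof.
move=> ub ul bK; apply: cvC_le ul _ => n; apply: le_trans (nrm_sum _ _ _) _.
by apply: le_trans (bK n); apply: ler_sum.
Qed.

Lemma cser_tail u l b K e : (forall n, nrm (u n) <= b n) -> cser u l ->
  (forall n, \sum_(K <= k < n) b k <= e) ->
  nrm (l - \sum_(0 <= k < K) u k) <= e.
Proof.
move=> ub ul be.
have e0 : 0 <= e by have := be 0%N; rewrite big_geq.
have h : cvC (fun n => \sum_(0 <= k < n) u k - \sum_(0 <= k < K) u k)
    (l - \sum_(0 <= k < K) u k) by apply: cvCB ul (cvC_cst _).
have h' := cvC_subseq (fun n => leq_addl K n) h.
apply: cvC_le h' _ => n; rewrite (big_cat_nat (n := K)) //= ?leq_addr // [X in nrm X](_ : _ = \sum_(K <= k < K + n) u k); last by rewrite addrAC subrr add0r.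
by apply: le_trans (nrm_sum _ _ _) _; apply: le_trans (be _); apply: ler_sum.
Qed.

Lemma real_abs_cvg (a b : nat -> R) : (forall n, `|a n| <= b n) -> bsum b ->
  exists l : R, forall e : R, 0 < e -> exists N, forall n, (N <= n)%N ->
    `|\sum_(0 <= k < n) a k - l| <= e.
Proof.
move=> ab [b0 [B hB]].
have : cvgn (series a).
  apply: normed_cvg; apply: nondecreasing_is_cvgn.
    by apply: nondecreasing_series => n _ /=.
  exists B => _ [n _ <-]; apply: le_trans (hB n); rewrite /series /=.
  by apply: ler_sum => k _; exact: ab.
move=> /cvgrPdist_le ca; exists (limn (series a)) => e e0.
have [N _ h] := ca e e0; exists N => n Nn; rewrite distrC; exact: h.
Qed.

Lemma cser_abs u b : (forall n, nrm (u n) <= b n) -> bsum b -> exists l, cser u l.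
Proof.
move=> ub bb.
have [l1 h1] : exists l : R, forall e : R, 0 < e -> exists N, forall n, (N <= n)%N ->
    `|\sum_(0 <= k < n) Re (u k) - l| <= e.
  by apply: real_abs_cvg bb => n; exact: le_trans (nrm_Re _) (ub n).
have [l2 h2] : exists l : R, forall e : R, 0 < e -> exists N, forall n, (N <= n)%N ->
    `|\sum_(0 <= k < n) Im (u k) - l| <= e.
  by apply: real_abs_cvg bb => n; exact: le_trans (nrm_Im _) (ub n).
exists (l1 +i* l2) => e e0; have e20 : 0 < e / 2 by rewrite divr_gt0.
have [N hN] := h1 _ e20; have [M hM] := h2 _ e20; exists (maxn N M) => n.
rewrite geq_max => /andP[/hN a1 /hM a2]; apply: le_trans (nrm_le_ReIm _) _.
rewrite !ReImE Re_sum Im_sum; lra.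
Qed.

(** Dominated convergence for series: beyond an index K chosen for the majorant [b] both tails are
    at most e / 3, and below K only finitely many limits are taken. *)
Lemma tannery (a : nat -> nat -> C) a' b s s' :
  (forall m c, nrm (a m c) <= b c) -> bsum b ->
  (forall c, cvC (a^~ c) (a' c)) -> (forall m, cser (a m) (s m)) ->
  cser a' s' -> cvC s s'.
Proof.
move=> ab bb aa' as_ as' e e0; have e30 : 0 < e / 3 by rewrite divr_gt0.
have [K hK] := bsum_tail bb e30.
have a'b c : nrm (a' c) <= b c by apply: cvC_le (aa' c) _ => m.
have t' := cser_tail a'b as' hK.
have [N hN] := cvC_sum (index_iota 0 K) aa' e30.
exists N => n /hN; have := cser_tail (ab n) (as_ n) hK.
set S := \sum_(_ <- _) _; set S' := \sum_(0 <= k < K) a' k in t' *.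
move=> h1 h2; have -> : s n - s' = (s n - S) + (S - S') - (s' - S') by ring.
apply: le_trans (nrmB _ _) _; have := nrmD (s n - S) (S - S'); lra.
Qed.

(** Fubini for a double series dominated by a product: the partial sums over d, as functions of c,
    form the dominated sequence to which [tannery] applies. *)
Lemma double_series (r : nat -> nat -> C) b rho rho' X :
  (forall c d, nrm (r c d) <= b c * b d) -> bsum b ->
  (forall c, cser (r c) (rho c)) -> (forall d, cser (r^~ d) (rho' d)) ->
  cser rho X -> cser rho' X.
Proof.
move=> rb bb; have [b0 [B hB]] := bb => hr hr' hX.
have B0 : 0 <= B by have := hB 0%N; rewrite big_geq.
apply: (@tannery (fun m c => \sum_(0 <= d < m) r c d) rho (fun c => b c * B)).
- move=> m c; apply: le_trans (nrm_sum _ _ _) _.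
  apply: le_trans (_ : \sum_(0 <= d < m) b c * b d <= _); first exact: ler_sum.
  by rewrite -mulr_sumr ler_wpM2l.
- by apply: le_bsum (bsumZ B0 bb) => n; rewrite mulr_ge0 //= mulrC.
- exact: hr.
- by move=> m; apply: cser_sum.
- exact: hX.
Qed.

Lemma cser_tele (u : nat -> C) : cvC u 0 -> cser (fun n => u n - u n.+1) (u 0%N).
Proof.
move=> u0; have h := cvCB (cvC_cst (u 0%N)) u0; rewrite subr0 in h.
apply: cvC_ext h => n; elim: n => [|n IH]; first by rewrite big_geq // subrr.
by rewrite big_nat_recr //= -IH; ring.
Qed.

End ComplexSequences.

(** * Complex derivatives with a quadratic remainder *)

Section QuadraticDerivative.
Variable R : realType.
Local Notation C := R[i].
Local Notation Re := (@complex.Re R).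
Local Notation Im := (@complex.Im R).
Implicit Types (f g : C -> C) (z d e h : C).

(* Complex differentiability with a quadratic remainder: strong enough to give [derivable],
   and stable under the locally uniform estimates available for q-series. *)
Definition qder f z d := exists K r : R, 0 < r /\
  forall h, nrm h < r -> nrm (f (z + h) - f z - d * h) <= K * nrm h ^+ 2.

Lemma qder_lip f z d : qder f z d -> exists K r : R, [/\ 0 < r, 0 <= K &
  forall h, nrm h < r -> nrm (f (z + h) - f z) <= K * nrm h].
Proof.
move=> [K [r [r0 H]]]; exists (nrm d + `|K| * r), r; split => //.
  by rewrite addr_ge0 ?nrm_ge0 ?mulr_ge0 ?normr_ge0 ?ltW.
move=> h hr; have -> : f (z + h) - f z = f (z + h) - f z - d * h + d * h by ring.
apply: le_trans (nrmD _ _) _; rewrite nrmM.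
have a1 := H h hr.
have a2 : K * nrm h ^+ 2 <= `|K| * r * nrm h.
  rewrite expr2 mulrA ler_wpM2r ?nrm_ge0 //.
  apply: le_trans (ler_wpM2r (nrm_ge0 h) (ler_norm K)) _.
  by rewrite ler_wpM2l ?normr_ge0 // ltW.
by rewrite mulrDl addrC lerD // (le_trans a1).
Qed.

Lemma qder_id z : qder id z 1.
Proof.
exists 0, 1; split=> // h _; rewrite mul0r mul1r /=.
by rewrite [z + h]addrC addrK subrr nrm0.
Qed.

Lemma qder_cst c z : qder (fun=> c) z 0.
Proof.
exists 0, 1; split=> // h _.
by rewrite subrr mul0r subr0 nrm0 mul0r.
Qed.

Lemma qderD f g z d e : qder f z d -> qder g z e ->
  qder (fun w => f w + g w) z (d + e).
Proof.
move=> [K [r [r0 Hf]]] [K' [r' [r'0 Hg]]]; exists (K + K'), (Num.min r r').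
split=> [|h]; first by rewrite lt_min r0 r'0.
rewrite lt_min => /andP[/Hf a1 /Hg a2]; rewrite [leRHS]mulrDl /=.
have -> : f (z + h) + g (z + h) - (f z + g z) - (d + e) * h =
  (f (z + h) - f z - d * h) + (g (z + h) - g z - e * h) by ring.
exact: le_trans (nrmD _ _) (lerD a1 a2).
Qed.

Lemma qderZ c f z d : qder f z d -> qder (fun w => c * f w) z (c * d).
Proof.
move=> [K [r [r0 Hf]]]; exists (nrm c * K), r; split=> // h /Hf a1.
have -> : c * f (z + h) - c * f z - c * d * h = c * (f (z + h) - f z - d * h)
  by ring.
by rewrite nrmM -mulrA ler_wpM2l ?nrm_ge0.
Qed.

Lemma qderN f z d : qder f z d -> qder (fun w => - f w) z (- d).
Proof.
by move=> /(qderZ (-1)); rewrite mulN1r; under eq_fun do rewrite mulN1r.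
Qed.

Lemma qderB f g z d e : qder f z d -> qder g z e ->
  qder (fun w => f w - g w) z (d - e).
Proof. by move=> hf /qderN; exact: qderD. Qed.

Lemma qder_sum I (r : seq I) (F : I -> C -> C) z (D : I -> C) :
  (forall i, qder (F i) z (D i)) ->
  qder (fun w => \sum_(i <- r) F i w) z (\sum_(i <- r) D i).
Proof.
move=> h; elim: r => [|i r IH].
  by rewrite big_nil; under eq_fun do rewrite big_nil; exact: qder_cst.
by rewrite big_cons; under eq_fun do rewrite big_cons; exact: qderD.
Qed.

Lemma qderM f g z d e : qder f z d -> qder g z e ->
  qder (fun w => f w * g w) z (d * g z + f z * e).
Proof.
move=> hf hg; have [Lf [rf [rf0 Lf0 Hlf]]] := qder_lip hf.
have [Lg [rg [rg0 Lg0 Hlg]]] := qder_lip hg.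
move: hf hg => [K [r [r0 Hf]]] [K' [r' [r'0 Hg]]].
exists (Lf * Lg + K * nrm (g z) + nrm (f z) * K').
exists (Num.min (Num.min rf rg) (Num.min r r')).
split=> [|h]; first by rewrite !lt_min rf0 rg0 r0 r'0.
rewrite !lt_min => /andP[/andP[/Hlf a1 /Hlg a2] /andP[/Hf a3 /Hg a4]].
set X := f (z + h) - f z in a1; set Y := g (z + h) - g z in a2.
have -> : f (z + h) * g (z + h) - f z * g z - (d * g z + f z * e) * h =
  X * Y + (f (z + h) - f z - d * h) * g z + f z * (g (z + h) - g z - e * h).
  by rewrite /X /Y; ring.
apply: le_trans (nrmD _ _) _; apply: le_trans (lerD (nrmD _ _) (lexx _)) _.
rewrite !nrmM.
have h1 : nrm X * nrm Y <= Lf * nrm h * (Lg * nrm h) by rewrite ler_pM ?nrm_ge0.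
have h2 := ler_wpM2r (nrm_ge0 (g z)) a3.
have h3 := ler_wpM2l (nrm_ge0 (f z)) a4.
have -> : (Lf * Lg + K * nrm (g z) + nrm (f z) * K') * nrm h ^+ 2 =
 Lf * nrm h * (Lg * nrm h) + K * nrm h ^+ 2 * nrm (g z) +
  nrm (f z) * (K' * nrm h ^+ 2) by ring.
by rewrite !lerD.
Qed.

Lemma qder_comp f g z d e : qder f z d -> qder g (f z) e ->
  qder (fun w => g (f w)) z (e * d).
Proof.
move=> hf [K' [r' [r'0 Hg]]]; have [L [rl [rl0 L0 Hl]]] := qder_lip hf.
move: hf => [K [r [r0 Hf]]].
exists (`|K'| * L ^+ 2 + nrm e * K), (Num.min (Num.min rl r) (r' / (L + 1))).
have L1 : 0 < L + 1 by rewrite ltr_wpDl.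
split=> [|h]; first by rewrite !lt_min rl0 r0 divr_gt0.
rewrite !lt_min => /andP[/andP[/Hl a1 /Hf a2]]; rewrite ltr_pdivlMr // => a3.
set k := f (z + h) - f z in a1.
have kr : nrm k < r'.
  apply: le_lt_trans a1 _; apply: le_lt_trans a3; rewrite mulrC.
  by rewrite ler_wpM2l ?nrm_ge0 // lerDl.
have := Hg k kr; have -> : f z + k = f (z + h) by rewrite /k; ring.
move=> a4.
have -> : g (f (z + h)) - g (f z) - e * d * h =
  (g (f (z + h)) - g (f z) - e * k) + e * (f (z + h) - f z - d * h).
  by rewrite /k; ring.
apply: le_trans (nrmD _ _) _; rewrite [nrm (e * _)]nrmM mulrDl; apply: lerD.
  apply: le_trans a4 _.
  apply: le_trans (_ : `|K'| * nrm k ^+ 2 <= _).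
    by rewrite ler_wpM2r ?exprn_ge0 ?nrm_ge0 ?ler_norm.
  rewrite -mulrA ler_wpM2l ?normr_ge0 // -exprMn.
  by rewrite lerXn2r ?nnegrE ?mulr_ge0 ?nrm_ge0.
by rewrite -mulrA ler_wpM2l ?nrm_ge0.
Qed.

Lemma qder_inv z : z != 0 -> qder (fun w => w^-1) z (- z ^- 2).
Proof.
move=> z0; have n0 : 0 < nrm z by rewrite nrm_gt0.
exists (2 / nrm z ^+ 3), (nrm z / 2); split=> [|h hr].
  by rewrite divr_gt0.
have zh : nrm z / 2 <= nrm (z + h) by have := nrm_lower z h; lra.
have zh0 : z + h != 0 by rewrite -nrm_gt0; lra.
have -> : (z + h)^-1 - z^-1 - - z ^- 2 * h = h ^+ 2 * (z ^- 2 * (z + h)^-1).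
  by field; rewrite z0 zh0.
rewrite [nrm (h ^+ 2 * _)]nrmM [nrm (z ^- 2 * _)]nrmM !nrmV !nrmX mulrC ler_wpM2r ?exprn_ge0 ?nrm_ge0 //.
have -> : 2 / nrm z ^+ 3 = (nrm z ^+ 2)^-1 * (nrm z / 2)^-1.
  by field; rewrite gt_eqF.
rewrite ler_wpM2l ?invr_ge0 ?exprn_ge0 ?nrm_ge0 //.
by rewrite lef_pV2 ?posrE // ?nrm_gt0 // divr_gt0.
Qed.

Lemma qder_eqH f g z d : 0 < Im z -> (forall w, 0 < Im w -> f w = g w) ->
  qder f z d -> qder g z d.
Proof.
move=> z0 fg [K [r [r0 H]]]; exists K, (Num.min r (Im z)).
split=> [|h]; first by rewrite lt_min r0 z0.
rewrite lt_min => /andP[hr hz]; rewrite -!fg ?H // ImD.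
have := nrm_Im h; rewrite ler_norml => /andP[]; lra.
Qed.

Lemma real_quad_derive (phi : R -> R) (t d : R) :
  (exists K r : R, 0 < r /\ forall h : R, `|h| < r ->
     `|phi (t + h) - phi t - d * h| <= K * h ^+ 2) ->
  is_derive t 1 phi d.
Proof.
move=> [K [r [r0 H]]].
have cv : h^-1 *: (phi (h *: 1 + t) - phi t) @[h --> 0^'] --> d.
  apply/cvgrPdist_le => /= e e0.
  have K1 : 0 < `|K| + 1 by rewrite ltr_wpDl.
  near=> h; have h0 : h != 0 by near: h; exact: nbhs_dnbhs_neq.
  have hr : `|h| < r by near: h; apply: dnbhs0_lt.
  have he : `|h| < e / (`|K| + 1) by near: h; apply: dnbhs0_lt; rewrite divr_gt0.
  rewrite /GRing.scale /= mulr1.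
  have -> : d - h^-1 * (phi (h + t) - phi t) = - (h^-1 * (phi (t + h) - phi t - d * h)).
    by rewrite [h + t]addrC; field.
  rewrite normrN normrM normfV.
  rewrite mulrC ler_pdivrMr ?normr_gt0 //.
  apply: le_trans (H _ hr) _; rewrite -(real_normK (num_real h)) expr2 mulrA.
  rewrite ler_wpM2r //; move: he; rewrite ltr_pdivlMr // => he.
  have := ler_norm K; have := normr_ge0 h; nra.
apply: DeriveDef; first by apply/cvg_ex; exists d.
by apply: cvg_lim.
Unshelve. all: by end_near. Qed.

Lemma is_derive_Re_path f z v (t : R) d : qder f (z + t%:C * v) d ->
  is_derive t 1 (fun t : R => Re (f (z + t%:C * v))) (Re (d * v)).
Proof.
move=> [K [r [r0 H]]]; apply: real_quad_derive.
have v1 : 0 < nrm v + 1 by rewrite ltr_wpDl ?nrm_ge0.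
exists (K * nrm v ^+ 2), (r / (nrm v + 1)); split=> [|h]; first by rewrite divr_gt0.
rewrite ltr_pdivlMr // => hr.
have hv : nrm (h%:C * v) < r.
  by rewrite nrmM nrmC; apply: le_lt_trans hr; rewrite ler_wpM2l // lerDl.
have := H _ hv; rewrite nrmM nrmC exprMn real_normK ?num_real //.
have -> : K * (h ^+ 2 * nrm v ^+ 2) = K * nrm v ^+ 2 * h ^+ 2 by ring.
apply: le_trans.
have -> : z + t%:C * v + h%:C * v = z + (t + h)%:C * v by rewrite CD; ring.
apply: le_trans (nrm_Re _); rewrite !ReImE.
by rewrite le_eqVlt; apply/orP; left; apply/eqP; congr `|_|; ring.
Qed.

Lemma is_derive_Im_path f z v (t : R) d : qder f (z + t%:C * v) d ->
  is_derive t 1 (fun t : R => Im (f (z + t%:C * v))) (Im (d * v)).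
Proof.
move=> h; have := is_derive_Re_path (qderZ (- 'i%C) h).
have E w : Re (- 'i%C * w) = Im w by rewrite !ReImE; ring.
by rewrite -mulrA E; under eq_fun do rewrite E.
Qed.

Lemma qder_derivable f z d : qder f z d -> derivable (f : C^o -> C^o) z 1.
Proof.
move=> [K [r [r0 H]]]; apply/cvg_ex; exists d; apply/cvgrPdist_le => /= e e0.
have [eI eR] : Im e = 0 /\ 0 < Re e by move: e0; rewrite ltcE /= => /andP[/eqP].
have K1 : 0 < `|K| + 1 by rewrite ltr_wpDl.
near=> h; have h0 : h != 0 by near: h; exact: (nbhs_dnbhs_neq (0 : C^o)).
have hr : nrm h < r.
  rewrite -ltcR -normE; near: h; apply: (@dnbhs0_lt _ C^o); by rewrite ltcR.
have he : nrm h < Re e / (`|K| + 1).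
  by rewrite -ltcR -normE; near: h; apply: (@dnbhs0_lt _ C^o); rewrite ltcR divr_gt0.
rewrite /GRing.scale /= mulr1.
have -> : d - h^-1 * (f (h + z) - f z) = - (h^-1 * (f (z + h) - f z - d * h)).
  by rewrite [h + z]addrC; field.
rewrite normrN normE lecE /= eI eqxx /= nrmM nrmV.
have hn : 0 < nrm h by rewrite nrm_gt0.
rewrite mulrC ler_pdivrMr //.
apply: le_trans (H _ hr) _; rewrite expr2 mulrA ler_wpM2r ?nrm_ge0 //.
move: he; rewrite ltr_pdivlMr // => he.
have := ler_norm K; nra.
Unshelve. all: by end_near. Qed.

(** The upper half-plane is convex, so the segment from [z1] to [z2] stays in it, and [path_bound]
    applies with the bound 0. *)
Lemma qder_const_H f z1 z2 : (forall z, 0 < Im z -> qder f z 0) ->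
  0 < Im z1 -> 0 < Im z2 -> f z1 = f z2.
Proof.
move=> f0 h1 h2.
have hs t : 0 <= t <= 1 -> 0 < Im (z1 + t%:C * (z2 - z1)).
  by move=> /andP[t0 t1]; rewrite !ReImE; nra.
have := @path_bound R (fun t => f (z1 + t%:C * (z2 - z1))) (fun=> 0) (z2 - z1) 0.
rewrite mul1r mul0r addr0 !mulr0.
have -> : z1 + (z2 - z1) = z2 by ring.
move=> h.
apply/esym/eqP; rewrite -subr_eq0 -nrm_eq0 eq_le nrm_ge0 andbT h // => t t01.
  rewrite -[0](mul0r (z2 - z1)).
  by split; [apply: is_derive_Re_path | apply: is_derive_Im_path]; apply: f0; apply: hs.
by rewrite nrm0.
Qed.

End QuadraticDerivative.

(** * q-series on the upper half-plane *)

Section QSeries.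
Variable R : realType.
Local Notation C := R[i].
Local Notation Re := (@complex.Re R).
Local Notation Im := (@complex.Im R).
Implicit Types (a b : nat -> C) (F G : C -> C) (l m t e : R).

Definition ex t (z : C) : C := cexp ('i%C * t%:C * z).

Lemma ex0 z : ex 0 z = 1.
Proof. by rewrite /ex mulr0 mul0r cexp0. Qed.

Lemma nrm_ex t z : nrm (ex t z) = expR (- (t * Im z)).
Proof. by rewrite /ex nrm_cexp !ReImE; congr expR; ring. Qed.

Lemma exDl s t z : ex (s + t) z = ex s z * ex t z.
Proof. by rewrite /ex -cexpD CD; congr cexp; ring. Qed.

Lemma exDr t z w : ex t (z + w) = ex t z * ex t w.
Proof. by rewrite /ex -cexpD; congr cexp; ring. Qed.

Lemma exXn t n z : ex (t * n%:R) z = ex t z ^+ n.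
Proof. by rewrite /ex -cexpXn CM -natC; congr cexp; ring. Qed.

Lemma ex_neq0 t z : ex t z != 0. Proof. exact: cexp_neq0. Qed.

Lemma ex_taylor t z h : 0 <= t ->
  nrm (ex t (z + h) - ex t z - 'i%C * t%:C * ex t z * h) <=
  4 * ((t * nrm h) ^+ 2 * expR (t * nrm h)) * expR (- (t * Im z)).
Proof.
move=> t0; rewrite exDr.
have -> : ex t z * ex t h - ex t z - 'i%C * t%:C * ex t z * h =
  ex t z * (ex t h - 1 - 'i%C * t%:C * h) by ring.
rewrite nrmM nrm_ex mulrC ler_wpM2r ?expR_ge0 //.
apply: le_trans (cexp_taylor2 _) _.
by rewrite !nrmM nrm_i mul1r nrmC ger0_norm.
Qed.

(** Subexponential growth is equivalent to convergence of the q-series at every point of the upper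
    half-plane: see [qsumP] and, conversely, [isq_growth]. *)
Definition growth a := forall e, 0 < e -> exists2 B, 0 <= B &
  forall n, nrm (a n) <= B * expR (e * n%:R).

Lemma growthZ c a : growth a -> growth (fun n => c * a n).
Proof.
move=> ga e e0; have [B B0 hB] := ga e e0; exists (nrm c * B).
  by rewrite mulr_ge0 ?nrm_ge0.
by move=> n; rewrite nrmM -mulrA ler_wpM2l ?nrm_ge0.
Qed.

Lemma growth_le a b : (forall n, nrm (a n) <= nrm (b n)) -> growth b -> growth a.
Proof.
move=> ab gb e e0; have [B B0 hB] := gb e e0; exists B => // n.
exact: le_trans (ab n) (hB n).
Qed.

Lemma le_expR (x : R) : x <= expR x.
Proof. by apply: le_trans (expR_ge1Dx x); rewrite lerDr. Qed.

Lemma expRN_itv t : 0 < t -> 0 <= expR (- t) < 1.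
Proof. by move=> t0; rewrite expR_ge0 -[ltRHS]expR0 ltr_expR oppr_lt0. Qed.

Lemma growthM_nat a : growth a -> growth (fun n => n%:R * a n).
Proof.
move=> ga e e0; have e20 : 0 < e / 2 by rewrite divr_gt0.
have [B B0 hB] := ga _ e20; exists (2 / e * B).
  by rewrite mulr_ge0 // divr_ge0 // ltW.
move=> n; rewrite nrmM nrm_nat.
have h : n%:R <= 2 / e * expR (e / 2 * n%:R).
  rewrite -ler_pdivrMl ?divr_gt0 // invf_div; exact: le_expR.
have -> : e * n%:R = e / 2 * n%:R + e / 2 * n%:R by field.
rewrite expRD.
have -> : 2 / e * B * (expR (e / 2 * n%:R) * expR (e / 2 * n%:R)) =
  2 / e * expR (e / 2 * n%:R) * (B * expR (e / 2 * n%:R)) by ring.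
by rewrite ler_pM ?nrm_ge0.
Qed.

Lemma growth_cst c : growth (fun=> c).
Proof.
move=> e e0; exists (nrm c); first exact: nrm_ge0.
by move=> n; rewrite ler_peMr ?nrm_ge0 // -expR0 ler_expR mulr_ge0 // ltW.
Qed.

(** [l] is the frequency: a Fourier expansion of period w has l = 2 pi / w. As a real parameter it
    covers cusp widths and rescalings of z alike. *)
Definition qterm l a z n := a n * ex (l * n%:R) z.
Definition qsum l a z : C := xget 0 [set s | cser (qterm l a z) s].

Lemma nrm_qterm l a z n : nrm (qterm l a z n) = nrm (a n) * expR (- (l * Im z)) ^+ n.
Proof.
rewrite /qterm nrmM nrm_ex -expRM_natr; congr (_ * expR _); ring.
Qed.

Lemma qsumP l a z : 0 < l -> growth a -> 0 < Im z ->
  cser (qterm l a z) (qsum l a z).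
Proof.
move=> l0 ga z0; rewrite /qsum.
suff [s hs] : exists s, cser (qterm l a z) s by apply: (@xgetPex _ 0 _ (ex_intro _ s hs)).
have e0 : 0 < l * Im z / 2 by rewrite divr_gt0 ?mulr_gt0.
have [B B0 hB] := ga _ e0.
apply: (@cser_abs _ _ (fun n => B * expR (- (l * Im z / 2)) ^+ n)).
  move=> n; rewrite nrm_qterm.
  apply: le_trans (ler_wpM2r (exprn_ge0 _ (expR_ge0 _)) (hB n)) _.
  rewrite -!expRM_natr -[leLHS]mulrA ler_wpM2l // -expRD ler_expR le_eqVlt.
  by apply/orP; left; apply/eqP; field.
by apply: bsumZ => //; apply: bsum_geo; exact: expRN_itv.
Qed.

Definition isq l a F := 0 < l /\ forall z, 0 < Im z -> cser (qterm l a z) (F z).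

(** At height e / l the n-th exponential has modulus exp(- e n), and the terms of the convergent
    series are bounded there. *)
Lemma isq_growth l a F : isq l a F -> growth a.
Proof.
move=> [l0 h] e e0; pose z : C := 0 +i* (e / l).
have z0 : 0 < Im z by rewrite divr_gt0.
have [K hK] := cser_terms_bounded (h z z0); exists K.
  by apply: le_trans (hK 0%N); exact: nrm_ge0.
move=> n; have := hK n; rewrite nrm_qterm -expRM_natr.
have -> : - (l * Im z) * n%:R = - (e * n%:R).
  by rewrite /z Im_pair mulrCA mulfV ?gt_eqF // mulr1 mulNr.
by rewrite expRN ler_pdivrMr ?expR_gt0.
Qed.

Lemma isqE l a F z : isq l a F -> 0 < Im z -> F z = qsum l a z.
Proof.
move=> h z0; apply: cser_unique (h.2 z z0) (qsumP _ _ z0); first exact: h.1.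
exact: isq_growth h.
Qed.

Lemma growth_isq l a : 0 < l -> growth a -> isq l a (qsum l a).
Proof. by move=> l0 ga; split => // z z0; exact: qsumP. Qed.

Lemma isq_ext l a b F G : isq l a F -> a =1 b ->
  (forall z, 0 < Im z -> F z = G z) -> isq l b G.
Proof.
move=> [l0 h] ab FG; split=> // z z0; rewrite -FG //.
by apply: cser_ext (h z z0) => n; rewrite /qterm ab.
Qed.

Lemma qder_qsum l a z : 0 < l -> growth a -> 0 < Im z ->
  qder (qsum l a) z ('i%C * l%:C * qsum l (fun n => n%:R * a n) z).
Proof.
move=> l0 ga z0; set y := Im z in z0.
have y40 : 0 < l * y / 4 by rewrite divr_gt0 ?mulr_gt0.
have [B B0 hB] := ga _ y40.
(* Put t = l n. Of the decay exp(- t y), one quarter absorbs the growth of [a n], one the factor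
   exp(t |h|) with |h| < y / 4, and one the factor t^2; the remaining quarter is x^n. In [K0], 256
   is the 4 of [ex_taylor] times the 64 of t^2 <= 64 / y^2 * exp(t y / 4). *)
pose x := expR (- (l * y / 4)).
have x01 : 0 <= x < 1 by exact: expRN_itv.
have [_ [S hS]] := bsum_geo x01.
pose K0 := B * (256 / y ^+ 2).
have K00 : 0 <= K0 by rewrite mulr_ge0 // divr_ge0 // exprn_ge0 // ltW.
exists (K0 * S), (y / 4); split=> [|h hy]; first by rewrite divr_gt0.
have zh0 : 0 < Im (z + h).
  by rewrite ImD; have := nrm_Im h; rewrite ler_norml -/y => /andP[]; lra.
have gn := growthM_nat ga.
have Hs : cser (fun n => qterm l a (z + h) n - qterm l a z n -
   'i%C * l%:C * h * qterm l (fun n => n%:R * a n) z n)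
  (qsum l a (z + h) - qsum l a z -
   'i%C * l%:C * qsum l (fun n => n%:R * a n) z * h).
  have -> : 'i%C * l%:C * qsum l (fun n => n%:R * a n) z * h =
    'i%C * l%:C * h * qsum l (fun n => n%:R * a n) z by ring.
  by apply: cserB; [apply: cserB | apply: cserZ]; apply: qsumP.
apply: (@bsum_le_cser _ _ _ (fun n => K0 * nrm h ^+ 2 * x ^+ n)) Hs _; last first.
  move=> n; rewrite -mulr_sumr.
  have -> : K0 * S * nrm h ^+ 2 = K0 * nrm h ^+ 2 * S by ring.
  by rewrite ler_wpM2l // mulr_ge0 // exprn_ge0 // nrm_ge0.
move=> n; rewrite /qterm.
have -> : a n * ex (l * n%:R) (z + h) - a n * ex (l * n%:R) z -
  'i%C * l%:C * h * (n%:R * a n * ex (l * n%:R) z) =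
  a n * (ex (l * n%:R) (z + h) - ex (l * n%:R) z -
     'i%C * (l * n%:R)%:C * ex (l * n%:R) z * h) by rewrite CM -natC; ring.
rewrite nrmM; set t := l * n%:R.
have t0 : 0 <= t by rewrite mulr_ge0 // ltW.
apply: le_trans (_ : B * expR (t * (y / 4)) *
    (4 * ((t * nrm h) ^+ 2 * expR (t * (y / 4))) * expR (- (t * y))) <= _).
  apply: ler_pM; rewrite ?nrm_ge0 //.
    by apply: le_trans (hB n) _; rewrite ler_wpM2l // ler_expR /t; nra.
  apply: le_trans (ex_taylor z h t0) _; rewrite ler_wpM2r ?expR_ge0 //.
  apply: ler_wpM2l => //; apply: ler_wpM2l.
    by apply: exprn_ge0; rewrite mulr_ge0 ?nrm_ge0.
  by rewrite ler_expR; apply: ler_wpM2l => //; exact: ltW.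
have tb : t * (y / 8) <= expR (t * (y / 8)) by exact: le_expR.
have tb2 : t ^+ 2 <= 64 / y ^+ 2 * expR (t * (y / 4)).
  have -> : t * (y / 4) = t * (y / 8) + t * (y / 8) by field.
  rewrite -ler_pdivrMl; last by rewrite divr_gt0 ?exprn_gt0.
  rewrite expRD -expr2 invf_div.
  have -> : y ^+ 2 / 64 * t ^+ 2 = (t * (y / 8)) ^+ 2 by field.
  by rewrite lerXn2r ?nnegrE ?expR_ge0 // mulr_ge0 // divr_ge0 // ltW.
have xE : x ^+ n = expR (t * (y / 4)) * expR (t * (y / 4)) * expR (t * (y / 4))
    * expR (- (t * y)).
  by rewrite /x -expRM_natr -!expRD /t; congr expR; field.
rewrite xE exprMn /K0.
set E := expR (t * (y / 4)) in tb2 *; set E' := expR (- (t * y)).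
have -> : B * E * (4 * (t ^+ 2 * nrm h ^+ 2 * E) * E') =
  B * 4 * nrm h ^+ 2 * (E * E) * E' * t ^+ 2 by ring.
have -> : B * (256 / y ^+ 2) * nrm h ^+ 2 * (E * E * E * E') =
  B * 4 * nrm h ^+ 2 * (E * E) * E' * (64 / y ^+ 2 * E).
  by field; rewrite gt_eqF.
rewrite ler_wpM2l // !mulr_ge0 ?expR_ge0 ?exprn_ge0 ?nrm_ge0 //.
Qed.

Lemma isq_qder l a F z : isq l a F -> 0 < Im z ->
  qder F z ('i%C * l%:C * qsum l (fun n => n%:R * a n) z).
Proof.
move=> h z0; have ga := isq_growth h.
apply: qder_eqH z0 _ (qder_qsum h.1 ga z0) => w w0; by rewrite (isqE h).
Qed.

(** The threshold 1/2 lies below sqrt 3 / 2, the lowest height of the fundamental domain, so the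
    decay is uniform on all of it. *)
Lemma qsum_bound l a : 0 < l -> growth a -> exists2 K, 0 <= K &
  forall z, 1 / 2 <= Im z -> nrm (qsum l a z - a 0%N) <= K * expR (- (l * Im z)).
Proof.
move=> l0 ga; have l40 : 0 < l / 4 by rewrite divr_gt0.
have [B B0 hB] := ga _ l40; pose x := expR (- (l / 4)).
have x01 : 0 <= x < 1 by exact: expRN_itv.
have [_ [S hS]] := bsum_geo x01.
have S0 : 0 <= S by have := hS 0%N; rewrite big_geq.
exists (B * expR (l / 4) * S); first by rewrite !mulr_ge0 ?expR_ge0.
move=> z z0; have z0' : 0 < Im z by apply: lt_le_trans z0.
have := cser_behead (qsumP l0 ga z0').
have -> : qterm l a z 0 = a 0%N by rewrite /qterm mulr0 ex0 mulr1.
move=> hs.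
apply: (@bsum_le_cser _ _ _
   (fun n => B * expR (l / 4) * expR (- (l * Im z)) * x ^+ n)) hs _; last first.
  move=> n; rewrite -mulr_sumr.
  have -> : B * expR (l / 4) * S * expR (- (l * Im z)) =
    B * expR (l / 4) * expR (- (l * Im z)) * S by ring.
  by rewrite ler_wpM2l // !mulr_ge0 ?expR_ge0.
move=> n; rewrite nrm_qterm.
apply: le_trans (ler_wpM2r (exprn_ge0 _ (expR_ge0 _)) (hB n.+1)) _.
rewrite /x -!expRM_natr -!mulrA ler_wpM2l // -!expRD ler_expR.
rewrite -[n.+1%:R]natr1; have : 0 <= n%:R * (l * (Im z - 1 / 2)).
  by rewrite !mulr_ge0 ?ler0n ?subr_ge0 // ltW.
have : 0 <= n%:R :> R by []; set N := n%:R; nra.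
Qed.

Lemma isq_bound l a F : isq l a F -> exists2 K, 0 <= K &
  forall z, 1 / 2 <= Im z -> nrm (F z - a 0%N) <= K * expR (- (l * Im z)).
Proof.
move=> h; have [K K0 hK] := qsum_bound h.1 (isq_growth h); exists K => // z zh.
by rewrite (isqE h) ?hK //; apply: lt_le_trans zh.
Qed.

Lemma expR_small l K e : 0 < l -> 0 <= K -> 0 < e ->
  exists2 Y : R, 2 <= Y & forall y, Y <= y -> K * expR (- (l * y)) <= e.
Proof.
move=> l0 K0 e0; exists (2 + K / (l * e)).
  by rewrite lerDl divr_ge0 // mulr_ge0 // ltW.
move=> y hy; rewrite expRN ler_pdivrMr ?expR_gt0 //.
have h1 : K <= e * (l * y).
  have -> : K = e * (l * (K / (l * e))) by field; rewrite !gt_eqF.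
  by rewrite ler_pM2l // ler_pM2l //; lra.
by apply: le_trans h1 _; rewrite ler_pM2l // le_expR.
Qed.

(** Both constant terms are the limit of the function at i infinity; hence the constant term depends
    neither on the frequency nor on the values at low height. *)
Lemma isq_a0_unique l a m b F G : isq l a F -> isq m b G ->
  (forall z, 1 < Im z -> F z = G z) -> a 0%N = b 0%N.
Proof.
move=> hF hG FG; have [K K0 hK] := isq_bound hF; have [K' K'0 hK'] := isq_bound hG.
apply/eqP; rewrite -subr_eq0 -nrm_eq0 eq_le nrm_ge0 andbT.
apply: le_eps_nrm => e e0; have e20 : 0 < e / 2 by rewrite divr_gt0.
have [Y Y1 hY] := expR_small hF.1 K0 e20.
have [Y' Y'1 hY'] := expR_small hG.1 K'0 e20.
pose z : C := 0 +i* (Y + Y').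
have z2 : 1 < Im z by rewrite /z Im_pair; lra.
have z3 : 1 / 2 <= Im z by lra.
have := hK z z3; have := hK' z z3; rewrite -FG //.
have := hY (Im z); have := hY' (Im z); rewrite !Im_pair.
move=> /(_ ltac:(lra)) h1 /(_ ltac:(lra)) h2 h3 h4.
have -> : a 0%N - b 0%N = (F z - b 0%N) - (F z - a 0%N) by ring.
apply: le_trans (nrmB _ _) _; lra.
Qed.

Lemma isq0 l : 0 < l -> isq l (fun=> 0) (fun=> 0).
Proof.
move=> l0; split=> // z _; apply: cvC_ext (@cvC_cst _ 0) => n.
by rewrite big1 // => i _; rewrite /qterm mul0r.
Qed.

Lemma qterm_shift l a z n k :
  qterm l a z (k + n) = ex (l * n%:R) z * qterm l (fun j => a (j + n)%N) z k.
Proof. by rewrite /qterm natrD mulrDr exDl; ring. Qed.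

Lemma growth_shift a n : growth a -> growth (fun j => a (j + n)%N).
Proof.
move=> ga e e0; have [B B0 hB] := ga e e0; exists (B * expR (e * n%:R)).
  by rewrite mulr_ge0 ?expR_ge0.
move=> j; apply: le_trans (hB _) _; rewrite natrD mulrDr addrC expRD.
by rewrite mulrA.
Qed.

(** If the first n coefficients vanish, dividing by the n-th exponential gives a q-series that still
    vanishes for Im z > 1 and has constant term [a n]; so all coefficients vanish by induction. *)
Lemma isq_zero l a F : isq l a F -> (forall z, 1 < Im z -> F z = 0) ->
  forall z, 0 < Im z -> F z = 0.
Proof.
move=> h F0; have ga := isq_growth h.
have a0 n : a n = 0.
  elim/ltn_ind: n => n IH; have gb := growth_shift n ga.
  have hb := growth_isq h.1 gb.
  apply: (isq_a0_unique hb (isq0 h.1)) => z z1.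
  have z0 : 0 < Im z by apply: lt_trans z1.
  have E : cser (qterm l a z) (ex (l * n%:R) z * qsum l (fun j => a (j + n)%N) z).
    have := cserZ (ex (l * n%:R) z) (hb.2 z z0).
    move=> hs e e0; have [N hN] := hs e e0; exists (N + n)%N => k Nk.
    have nk : (n <= k)%N by apply: leq_trans Nk; rewrite leq_addl.
    have -> : \sum_(0 <= i < k) qterm l a z i =
      \sum_(0 <= i < k - n) ex (l * n%:R) z * qterm l (fun j => a (j + n)%N) z i.
      rewrite (big_cat_nat (n := n)) //= big1_seq ?add0r.
        rewrite -{1}[n]add0n big_addn; apply: eq_bigr => i _.
        exact: qterm_shift.
      by move=> i; rewrite mem_index_iota /= => lt_in; rewrite /qterm IH // mul0r.
    by apply: hN; rewrite leq_subRL // addnC.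
  have := cser_unique E (h.2 z z0); rewrite (F0 z z1) => /eqP.
  by rewrite mulf_eq0 (negbTE (ex_neq0 _ _)) => /eqP.
move=> z z0; apply: cser_unique (h.2 z z0) _.
by apply: cser_ext ((isq0 h.1).2 z z0) => n; rewrite /qterm a0.
Qed.

(** Coefficients of the same function as a series in q^(1/m). This brings series of different
    periods to a common one and, in [sig], picks out divisors. *)
Definition spread (m : nat) a n := if (m %| n)%N then a (n %/ m)%N else 0.

Lemma isq_spread l a F (k : nat) : (0 < k)%N -> isq l a F ->
  isq (l / k%:R) (spread k a) F.
Proof.
move=> k0 [l0 h]; split; first by rewrite divr_gt0 // ltr0n.
(* [up n] is the ceiling of n / k, the number of multiples of k below n. *)
move=> z z0; pose up n := ((n + k.-1) %/ k)%N.
have E n : \sum_(0 <= i < n) qterm (l / k%:R) (spread k a) z i =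
    \sum_(0 <= j < up n) qterm l a z j.
  elim: n => [|n IH].
    rewrite !big_geq // /up add0n divn_small //; by rewrite prednK.
  rewrite big_nat_recr //= IH {2}/qterm /spread.
  have upS : up n.+1 = (up n + (k %| n))%N.
    rewrite /up addSn -addnS prednK // divnDr ?dvdnn // divnn k0.
    rewrite addn1; case: (boolP (k %| n)%N) => [/dvdnP[q ->]|kn].
      by rewrite divnMDl // mulnK // (@divn_small k.-1) ?addn0 ?addn1 // prednK.
    rewrite addn0 {2}(divn_eq n k) -addnA divnMDl // addnC.
    have r0 : (0 < n %% k)%N by rewrite lt0n.
    have rk := ltn_pmod n k0.
    have -> : (n %% k + k.-1 = 1 * k + (n %% k).-1)%N.
      by move: (n %% k)%N r0 rk => r r0 rk; rewrite mul1n; clear - k0 r0; lia.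
    rewrite divnMDl // (@divn_small (n %% k).-1) ?addn0 1?addnC //;
      move: (n %% k)%N r0 rk => r r0 rk; clear - rk r0; lia.
  rewrite upS; case: ifP => [kn|_]; last by rewrite addn0 mul0r addr0.
  rewrite addn1 big_nat_recr //=; congr (_ + _).
  have -> : up n = (n %/ k)%N.
    move: kn => /dvdnP[q ->]; rewrite /up divnMDl // mulnK //.
    by rewrite divn_small ?addn0 // prednK.
  rewrite /qterm; congr (_ * ex _ z).
  have kR : k%:R != 0 :> R by rewrite pnatr_eq0 -lt0n.
  rewrite -mulrA; congr (_ * _); move: kn => /dvdnP[q ->].
  by rewrite mulnK // natrM mulrC mulfK.
move=> e e0; have [N hN] := h z z0 e e0; exists (N * k)%N => n Nn.
by rewrite E; apply: hN; rewrite /up leq_divRL //; lia.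
Qed.

Lemma spread0 (k : nat) a : spread k a 0 = a 0%N.
Proof. by rewrite /spread dvdn0 div0n. Qed.

Lemma isqD l a b F G : isq l a F -> isq l b G ->
  isq l (fun n => a n + b n) (fun z => F z + G z).
Proof.
move=> [l0 hF] [_ hG]; split=> // z z0.
by apply: cser_ext (cserD (hF z z0) (hG z z0)) => n; rewrite /qterm mulrDl.
Qed.

Lemma isqZ l a F c : isq l a F -> isq l (fun n => c * a n) (fun z => c * F z).
Proof.
move=> [l0 hF]; split=> // z z0.
by apply: cser_ext (cserZ c (hF z z0)) => n; rewrite /qterm mulrA.
Qed.

Lemma isq_sum I (r : seq I) l (a : I -> nat -> C) (F : I -> C -> C) : 0 < l ->
  (forall i, isq l (a i) (F i)) ->
  isq l (fun n => \sum_(i <- r) a i n) (fun z => \sum_(i <- r) F i z).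
Proof.
move=> l0 h; elim: r => [|i r IH].
  by apply: isq_ext (isq0 l0) _ _ => [n|z _]; rewrite big_nil.
by apply: isq_ext (isqD (h i) IH) _ _ => [n|z _]; rewrite big_cons.
Qed.

Lemma isq_affine l a F (u v : R) : 0 < u -> isq l a F ->
  isq (l * u) (fun n => a n * ex (l * n%:R) v%:C) (fun z => F (u%:C * z + v%:C)).
Proof.
move=> u0 [l0 h]; split=> [|z z0]; first by rewrite mulr_gt0.
have z0' : 0 < Im (u%:C * z + v%:C) by rewrite !ReImE; nra.
apply: cser_ext (h _ z0') => n; rewrite /qterm exDr.
have -> : ex (l * n%:R) (u%:C * z) = ex (l * u * n%:R) z.
  by rewrite /ex !CM; congr cexp; ring.
by ring.
Qed.

End QSeries.

(** * Regular functions of (x, y) and integration over the truncated fundamental domain *)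

Section PlanarFunctions.
Variable R : realType.
Local Notation mu := (@lebesgue_measure R).
Local Notation area := (mu \x mu)%E.
Implicit Types (u v : R -> R -> R) (x y t T : R).

Definition upper : set (R * R) := [set p | 0 < p.2].

Definition cont2 u := forall x y, 0 < y -> forall e, 0 < e ->
  exists2 r, 0 < r & forall x' y', `|x' - x| < r -> `|y' - y| < r ->
    `|u x' y' - u x y| <= e.

Definition bnd2 u := forall T, exists2 M, 0 <= M & forall x y,
  `|x| <= 2^-1 -> 2^-1 <= y <= T -> `|u x y| <= M.

Definition meas2 u := measurable_fun upper (fun p : R * R => u p.1 p.2).

(** What Green's formula asks of each function: continuity for the one-dimensional integrals, a
    bound on a box containing the truncated domain for integrability, and measurability for Fubini.
    All three survive sums and products. *)
Definition reg u := [/\ cont2 u, bnd2 u & meas2 u].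

Lemma measurable_upper : measurable upper.
Proof.
have -> : upper = [set: R * R] `&` snd @^-1` `]0, +oo[.
  by rewrite setTI; apply/seteqP; split=> p; rewrite /upper /= in_itv /= andbT.
by apply: (@measurable_snd _ _ R R) => //; exact: measurable_itv.
Qed.

Lemma reg_cst c : reg (fun _ _ => c).
Proof.
split; first by move=> x y _ e e0; exists 1 => // *; rewrite subrr normr0 ltW.
  by move=> T; exists `|c|.
exact: measurable_cst.
Qed.

Lemma reg_y : reg (fun _ y => y).
Proof.
split; first by move=> x y _ e e0; exists e => // x' y' _ /ltW.
  move=> T; exists `|T| => // x y _ /andP[y0 yT].
  rewrite ger0_norm; last by apply: le_trans y0.
  exact: le_trans (ler_norm T).
by apply: measurable_funTS; exact: measurable_snd.
Qed.

Lemma regD u v : reg u -> reg v -> reg (fun x y => u x y + v x y).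
Proof.
move=> [cu bu mu'] [cv bv mv]; split.
- move=> x y y0 e e0; have e20 : 0 < e / 2 by rewrite divr_gt0.
  have [r r0 hr] := cu x y y0 _ e20; have [s s0 hs] := cv x y y0 _ e20.
  exists (Num.min r s); first by rewrite lt_min r0.
  move=> x' y'; rewrite !lt_min => /andP[a1 a2] /andP[a3 a4].
  have := hr x' y' a1 a3; have := hs x' y' a2 a4.
  rewrite !ler_norml => /andP[? ?] /andP[? ?]; apply/andP; split; lra.
- move=> T; have [M M0 hM] := bu T; have [N N0 hN] := bv T.
  exists (M + N); first by rewrite addr_ge0.
  by move=> x y hx hy; apply: le_trans (ler_normD _ _) (lerD (hM _ _ hx hy) (hN _ _ hx hy)).
- exact: measurable_funD.
Qed.

Lemma regM u v : reg u -> reg v -> reg (fun x y => u x y * v x y).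
Proof.
move=> [cu bu mu'] [cv bv mv]; split.
- move=> x y y0 e e0.
  pose A := `|u x y| + 1; pose B := `|v x y| + 1.
  have A0 : 0 < A by rewrite ltr_wpDl.
  have B0 : 0 < B by rewrite ltr_wpDl.
  have e1 : 0 < Num.min (e / (2 * B)) 1 by rewrite lt_min ltr01 andbT divr_gt0 ?mulr_gt0.
  have e2 : 0 < e / (2 * A) by rewrite divr_gt0 ?mulr_gt0.
  have [r r0 hr] := cu x y y0 _ e1; have [s s0 hs] := cv x y y0 _ e2.
  exists (Num.min r s); first by rewrite lt_min r0.
  move=> x' y'; rewrite !lt_min => /andP[a1 a2] /andP[a3 a4].
  have := hr x' y' a1 a3; have := hs x' y' a2 a4.
  rewrite le_min; set U := u x' y'; set V := v x' y' => h1 /andP[h2 h3].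
  have UA : `|U| <= A.
    have -> : U = (U - u x y) + u x y by ring.
    by apply: le_trans (ler_normD _ _) _; rewrite /A; lra.
  have -> : U * V - u x y * v x y = U * (V - v x y) + (U - u x y) * v x y by ring.
  apply: le_trans (ler_normD _ _) _; rewrite !normrM.
  have b1 : `|U| * `|V - v x y| <= A * (e / (2 * A)) by rewrite ler_pM.
  have b2 : `|U - u x y| * `|v x y| <= e / (2 * B) * B by rewrite ler_pM // lerDl.
  have E1 : A * (e / (2 * A)) = e / 2 by field; rewrite gt_eqF.
  have E2 : e / (2 * B) * B = e / 2 by field; rewrite gt_eqF.
  rewrite E1 in b1; rewrite E2 in b2; lra.
- move=> T; have [M M0 hM] := bu T; have [N N0 hN] := bv T.
  exists (M * N); first by rewrite mulr_ge0.
  by move=> x y hx hy; rewrite normrM ler_pM ?hM ?hN.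
- exact: measurable_funM.
Qed.

Lemma reg_ext u v : (forall x y, 0 < y -> u x y = v x y) -> reg u -> reg v.
Proof.
move=> uv [cu bu mu']; split.
- move=> x y y0 e e0; have [r r0 hr] := cu x y y0 e e0.
  exists (Num.min r y); first by rewrite lt_min r0.
  move=> x' y'; rewrite !lt_min => /andP[a1 _] /andP[a3 a4].
  by rewrite -!uv ?hr //; move: a4; rewrite ltr_norml => /andP[]; lra.
- move=> T; have [M M0 hM] := bu T; exists M => // x y hx /[dup] /andP[hy _] hy'.
  by rewrite -uv ?hM //; apply: lt_le_trans hy; rewrite invr_gt0.
- move: mu'; apply: eq_measurable_fun => p; rewrite inE => p0; exact: uv.
Qed.

Lemma regN u : reg u -> reg (fun x y => - u x y).
Proof.
by move=> h; apply: reg_ext (regM (reg_cst (-1)) h) => x y _; rewrite mulN1r.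
Qed.

Lemma regB u v : reg u -> reg v -> reg (fun x y => u x y - v x y).
Proof. by move=> hu /regN; exact: regD. Qed.

Lemma cont2_comp u (al be : R -> R) t : cont2 u -> 0 < be t ->
  {for t, continuous al} -> {for t, continuous be} ->
  {for t, continuous (fun s => u (al s) (be s))}.
Proof.
move=> cu b0 ca cb; apply/cvgrPdist_le => /= e e0.
have [r r0 hr] := cu (al t) (be t) b0 e e0.
near=> s; rewrite distrC; apply: hr; rewrite distrC; near: s.
  by move/cvgrPdist_lt: ca; apply.
by move/cvgrPdist_lt: cb; apply.
Unshelve. all: by end_near. Qed.

Lemma ftc_itv (F f : R -> R) a b : a <= b ->
  (forall t, a <= t <= b -> is_derive t 1 F (f t)) ->
  (forall t, a <= t <= b -> {for t, continuous f}) ->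
  (\int[mu]_(t in `[a, b]) (f t)%:E = (F b - F a)%:E)%E.
Proof.
rewrite le_eqVlt => /predU1P[<- _ _|ab dF cf].
  by rewrite set_itv1 integral_set1 subrr.
have cF t : a <= t <= b -> {for t, continuous F}.
  move=> /dF [dFt _]; exact/differentiable_continuous/derivable1_diffP.
rewrite EFinB; apply: continuous_FTC2 => //.
- apply: continuous_in_subspaceT => t; rewrite inE /= in_itv /=; exact: cf.
- split.
  + move=> t; rewrite in_itv /= => /andP[a1 a2].
    by have [] : is_derive t 1 F (f t) by apply: dF; rewrite !ltW.
  + by apply: cvg_at_right_filter; apply: cF; rewrite lexx ltW.
  + by apply: cvg_at_left_filter; apply: cF; rewrite lexx ltW.
- move=> t; rewrite in_itv /= => /andP[a1 a2]; rewrite derive1E.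
  have h : is_derive t 1 F (f t) by apply: dF; rewrite !ltW.
  by rewrite derive_val.
Qed.

Lemma ftc_itvo (F f : R -> R) a b : a <= b ->
  (forall t, a <= t <= b -> is_derive t 1 F (f t)) ->
  (forall t, a <= t <= b -> {for t, continuous f}) ->
  (\int[mu]_(t in `[a, b[) (f t)%:E = (F b - F a)%:E)%E.
Proof.
move=> ab dF cf; rewrite integral_itv_bndo_bndc ?(ftc_itv ab dF cf) //.
apply/measurable_EFinP; apply: subspace_continuous_measurable_fun => //.
apply: continuous_in_subspaceT => t; rewrite inE /= in_itv /= => /andP[h1 h2].
by apply: cf; rewrite h1 ltW.
Qed.

Definition Fdom T : set (R * R) :=
  [set p | [/\ 0 < p.2, 1 <= p.1 ^+ 2 + p.2 ^+ 2, `|p.1| <= 2^-1 & p.2 < T]].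

Lemma Fdom_y T p : Fdom T p -> 2^-1 <= p.2 <= T.
Proof.
move=> [p0 p1 p2 p3]; rewrite (ltW p3) andbT.
have : p.1 ^+ 2 <= 4^-1.
  rewrite -(real_normK (num_real _)).
  have -> : 4^-1 = 2^-1 ^+ 2 :> R by field.
  by rewrite lerXn2r ?nnegrE // invr_ge0.
by rewrite leNgt; move=> h; apply/negP => h'; nra.
Qed.

Lemma measurable_Fdom T : measurable (Fdom T).
Proof.
have mf := @measurable_fst _ _ R R; have ms := @measurable_snd _ _ R R.
have mq : measurable_fun [set: R * R] (fun p => p.1 ^+ 2 + p.2 ^+ 2).
  by apply: measurable_funD; apply: measurable_funX.
have mn : measurable_fun [set: R * R] (fun p => `|p.1|).
  exact: measurableT_comp.
have -> : Fdom T = upper `&`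
   ([set: R * R] `&` (fun p => p.1 ^+ 2 + p.2 ^+ 2) @^-1` `[1, +oo[) `&`
   ([set: R * R] `&` (fun p => `|p.1|) @^-1` `]-oo, 2^-1]) `&`
   ([set: R * R] `&` snd @^-1` `]-oo, T[).
  apply/seteqP; split=> p; rewrite /Fdom /upper /= !in_itv /= ?andbT.
    by move=> [h1 h2 h3 h4]; do !split.
  by move=> [[[h1 [_ h2]] [_ h3]] [_ h4]]; split.
apply: measurableI; last by apply: ms => //; exact: measurable_itv.
apply: measurableI; last by apply: mn => //; exact: measurable_itv.
apply: measurableI; first exact: measurable_upper.
by apply: mq => //; exact: measurable_itv.
Qed.

Lemma integrable_Fdom u T : reg u ->
  area.-integrable (Fdom T) (fun p => (u p.1 p.2)%:E).
Proof.
move=> [cu bu mu']; have [M M0 hM] := bu T.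
suff : area.-integrable (Fdom T) (EFin \o (fun p : R * R => u p.1 p.2)) by [].
apply: measurable_bounded_integrable.
- exact: measurable_Fdom.
- apply: (@le_lt_trans _ _ (area (`[- 2^-1, 2^-1] `*` `[2^-1, T]))).
    apply: le_measure; rewrite ?inE; [exact: measurable_Fdom|exact: measurableX|].
    move=> p pD; have := Fdom_y pD; case: pD => _ _ px _ py.
    by split; rewrite /= in_itv //= -ler_norml.
  rewrite product_measure1E //= !lebesgue_measure_itv /=.
  by do 2 case: ifP => _; rewrite ?mule0 ?mul0e ?ltry // -!EFinB -EFinM ltry.
- by apply: measurable_funS mu' => //; [exact: measurable_upper | move=> p []].
- exists M; split; first exact: num_real.
  move=> N MN p pD; apply: le_trans (ltW MN); apply: hM; last exact: Fdom_y.
  by case: pD.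
Qed.

Lemma fubini_x u T (v : R -> R) : reg u ->
  (forall x, \int[mu]_(y in [set y | Fdom T (x, y)]) (u x y)%:E = (v x)%:E)%E ->
  \int[area]_(p in Fdom T) u p.1 p.2 = \int[mu]_x v x.
Proof.
move=> ru h; have iu := integrable_Fdom T ru.
rewrite /Rintegral; congr fine; rewrite integral_mkcond -integral12_prod_meas1.
  apply: eq_integral => x _; rewrite -h [RHS]integral_mkcond /fubini_F.
  apply: eq_integral => y _; rewrite /patch.
  have -> // : ((x, y) \in Fdom T) = (y \in [set y | Fdom T (x, y)]).
  by apply/idP/idP; rewrite !inE.
by have [hi _] := @integrable_mkcond _ _ _ area _ (fun p => (u p.1 p.2)%:E) (measurable_Fdom T); exact: hi.
Qed.

Lemma fubini_y u T (v : R -> R) : reg u ->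
  (forall y, \int[mu]_(x in [set x | Fdom T (x, y)]) (u x y)%:E = (v y)%:E)%E ->
  \int[area]_(p in Fdom T) u p.1 p.2 = \int[mu]_y v y.
Proof.
move=> ru h; have iu := integrable_Fdom T ru.
rewrite /Rintegral; congr fine; rewrite integral_mkcond -integral21_prod_meas1.
  apply: eq_integral => y _; rewrite -h [RHS]integral_mkcond /fubini_G.
  apply: eq_integral => x _; rewrite /patch.
  have -> // : ((x, y) \in Fdom T) = (x \in [set x | Fdom T (x, y)]).
  by apply/idP/idP; rewrite !inE.
by have [hi _] := @integrable_mkcond _ _ _ area _ (fun p => (u p.1 p.2)%:E) (measurable_Fdom T); exact: hi.
Qed.

End PlanarFunctions.

(** * Green's formula on the truncated fundamental domain *)

Section Green.
Variable R : realType.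
Local Notation mu := (@lebesgue_measure R).
Local Notation area := (mu \x mu)%E.
Implicit Types (u v : R -> R -> R) (x y t T : R).

Record C1 u ux uy : Prop := MkC1 {
  C1r : reg u; C1rx : reg ux; C1ry : reg uy;
  C1x : forall x y, 0 < y -> is_derive x 1 (u^~ y) (ux x y);
  C1y : forall x y, 0 < y -> is_derive y 1 (u x) (uy x y) }.

Lemma C1D u ux uy v vx vy : C1 u ux uy -> C1 v vx vy ->
  C1 (fun x y => u x y + v x y) (fun x y => ux x y + vx x y)
     (fun x y => uy x y + vy x y).
Proof.
move=> [r1 r2 r3 d1 d2] [s1 s2 s3 e1 e2]; split; try exact: regD.
  by move=> x y y0; have h1 := d1 x y y0; have h2 := e1 x y y0; apply: is_derive_eq.
by move=> x y y0; have h1 := d2 x y y0; have h2 := e2 x y y0; apply: is_derive_eq.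
Qed.

Lemma C1M u ux uy v vx vy : C1 u ux uy -> C1 v vx vy ->
  C1 (fun x y => u x y * v x y) (fun x y => ux x y * v x y + u x y * vx x y)
     (fun x y => uy x y * v x y + u x y * vy x y).
Proof.
move=> [r1 r2 r3 d1 d2] [s1 s2 s3 e1 e2].
split; try (by apply: regD; apply: regM); try exact: regM.
  move=> x y y0; have h1 := d1 x y y0; have h2 := e1 x y y0.
  by apply: is_derive_eq; rewrite /GRing.scale /=; ring.
move=> x y y0; have h1 := d2 x y y0; have h2 := e2 x y y0.
by apply: is_derive_eq; rewrite /GRing.scale /=; ring.
Qed.

Lemma C1_cst c : C1 (fun _ _ => c) (fun _ _ => 0) (fun _ _ => 0).
Proof.
by split; try exact: reg_cst; move=> x y _; exact: is_derive_cst.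
Qed.

Lemma C1_ext u ux uy v vx vy : C1 u ux uy -> (forall x y, u x y = v x y) ->
  (forall x y, 0 < y -> ux x y = vx x y) -> (forall x y, 0 < y -> uy x y = vy x y) ->
  C1 v vx vy.
Proof.
move=> [r1 r2 r3 d1 d2] /(fun h => funext (fun x => funext (h x))) <- hx hy.
split => //; [exact: reg_ext r2 | exact: reg_ext r3 | |] => x y y0.
  by rewrite -hx //; exact: d1.
by rewrite -hy //; exact: d2.
Qed.

Definition arc x : R := Num.sqrt (1 - x ^+ 2).

Lemma arc_sqr x : -1 < x < 1 -> 0 < arc x /\ x ^+ 2 + arc x ^+ 2 = 1.
Proof.
move=> /andP[a b]; have h : 0 < 1 - x ^+ 2 by nra.
by split; [rewrite sqrtr_gt0 | rewrite sqr_sqrtr ?ltW //; ring].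
Qed.

Lemma is_derive_arc x : -1 < x < 1 -> is_derive x 1 arc (- x / arc x).
Proof.
move=> /andP[a b]; have h : 0 < 1 - x ^+ 2 by nra.
have q : is_derive x 1 (fun x : R => 1 - x ^+ 2) (- (2 * x)).
  by apply: is_derive_eq; rewrite /GRing.scale /=; ring.
have := @is_derive1_comp _ (@Num.sqrt R) (fun x => 1 - x ^+ 2) x _ _ (is_derive1_sqrt h) q.
move=> D.
suff -> : - x / arc x = (2 * Num.sqrt (1 - x ^+ 2))^-1 * - (2 * x) by exact: D.
have := sqrtr_gt0 (1 - x ^+ 2); rewrite h /arc => s0.
by field; rewrite gt_eqF.
Qed.

Lemma continuous_arc x : {for x, continuous arc}.
Proof.
apply: (@continuous_comp _ _ _ (fun x : R => 1 - x ^+ 2) (@Num.sqrt R)).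
  apply: cvgB; first exact: cvg_cst.
  exact: exprn_continuous.
exact: sqrt_continuous.
Qed.

Lemma continuous_at_id t : {for t, continuous (@id R)}.
Proof. by move=> A hA. Qed.

Section Stokes.
Variables (P Px Py Q Qx Qy : R -> R -> R) (T : R).
Hypotheses (CP : C1 P Px Py) (CQ : C1 Q Qx Qy) (T1 : 1 < T).
Hypothesis Pper : forall y, 0 < y -> P 2^-1 y = P (- 2^-1) y.
(** [PS] and [QS] are the real and imaginary parts of Phi(-1/z) = conj(z)^2 Phi(z) for Phi = P + i
    Q; on the unit circle, -1/z = -x + i y. *)
Hypothesis PS : forall x y, 0 < y -> x ^+ 2 + y ^+ 2 = 1 ->
  P (- x) y = P x y * (x ^+ 2 - y ^+ 2) + 2 * x * y * Q x y.
Hypothesis QS : forall x y, 0 < y -> x ^+ 2 + y ^+ 2 = 1 ->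
  Q (- x) y = Q x y * (x ^+ 2 - y ^+ 2) - 2 * x * y * P x y.

Let half_lt : -1 < (2^-1 : R) < 1. Proof. by apply/andP; split; lra. Qed.

Lemma arc_le1 x : arc x <= 1.
Proof. by rewrite /arc -[leRHS]sqrtr1 ler_wsqrtr // gerBl sqr_ge0. Qed.

Lemma in_half x : (x \in `[- 2^-1, 2^-1]) -> `|x| <= 2^-1 /\ -1 < x < 1.
Proof.
rewrite in_itv /= => /andP[a b]; split; first by rewrite ler_norml a.
by apply/andP; split; lra.
Qed.

Lemma Fdom_xsec x : -1 < x < 1 -> `|x| <= 2^-1 ->
  [set y | Fdom T (x, y)] = `[arc x, T[%classic.
Proof.
move=> x1 xh; have [a0 aE] := arc_sqr x1.
apply/seteqP; split=> y; rewrite /= in_itv /=.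
  move=> [/= y0 y1 _ yT]; rewrite yT andbT.
  have : arc x ^+ 2 <= y ^+ 2 by lra.
  by rewrite ler_pXn2r // nnegrE ltW.
move=> /andP[ay yT]; have y0 : 0 < y by apply: lt_le_trans ay.
have : arc x ^+ 2 <= y ^+ 2 by rewrite lerXn2r // nnegrE ltW.
by split => //=; lra.
Qed.

Lemma int_Qy : \int[area]_(p in Fdom T) Qy p.1 p.2 =
  \int[mu]_(x in `[- 2^-1, 2^-1]) (Q x T - Q x (arc x)).
Proof.
rewrite [RHS]Rintegral_mkcond; apply: fubini_x; first exact: (C1ry CQ).
move=> x; rewrite /patch mem_setE; case: ifPn => [/in_half [xh x1]|xn].
  rewrite (Fdom_xsec x1 xh); have [a0 aE] := arc_sqr x1.
  apply: ftc_itvo => [|t /andP[at_ _]|t /andP[at_ _]].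
  - by apply: le_trans (arc_le1 _) _; exact: ltW.
  - by apply: (C1y CQ); apply: lt_le_trans at_.
  - have [cQ _ _] := C1ry CQ.
    apply: (cont2_comp cQ); first by apply: lt_le_trans at_.
      exact: cvg_cst.
    exact: continuous_at_id.
have -> : [set y | Fdom T (x, y)] = set0.
  apply/seteqP; split=> y //= [_ _ /= xh _]; move: xn.
  by rewrite in_itv /= -ler_norml xh.
by rewrite integral_set0.
Qed.

Definition lowP y : R := P (- arc y) y - P (arc y) y.

(** Below height 1 a horizontal slice consists of two intervals: their outer endpoints cancel by
    [Pper], and the inner ones lie on the arc and give [lowP]. From height 1 upwards the slice is
    full and contributes 0. The lowest height is arc(1/2) = sqrt 3 / 2. *)
Lemma int_Px : \int[area]_(p in Fdom T) Px p.1 p.2 =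
  \int[mu]_(y in `[arc 2^-1, 1[) lowP y.
Proof.
rewrite [RHS]Rintegral_mkcond; apply: fubini_y; first exact: (C1rx CP).
have [h0 hE] := arc_sqr half_lt.
have [cP _ _] := C1rx CP.
have ftcx a b y : 0 < y -> a <= b ->
    (\int[mu]_(x in `[a, b]) (Px x y)%:E = (P b y - P a y)%:E)%E.
  move=> y0 ab; apply: (@ftc_itv R (P^~ y) (Px^~ y) a b ab) => t _; first exact: (C1x CP).
  apply: (cont2_comp cP) => //; (exact: continuous_at_id || exact: cvg_cst || exact: continuous_arc).
move=> y; rewrite /patch mem_setE; case: ifPn.
  rewrite in_itv /= => /andP[ay y1]; have y0 : 0 < y by apply: lt_le_trans ay.
  have ym : -1 < y < 1 by rewrite y1 andbT; lra.
  have [r0 rE] := arc_sqr ym; set r := arc y in r0 rE.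
  have yq : arc 2^-1 ^+ 2 <= y ^+ 2 by rewrite lerXn2r // nnegrE ltW.
  have rh : r <= 2^-1.
    have : r ^+ 2 <= 2^-1 ^+ 2 by lra.
    by rewrite ler_pXn2r // nnegrE ?invr_ge0 // ltW.
  have -> : [set x | Fdom T (x, y)] = `[- 2^-1, - r]%classic `|` `[r, 2^-1]%classic.
    apply/seteqP; split=> x /=.
      move=> [_ /= h1 h2 _]; move: h2; rewrite ler_norml => /andP[h3 h4].
      have : r ^+ 2 <= x ^+ 2 by lra.
      have [x0|x0] := leP 0 x => h5.
        right; rewrite in_itv /= h4 andbT.
        by move: h5; rewrite ler_pXn2r // nnegrE ltW.
      left; rewrite in_itv /= h3 /= lerNr.
      by move: h5; rewrite -[x ^+ 2]sqrrN ler_pXn2r // nnegrE ?oppr_ge0 ltW.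
    rewrite !in_itv /= => h.
    have [xh xr] : `|x| <= 2^-1 /\ r ^+ 2 <= x ^+ 2.
      case: h => /andP[h1 h2]; split; rewrite ?ler_norml;
        by [apply/andP; split; lra | nra].
    split => //=; [lra | exact: lt_trans y1 T1].
  rewrite integral_setU //=.
  - rewrite !ftcx //; last by lra.
    by rewrite -EFinD /lowP -/r; congr EFin; rewrite (Pper y0); ring.
  - apply/measurable_EFinP; apply: measurable_funTS.
    apply: continuous_measurable_fun => t.
    by apply: (cont2_comp cP) => //; (exact: continuous_at_id || exact: cvg_cst || exact: continuous_arc).
  - apply/disj_setPS => x [] /=; rewrite !in_itv /= => /andP[_ h1] /andP[h2 _].
    lra.
rewrite in_itv /= negb_and -ltNge -leNgt => hy.
have [y0|y0] := leP y 0.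
  have -> : [set x | Fdom T (x, y)] = set0.
    by apply/seteqP; split=> x //= [/= h _ _ _]; lra.
  by rewrite integral_set0.
have [y1|y1] := ltP y 1.
  move: hy; rewrite leNgt y1 orbF => ya.
  have -> : [set x | Fdom T (x, y)] = set0.
    apply/seteqP; split=> x //= [_ /= h1 h2 _].
    have : x ^+ 2 <= 2^-1 ^+ 2.
      by rewrite -(real_normK (num_real x)) lerXn2r // nnegrE invr_ge0.
    have : y ^+ 2 < arc 2^-1 ^+ 2 by rewrite ltr_pXn2r // nnegrE ltW.
    lra.
  by rewrite integral_set0.
have [yT|yT] := ltP y T; last first.
  have -> : [set x | Fdom T (x, y)] = set0.
    by apply/seteqP; split=> x //= [_ _ _ /=]; rewrite ltNge yT.
  by rewrite integral_set0.
have -> : [set x | Fdom T (x, y)] = `[- 2^-1, 2^-1]%classic.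
  apply/seteqP; split=> x /=; first by move=> [_ _ h _]; rewrite in_itv /= -ler_norml.
  rewrite in_itv /= -ler_norml => xh; split => //=.
  have := sqr_ge0 x; nra.
by rewrite ftcx //; [rewrite (Pper y0) subrr | lra].
Qed.

Lemma continuous_lowP y : 0 < y -> {for y, continuous lowP}.
Proof.
have [cP _ _] := C1r CP; move=> y0.
have h1 : {for y, continuous (fun s => P (- arc s) s)}.
  apply: (@cont2_comp _ P (fun s => - arc s) id) => //.
  by apply: cvgN; exact: continuous_arc.
have h2 : {for y, continuous (fun s => P (arc s) s)}.
  by apply: (@cont2_comp _ P arc id) => //; exact: continuous_arc.
exact: cvgB h1 h2.
Qed.

Lemma arcK x : 0 <= x <= 2^-1 -> arc (arc x) = x.
Proof.
move=> /andP[x0 xh]; rewrite {1}/arc.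
have [_ aE] : 0 < arc x /\ x ^+ 2 + arc x ^+ 2 = 1.
  by apply: arc_sqr; apply/andP; split; lra.
have -> : 1 - arc x ^+ 2 = x ^+ 2 by lra.
by rewrite sqrtr_sqr ger0_norm.
Qed.

(** The substitution y = arc x parametrises the arc by x, as the integral of [Qy] does, so that the
    two contributions can be compared pointwise. *)
Lemma int_lowP : \int[mu]_(y in `[arc 2^-1, 1[) lowP y =
  \int[mu]_(x in `[0, 2^-1]) (lowP (arc x) * (x / arc x)).
Proof.
have [h0 hE] := arc_sqr half_lt.
have itv1 x : 0 <= x <= 2^-1 -> -1 < x < 1 by move=> /andP[? ?]; apply/andP; split; lra.
have dA x : -1 < x < 1 -> derive1 arc x = - x / arc x.
  by move=> x1; have h := is_derive_arc x1; rewrite derive1E derive_val.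
have cA x : -1 < x < 1 -> {for x, continuous (derive1 arc)}.
  move=> x1; have [a0 _] := arc_sqr x1.
  have : {for x, continuous (fun x => - x / arc x)}.
    apply: cvgM; first by apply: cvgN; apply: continuous_at_id.
    by apply: cvgV; [rewrite gt_eqF | exact: continuous_arc].
  rewrite /prop_for /continuous_at -(dA _ x1); apply: cvg_trans; apply: near_eq_cvg.
  have : x \in `]-1, 1[ by rewrite in_itv.
  by move=> /near_in_itvoo; apply: filterS => t; rewrite in_itv /= => /dA.
have arc0 : arc 0 = 1 by rewrite /arc expr0n subr0 sqrtr1.
rewrite /Rintegral integral_itv_bndo_bndc; last first.
  apply/measurable_EFinP; apply: subspace_continuous_measurable_fun => //.
  apply: continuous_in_subspaceT => t; rewrite inE /= in_itv /= => /andP[h _].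
  by apply: continuous_lowP; apply: lt_le_trans h.
have -> : `[arc 2^-1, 1]%classic = `[arc 2^-1, arc 0]%classic by rewrite arc0.
rewrite integration_by_substitution_decreasing //.
- congr fine; apply: eq_integral => x; rewrite inE /= in_itv /= => hx.
  transitivity ((lowP (arc x) * - derive1 arc x)%:E); first by [].
  by rewrite (dA _ (itv1 _ hx)) mulNr opprK.
- move=> y x; rewrite !in_itv /= => hy hx xy.
  have [ax0 aE] := arc_sqr (itv1 _ hx); have [ay0 bE] := arc_sqr (itv1 _ hy).
  have : x ^+ 2 < y ^+ 2.
    by move: hx => /andP[x0 _]; rewrite ltr_pXn2r // nnegrE // (le_trans x0) // ltW.
  have : (arc y ^+ 2 < arc x ^+ 2) = (arc y < arc x).
    by rewrite ltr_pXn2r // nnegrE ltW.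
  by move=> <- h; lra.
- by move=> x; rewrite in_itv /= => /andP[a b]; apply: cA; apply: itv1; rewrite !ltW.
- apply/cvg_ex; exists (derive1 arc 0); apply: cvg_at_right_filter; apply: cA; apply: itv1.
  by rewrite lexx /= invr_ge0 ler0n.
- apply/cvg_ex; exists (derive1 arc 2^-1); apply: cvg_at_left_filter; apply: cA.
  exact: half_lt.
- split.
  + move=> x; rewrite in_itv /= => /andP[a b].
    have h : is_derive x 1 arc (- x / arc x).
      by apply: is_derive_arc; apply: itv1; rewrite !ltW.
    by case: h.
  + apply: cvg_at_right_filter; exact: continuous_arc.
  + apply: cvg_at_left_filter; exact: continuous_arc.
- apply: continuous_in_subspaceT => t; rewrite inE /= in_itv /= => /andP[h _].
  by apply: continuous_lowP; apply: lt_le_trans h.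
Qed.

Lemma continuous_Qarc x : -1 < x < 1 -> {for x, continuous (fun x => Q x (arc x))}.
Proof.
move=> x1; have [a0 _] := arc_sqr x1; have [cQ _ _] := C1r CQ.
apply: (@cont2_comp _ Q id arc) => //.
exact: continuous_arc.
Qed.

Lemma continuous_QN x : -1 < x < 1 -> {for x, continuous (fun x => Q (- x) (arc x))}.
Proof.
move=> x1; have [a0 _] := arc_sqr x1; have [cQ _ _] := C1r CQ.
apply: (@cont2_comp _ Q -%R arc) => //; last exact: continuous_arc.
by apply: cvgN; apply: continuous_at_id.
Qed.

Lemma integrable_seg (f : R -> R) a b :
  (forall x, a <= x <= b -> {for x, continuous f}) ->
  mu.-integrable `[a, b] (EFin \o f).
Proof.
move=> h; apply: continuous_compact_integrable; first exact: segment_compact.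
by apply: continuous_in_subspaceT => t; rewrite inE /= in_itv /=; exact: h.
Qed.

Lemma int_Qarc : \int[mu]_(x in `[- 2^-1, 2^-1]) Q x (arc x) =
  \int[mu]_(x in `[0, 2^-1]) (Q x (arc x) + Q (- x) (arc x)).
Proof.
have h20 : 0 <= 2^-1 :> R by rewrite invr_ge0.
have itv1 x : - 2^-1 <= x <= 2^-1 -> -1 < x < 1.
  by move=> /andP[? ?]; apply/andP; split; lra.
have iQ : mu.-integrable `[- 2^-1, 2^-1] (EFin \o (fun x => Q x (arc x))).
  by apply: integrable_seg => x /itv1; exact: continuous_Qarc.
have iQ' : mu.-integrable `[0, 2^-1] (EFin \o (fun x => Q x (arc x))).
  apply: integrable_seg => x /andP[a b]; apply: continuous_Qarc; apply: itv1.
  by rewrite b andbT; lra.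
rewrite RintegralD //; last first.
  apply: (@integrable_seg (fun x => Q (- x) (arc x))) => x /andP[a b].
  by apply: continuous_QN; apply: itv1; rewrite b andbT; lra.
have := @Rintegral_itvB _ (fun x => Q x (arc x)) (BLeft (- 2^-1)) (BRight 2^-1) 0 iQ.
rewrite !bnd_simp => /(_ ltac:(lra) h20).
rewrite Rintegral_itv_obnd_cbnd; last first.
  by apply: integrableS iQ' => //; apply: subset_itvr; rewrite bnd_simp.
move=> E; have : \int[mu]_(x in `[- 2^-1, 0]) Q x (arc x) =
    \int[mu]_(x in `[0, 2^-1]) Q (- x) (arc x).
  have := @integration_by_substitution_oppr _ (fun x => Q x (arc x)) 0 2^-1 h20.
  rewrite oppr0 => /(_ _) H; rewrite /Rintegral H.
    congr fine; apply: eq_integral => x _ /=; congr EFin.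
    by rewrite /arc sqrrN.
  apply: continuous_in_subspaceT => t; rewrite inE /= in_itv /= => /andP[a b].
  by apply: continuous_Qarc; apply: itv1; rewrite a /=; lra.
by move=> E'; rewrite -E -E'; ring.
Qed.

(** The vertical sides cancel by periodicity and the two halves of the arc by the symmetry z ->
    -1/z, so only the top edge remains. *)
Lemma green : \int[area]_(p in Fdom T) (Px p.1 p.2 + Qy p.1 p.2) =
  \int[mu]_(x in `[- 2^-1, 2^-1]) Q x T.
Proof.
rewrite RintegralD; [|exact: measurable_Fdom|exact: integrable_Fdom (C1rx CP)
  |exact: integrable_Fdom (C1ry CQ)].
rewrite int_Px int_Qy int_lowP RintegralB //; last 2 first.
- have [cQ _ _] := C1r CQ; apply: integrable_seg => x _.
  have T0 : 0 < T by apply: lt_trans T1.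
  by apply: (@cont2_comp _ Q id (cst T)) => //; exact: cvg_cst.
- apply: (@integrable_seg (fun x => Q x (arc x))) => x /andP[a b].
  by apply: continuous_Qarc; apply/andP; split; lra.
(* With both halves of the arc folded onto 0 <= x <= 1/2, the arc terms of P and of Q agree at every
   x because x^2 + y^2 = 1. *)
rewrite int_Qarc addrCA -[RHS]addr0; congr (_ + _); apply/eqP; rewrite subr_eq0.
apply/eqP; apply: eq_Rintegral => x; rewrite inE /= in_itv /= => hx.
have [a0 aE] : 0 < arc x /\ x ^+ 2 + arc x ^+ 2 = 1.
  by move: hx => /andP[? ?]; apply: arc_sqr; apply/andP; split; lra.
rewrite /lowP arcK // (PS a0 aE) (QS a0 aE); move: (arc x) a0 aE => y y0 E.
apply: (mulfI (lt0r_neq0 y0)).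
have -> : y * ((P x y * (x ^+ 2 - y ^+ 2) + 2 * x * y * Q x y - P x y) * (x / y)) =
  (P x y * (x ^+ 2 - y ^+ 2) + 2 * x * y * Q x y - P x y) * x.
  by field; exact: lt0r_neq0.
apply/eqP; rewrite -subr_eq0; apply/eqP.
transitivity ((x ^+ 2 + y ^+ 2 - 1) * (P x y * x + Q x y * y)); first by ring.
by rewrite E subrr mul0r.
Qed.

End Stokes.
End Green.

(** * Lipschitz's formula for the sum of (w + m)^(-2) over the integers m *)

Section Lipschitz.
Variable R : realType.
Local Notation C := R[i].
Local Notation Re := (@complex.Re R).
Local Notation Im := (@complex.Im R).
Implicit Types (z w : C).

(** The majorant (n + 1)^(-3/2): since c + d >= sqrt(c d), a lattice term of order -3 is dominated
    by a product of two such factors, the form required by [double_series]. *)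
Definition b32 (n : nat) : R := (Num.sqrt n.+1%:R) ^- 3.

Lemma bsum_b32 : bsum b32.
Proof.
pose s n : R := Num.sqrt n.+1%:R.
have s0 n : 0 < s n by rewrite sqrtr_gt0 ltr0n.
split=> [n|]; first by rewrite invr_ge0 exprn_ge0 // sqrtr_ge0.
(* A telescoping majorant: the induction step is b^(-3) <= 2 / a - 2 / b for consecutive square
   roots a < b. *)
suff h n : \sum_(0 <= k < n.+1) b32 k <= 3 - 2 / s n.
  exists 3 => -[|n]; first by rewrite big_geq.
  by apply: le_trans (h n) _; rewrite gerBl divr_ge0 // ltW.
elim: n => [|n IH].
  rewrite big_nat1 /b32 /s sqrtr1 expr1n invr1 ?divr1 ?mulr1; lra.
rewrite big_nat_recr //=; apply: le_trans (lerD IH (lexx _)) _.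
rewrite /b32 -/(s n.+1); set a := s n; set b := s n.+1.
have a0 : 0 < a := s0 _; have b0 : 0 < b := s0 _.
have ba : b ^+ 2 = a ^+ 2 + 1.
  by rewrite /a /b /s !sqr_sqrtr ?ler0n // -natr1.
have ab : a <= b by rewrite /a /b ler_wsqrtr // ler_nat.
have E : (b - a) * (a + b) = 1 by nra.
have h : b ^- 3 <= 2 / a - 2 / b.
  rewrite -subr_ge0.
  have -> : 2 / a - 2 / b - b ^- 3 = (2 * b ^+ 2 * (b - a) - a) / (a * b ^+ 3).
    by field; rewrite !gt_eqF.
  apply: divr_ge0; last by rewrite mulr_ge0 ?exprn_ge0 // ltW.
  have ab0 : 0 < a + b by lra.
  rewrite -(pmulr_lge0 _ ab0).
  have -> : (2 * b ^+ 2 * (b - a) - a) * (a + b) =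
    2 * b ^+ 2 * ((b - a) * (a + b)) - a * (a + b) by ring.
  rewrite E; nra.
lra.
Qed.

Lemma b32_ge0 n : 0 <= b32 n. Proof. by have [] := bsum_b32. Qed.

Lemma inv_sqr_b32 n : (n.+1%:R ^+ 2)^-1 <= b32 n.
Proof.
rewrite /b32; set s := Num.sqrt _.
have s1 : 1 <= s by rewrite /s -[leLHS]sqrtr1 ler_wsqrtr // ler1n.
have -> : n.+1%:R = s ^+ 2 :> R by rewrite sqr_sqrtr.
rewrite lef_pV2 ?posrE ?exprn_gt0 //; try lra.
by rewrite -exprM ler_weXn2l.
Qed.

Lemma bsum_inv_sqr : bsum (fun n => (n.+1%:R ^+ 2)^-1 : R).
Proof.
by apply: le_bsum bsum_b32 => n; rewrite inv_sqr_b32 andbT invr_ge0 exprn_ge0.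
Qed.

Lemma nat_small (K e : R) : 0 < e -> exists N, forall n, (N <= n)%N -> K / n.+1%:R <= e.
Proof.
move=> e0; exists (Num.truncn (`|K| / e)) => n Nn.
rewrite ler_pdivrMr ?ltr0n //; apply: le_trans (ler_norm _) _.
rewrite -ler_pdivrMl // mulrC; apply: le_trans (ltW (truncnS_gt _)) _.
by rewrite ler_nat.
Qed.

Lemma lattice_lower z : 0 < Im z -> exists2 k : R, 0 < k &
  forall c m : R, 0 <= c -> k * (c + `|m|) <= nrm (c%:C * z + m%:C).
Proof.
move=> y0; set y := Im z in y0; set x := Re z; pose D := 1 + `|x| + y.
have D0 : 0 < D by rewrite /D; have := normr_ge0 x; lra.
exists (y / D); first by rewrite divr_gt0.
move=> c m c0; have -> : y / D * (c + `|m|) = (y * (c + `|m|)) / D by ring.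
rewrite ler_pdivrMr //; set n := nrm _.
have h1 : c * y <= n.
  have := nrm_Im (c%:C * z + m%:C); rewrite !ReImE -/y -/n.
  have -> : c * y + 0 * complex.Re z + 0 = c * y by ring.
  by rewrite ger0_norm // mulr_ge0 // ltW.
have h2 : `|m| - c * `|x| <= n.
  have := nrm_Re (c%:C * z + m%:C); rewrite !ReImE -/x -/n.
  have -> : c * x - 0 * complex.Im z + m = m + c * x by ring.
  apply: le_trans; have := ler_normB (m + c * x) (c * x).
  by rewrite addrK [`|c * x|]normrM (ger0_norm c0); lra.
(* The choice of D: y (c + |m|) = (1 + |x|) c y + y (|m| - c |x|), and both c y and |m| - c |x| are
   at most n. *)
have := normr_ge0 x; rewrite /D => x0.
have h3 : (1 + `|x|) * (c * y) <= (1 + `|x|) * n by rewrite ler_wpM2l //; lra.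
have h4 : y * (`|m| - c * `|x|) <= y * n by rewrite ler_wpM2l // ltW.
nra.
Qed.

Lemma H_add_neq0 z (m : R) : 0 < Im z -> z + m%:C != 0.
Proof.
by move=> z0; apply/eqP => /(congr1 Im); rewrite !ReImE addr0 => h; lra.
Qed.

Lemma H_neq0 z : 0 < Im z -> z != 0.
Proof. by move=> /(@H_add_neq0 _ 0); rewrite addr0. Qed.

Lemma H_addn_neq0 z n : 0 < Im z -> z + n%:R != 0.
Proof. by rewrite natC; exact: H_add_neq0. Qed.

Lemma H_subn_neq0 z n : 0 < Im z -> z - n%:R != 0.
Proof. by move=> z0; rewrite natC -CN H_add_neq0. Qed.

Lemma H_scale z (r : R) : 0 < r -> 0 < Im z -> 0 < Im (r%:C * z).
Proof. by move=> r0 z0; rewrite !ReImE mul0r addr0 mulr_gt0. Qed.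

Lemma H_scalen z n : 0 < Im z -> 0 < Im (n.+1%:R * z).
Proof. by move=> z0; rewrite natC H_scale. Qed.

Lemma shift_inv_bound w : 0 < Im w -> exists2 K : R, 0 <= K & forall n : nat,
  nrm (w + n%:R)^-1 <= K / n.+1%:R /\ nrm (w - n%:R)^-1 <= K / n.+1%:R.
Proof.
move=> w0; have [k k0 h] := lattice_lower w0.
exists k^-1; first by rewrite invr_ge0 ltW.
have hh (m : R) n : `|m| = n%:R -> nrm (w + m%:C)^-1 <= k^-1 / n.+1%:R.
  move=> mn; rewrite nrmV -invfM; have := h 1 m ler01; rewrite mul1r mn.
  have -> : 1 + n%:R = n.+1%:R :> R by rewrite -natr1 addrC.
  move=> a1; rewrite lef_pV2 ?posrE // ?nrm_gt0 ?H_add_neq0 //.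
  by rewrite mulr_gt0.
move=> n; split; rewrite natC; first by apply: hh; rewrite normr_nat.
by rewrite -CN; apply: hh; rewrite normrN normr_nat.
Qed.

Lemma shift_sqr_cv0 w : 0 < Im w ->
  cvC (fun n => (w + n%:R) ^- 2) 0 /\ cvC (fun n => (w - n%:R) ^- 2) 0.
Proof.
move=> w0; have [K K0 h] := shift_inv_bound w0.
have hh x n : nrm x^-1 <= K / n.+1%:R -> nrm (x ^- 2 - 0) <= K ^+ 2 / n.+1%:R.
  move=> a1; rewrite subr0 -exprVn nrmX.
  apply: le_trans (_ : (K / n.+1%:R) ^+ 2 <= _).
    by rewrite lerXn2r ?nnegrE ?nrm_ge0 // divr_ge0.
  rewrite exprMn ler_wpM2l ?exprn_ge0 // exprVn lef_pV2 ?posrE ?exprn_gt0 ?ltr0n //.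
  by rewrite expr2 ler_peMl ?ler1n.
by split; apply: cvC_squeeze (@nat_small (K ^+ 2)) => n; apply: hh; have [] := h n.
Qed.

Definition lipt w n : C := (w + n.+1%:R) ^- 2 + (w - n.+1%:R) ^- 2.
Definition LP w N : C := w ^- 2 + \sum_(0 <= k < N) lipt w k.
(** The sum of (w + m)^(-2) over all integers m, with m and -m taken together. *)
Definition Lip w : C := xget 0 [set l | cvC (LP w) l].

Lemma LipP w : 0 < Im w -> cvC (LP w) (Lip w).
Proof.
move=> w0; suff [l hl] : exists l, cvC (LP w) l.
  exact: (@xgetPex _ 0 [set l | cvC (LP w) l] (ex_intro _ l hl)).
have [K K0 h] := shift_inv_bound w0.
have [l hl] : exists l, cser (lipt w) l.
  apply: (@cser_abs _ _ (fun n => 2 * K ^+ 2 * (n.+1%:R ^+ 2)^-1)); last first.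
    by apply: bsumZ bsum_inv_sqr; rewrite mulr_ge0 ?exprn_ge0.
  move=> n; apply: le_trans (nrmD _ _) _.
  rewrite -[(w + _) ^- 2]exprVn -[(w - _) ^- 2]exprVn !nrmX.
  have hh x : nrm x <= K / n.+2%:R -> nrm x ^+ 2 <= K ^+ 2 * (n.+1%:R^-1) ^+ 2.
    move=> a1; rewrite -exprMn lerXn2r ?nnegrE ?nrm_ge0 ?divr_ge0 //.
    apply: le_trans a1 _; rewrite ler_wpM2l // lef_pV2 ?posrE ?ltr0n //.
    by rewrite ler_nat.
  have [/hh a1 /hh a2] := h n.+1; rewrite exprVn in a1 a2.
  have -> : 2 * K ^+ 2 / n.+1%:R ^+ 2 = K ^+ 2 / n.+1%:R ^+ 2 + K ^+ 2 / n.+1%:R ^+ 2.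
    by ring.
  exact: lerD.
by exists (w ^- 2 + l); apply: cvCD (cvC_cst _) hl.
Qed.

Lemma cser_lipt w : 0 < Im w -> cser (lipt w) (Lip w - w ^- 2).
Proof.
move=> w0; apply: cvC_ext (cvCB (LipP w0) (cvC_cst (w ^- 2))) => n.
by rewrite /LP addrC addKr.
Qed.

Lemma LP_add1 w N : LP (w + 1) N = LP w N + (w + N.+1%:R) ^- 2 - (w - N%:R) ^- 2.
Proof.
elim: N => [|N IH]; first by rewrite /LP !big_geq // subr0 !addr0 addrAC subrr add0r.
have -> : LP (w + 1) N.+1 = LP (w + 1) N + lipt (w + 1) N.
  by rewrite /LP big_nat_recr //= addrA.
have -> : LP w N.+1 = LP w N + lipt w N by rewrite /LP big_nat_recr //= addrA.
rewrite IH /lipt.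
have -> : w + 1 + N.+1%:R = w + N.+2%:R by rewrite -[N.+2%:R]natr1; ring.
have -> : w + 1 - N.+1%:R = w - N%:R by rewrite -natr1; ring.
ring.
Qed.

Lemma Lip_add1 w : 0 < Im w -> Lip (w + 1) = Lip w.
Proof.
move=> w0; have w10 : 0 < Im (w + 1) by rewrite ImD /= addr0.
apply: cvC_unique (LipP w10) _.
have [h1 h2] := shift_sqr_cv0 w0.
have := cvCB (cvCD (LipP w0) (cvC_subseq (fun n => leqnSn n) h1)) h2.
by rewrite addr0 subr0; apply: cvC_ext => n; rewrite LP_add1.
Qed.

(** The shifts of w / 2 yield the even integers from -2N to 2N, those of (w + 1) / 2 the odd ones
    from -2N + 1 to 2N + 1; the unmatched 2N + 1 is the extra term. *)
Lemma LP_double w N : 0 < Im w -> LP (w / 2) N + LP ((w + 1) / 2) N =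
  4 * (LP w N.*2 + (w + N.*2.+1%:R) ^- 2).
Proof.
move=> w0; have w1 : w != 0 := H_neq0 w0.
have w2 : w + 1 != 0 := @H_addn_neq0 w 1 w0.
elim: N => [|N IH].
  have -> : (0.*2.+1%:R : C) = 1 by [].
  by rewrite /LP !big_geq // !addr0; field; rewrite w1 w2.
have LPS v M : LP v M.+1 = LP v M + lipt v M by rewrite /LP big_nat_recr //= addrA.
rewrite doubleS !LPS.
have -> : LP (w / 2) N + lipt (w / 2) N + (LP ((w + 1) / 2) N + lipt ((w + 1) / 2) N) =
  LP (w / 2) N + LP ((w + 1) / 2) N + (lipt (w / 2) N + lipt ((w + 1) / 2) N) by ring.
rewrite IH /lipt.
have E1 : w / 2 + N.+1%:R = (w + N.*2.+2%:R) / 2.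
  by rewrite -doubleS -muln2 natrM; field.
have E2 : w / 2 - N.+1%:R = (w - N.*2.+2%:R) / 2.
  by rewrite -doubleS -muln2 natrM; field.
have E3 : (w + 1) / 2 + N.+1%:R = (w + N.*2.+3%:R) / 2.
  by rewrite -[N.*2.+3%:R]natr1 -doubleS -muln2 natrM; field.
have E4 : (w + 1) / 2 - N.+1%:R = (w - N.*2.+1%:R) / 2.
  have -> : N.*2.+1%:R = N.+1%:R * 2 - 1 :> C.
    by rewrite -natr1 -[N.+1%:R]natr1 -muln2 natrM; ring.
  by field.
rewrite E1 E2 E3 E4 !exprMn !exprVn.
have n1 := H_addn_neq0 N.*2.+1 w0; have n2 := H_addn_neq0 N.*2.+2 w0.
have n3 := H_addn_neq0 N.*2.+3 w0.
have n4 := H_subn_neq0 N.*2.+1 w0; have n5 := H_subn_neq0 N.*2.+2 w0.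
move: n1 n2 n3 n4 n5; set a := w + N.*2.+1%:R; set b := w + N.*2.+2%:R.
set c := w + N.*2.+3%:R; set d := w - N.*2.+1%:R; set e := w - N.*2.+2%:R.
by move=> n1 n2 n3 n4 n5; field; rewrite n1 n2 n3 n4 n5.
Qed.

Lemma Lip_double w : 0 < Im w -> Lip (w / 2) + Lip ((w + 1) / 2) = 4 * Lip w.
Proof.
move=> w0; have h : (2^-1 : C) = (2^-1 : R)%:C by rewrite CV -natC.
have w10 : 0 < Im (w / 2) by rewrite mulrC h H_scale // invr_gt0.
have w20 : 0 < Im ((w + 1) / 2).
  by rewrite mulrC h H_scale ?invr_gt0 // ImD /= addr0.
apply: cvC_unique (cvCD (LipP w10) (LipP w20)) _.
have [h1 _] := shift_sqr_cv0 w0.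
have dn n : (n <= n.*2)%N by rewrite -addnn leq_addr.
have dn1 n : (n <= n.*2.+1)%N by apply: leq_trans (dn n) _.
have := cvCZ 4 (cvCD (cvC_subseq dn (LipP w0)) (cvC_subseq dn1 h1)).
by rewrite addr0; apply: cvC_ext => n; rewrite LP_double.
Qed.

Local Notation tpi := (2 * pi : R).

Lemma ex_tpi_sqr w : ex tpi w = ex pi w ^+ 2.
Proof.
have -> : tpi = pi * 2%:R by exact: mulrC.
by rewrite exXn.
Qed.

(** This is - pi^2 / sin^2(pi w), written in q = exp(2 pi i w) so that [csc_qsum] can expand it. *)
Definition csc w : C := (tpi ^+ 2)%:C * (ex tpi w / (1 - ex tpi w) ^+ 2).

Lemma ex_tpi1 : ex tpi 1 = 1.
Proof. by rewrite /ex mulr1 -(cexp_2pi_nat R 1) mulr1. Qed.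

Lemma ex_pi1 : ex (pi : R) 1 = -1.
Proof.
rewrite /ex mulr1 /cexp.
have -> : Re ('i%C * (pi : R)%:C) = 0 by rewrite !ReImE; ring.
have -> : Im ('i%C * (pi : R)%:C) = pi by rewrite !ReImE; ring.
rewrite expR0 mul1r cospi sinpi.
by apply: complexP; rewrite ?ReN ?ImN //= oppr0.
Qed.

Lemma nrm_ex_lt1 (t : R) w : 0 < t -> 0 < Im w -> nrm (ex t w) < 1.
Proof.
by move=> t0 w0; rewrite nrm_ex -[ltRHS]expR0 ltr_expR oppr_lt0 mulr_gt0.
Qed.

Lemma sub1_neq0 (q : C) : nrm q < 1 -> 1 - q != 0.
Proof. by move=> h; apply/eqP => /eqP; rewrite subr_eq0 => /eqP E; move: h; rewrite -E nrm1 ltxx. Qed.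

Lemma tpi_gt0 : 0 < tpi. Proof. by rewrite mulr_gt0 ?pi_gt0. Qed.

Lemma csc_add1 w : csc (w + 1) = csc w.
Proof. by rewrite /csc exDr ex_tpi1 mulr1. Qed.

Lemma csc_double w : 0 < Im w -> csc (w / 2) + csc ((w + 1) / 2) = 4 * csc w.
Proof.
move=> w0; set r := ex pi w.
have E0 v : ex tpi (v / 2) = ex pi v.
  by rewrite /ex CM -natC; congr cexp; field.
have E1 : ex tpi ((w + 1) / 2) = - r by rewrite E0 exDr ex_pi1 mulrN1.
have E2 : ex tpi w = r ^+ 2 by exact: ex_tpi_sqr.
have r1 : nrm r < 1 by apply: nrm_ex_lt1 => //; exact: pi_gt0.
have n1 := sub1_neq0 r1.
have n2 : 1 + r != 0 by have := @sub1_neq0 (- r); rewrite nrmN opprK; exact.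
rewrite /csc E0 E1 E2 -/r -!mulrDr mulrCA; congr (_ * _).
have -> : 1 - r ^+ 2 = (1 - r) * (1 + r) by ring.
by rewrite opprK; field; rewrite n1 n2.
Qed.

Lemma sin_lower (x : R) : `|x| <= 2^-1 -> `|x| <= `|sin (pi * x)|.
Proof.
have h (t : R) : 0 <= t <= 2^-1 -> t <= sin (pi * t).
  move=> /andP[t0 t1]; have p0 := pi_gt0 R; have p2 := pi_ge2 R.
  have [->|tn0] := eqVneq t 0; first by rewrite mulr0 sin0.
  have tp : 0 < t by rewrite lt_neqAle eq_sym tn0.
  have pt0 : 0 < pi * t by rewrite mulr_gt0.
  have pt1 : pi * t <= pi / 2 by rewrite ler_pM2l.
  (* Where cos >= 1/2, the mean value theorem and pi >= 2 suffice; otherwise sin^2 > 3/4 exceeds t^2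
     <= 1/4. *)
  have [c1|c1] := leP 2^-1 (cos (pi * t)).
    have [c] : exists2 c, c \in `]0, (pi * t)[ & sin (pi * t) - sin 0 = cos c * (pi * t - 0).
      apply: (@MVT _ sin cos) => //.
      by apply: continuous_subspaceT => u; exact: continuous_sin.
    rewrite in_itv /= sin0 !subr0 => /andP[c0 ct] ->.
    have : cos (pi * t) <= cos c.
      apply: ltW; rewrite ltr_cos // in_itv /=; apply/andP; split; lra.
    nra.
  have c0 : 0 <= cos (pi * t) by apply: cos_ge0_pihalf; apply/andP; split; lra.
  have s0 : 0 <= sin (pi * t) by apply: sin_ge0_pi; apply/andP; split; lra.
  have := cos2Dsin2 (pi * t); nra.
move=> x1; have [x0|x0] := leP 0 x.
  move: x1; rewrite (ger0_norm x0) => x1; apply: le_trans (ler_norm _).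
  by apply: h; rewrite x0.
move: x1; rewrite (ltr0_norm x0) => x1; rewrite -normrN -sinN -mulrN.
by apply: le_trans (ler_norm _); apply: h; rewrite x1 oppr_ge0 ltW.
Qed.

(** This is 2 i sin(pi w). *)
Definition sinc2 w : C := ex pi w - (ex pi w)^-1.

Lemma csc_sinc2 w : 0 < Im w -> csc w = (tpi ^+ 2)%:C / sinc2 w ^+ 2.
Proof.
move=> w0; have h0 := ex_neq0 pi w; rewrite /csc /sinc2.
rewrite ex_tpi_sqr.
have r1 : nrm (ex pi w) < 1 by apply: nrm_ex_lt1 => //; exact: pi_gt0.
have r2 : 1 - ex pi w ^+ 2 != 0.
  by apply: sub1_neq0; rewrite nrmX exprn_ilt1 ?nrm_ge0.
move: (ex pi w) h0 r2 => h h0 r2.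
have r3 : h - h^-1 != 0.
  have -> : h - h^-1 = - (1 - h ^+ 2) / h by field.
  by rewrite mulf_neq0 ?oppr_eq0 ?invr_eq0.
have -> : h - h^-1 = - (1 - h ^+ 2) / h by field.
by field; rewrite h0 r2.
Qed.

Lemma sinc2_lower w : 0 < Im w -> `|Re w| <= 2^-1 -> nrm w <= nrm (sinc2 w).
Proof.
move=> w0 wh; set x := Re w in wh; set y := Im w in w0.
pose E := expR (pi * y); have p0 := pi_gt0 R; have p2 := pi_ge2 R.
have E1 : 1 + pi * y <= E by exact: expR_ge1Dx.
have py : 0 < pi * y by rewrite mulr_gt0.
have Ei : E * E^-1 = 1 by rewrite mulfV // gt_eqF // expR_gt0.
have Ei0 : 0 < E^-1 by rewrite invr_gt0 expR_gt0.
have Ei1 : E^-1 <= 1 by rewrite invf_le1 ?expR_gt0 //; lra.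
pose c1 : R := E^-1 * cos (pi * x); pose s1 : R := E^-1 * sin (pi * x).
pose c2 : R := E * cos (pi * x); pose s2 : R := - (E * sin (pi * x)).
have hexp : ex pi w = c1 +i* s1.
  rewrite /ex /cexp -/x -/y.
  have -> : Re ('i%C * pi%:C * w) = - (pi * y) by rewrite !ReImE; ring.
  have -> : Im ('i%C * pi%:C * w) = pi * x by rewrite !ReImE; ring.
  by rewrite expRN -/E; apply: complexP; rewrite !ReImE ?mul0r ?subr0 ?addr0.
have hexpV : (ex pi w)^-1 = c2 +i* s2.
  apply: (mulfI (ex_neq0 pi w)); rewrite mulfV ?ex_neq0 // hexp.
  have cs := cos2Dsin2 (pi * x).
  apply: complexP; rewrite !ReImE.
    have -> : c1 * c2 - s1 * s2 =
      E * E^-1 * (cos (pi * x) ^+ 2 + sin (pi * x) ^+ 2) by rewrite /c1 /c2 /s1 /s2; ring.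
    by rewrite Ei cs mulr1.
  rewrite (_ : c1 * s2 + s1 * c2 = 0) //; rewrite /c1 /c2 /s1 /s2; ring.
pose a1 : R := (E^-1 - E) * cos (pi * x); pose a2 : R := (E^-1 + E) * sin (pi * x).
have sE : sinc2 w = a1 +i* a2.
  rewrite /sinc2 hexpV hexp; apply: complexP; rewrite !ReImE /a1 /a2 /c1 /c2 /s1 /s2; ring.
have hs := sin_lower wh.
have n1 : 2 * `|x| <= nrm (sinc2 w).
  apply: le_trans (nrm_Im _); rewrite sE Im_pair /a2 normrM.
  apply: ler_pM => //; rewrite ger0_norm; last by lra.
  have : 0 <= (E - 1) ^+ 2 * E^-1 by rewrite mulr_ge0 ?sqr_ge0 ?ltW.
  nra.
have n2 : 2 * y <= nrm (sinc2 w).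
  have h0 : 0 <= E - E^-1 by lra.
  have : (E - E^-1) ^+ 2 <= nrm (sinc2 w) ^+ 2.
    rewrite nrm_sqr sE !ReImE /a1 /a2; have cs := cos2Dsin2 (pi * x).
    have -> : ((E^-1 - E) * cos (pi * x)) ^+ 2 + ((E^-1 + E) * sin (pi * x)) ^+ 2 =
      (E - E^-1) ^+ 2 * (cos (pi * x) ^+ 2 + sin (pi * x) ^+ 2) +
      4 * (E * E^-1) * sin (pi * x) ^+ 2 by ring.
    by rewrite cs Ei mulr1 lerDl; apply: mulr_ge0; [lra | exact: sqr_ge0].
  rewrite ler_pXn2r ?nnegrE ?nrm_ge0 // => h3.
  have : 2 * y <= pi * y by rewrite ler_pM2r.
  lra.
apply: le_trans (nrm_le_ReIm _) _; rewrite -/x -/y (gtr0_norm w0); lra.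
Qed.

Lemma csc_bound : exists2 M : R, 0 <= M & forall w, 0 < Im w -> `|Re w| <= 2^-1 ->
  nrm w <= 1 -> nrm (csc w + w ^- 2) <= M.
Proof.
pose K : R := 16 * (pi ^+ 3 * expR pi); pose M := K * (K + 4 * pi).
have p0 := pi_gt0 R.
have K0 : 0 <= K by rewrite !mulr_ge0 ?exprn_ge0 ?expR_ge0 // ltW.
exists M => [|w w0 wh w1]; first by rewrite mulr_ge0 // addr_ge0 // mulr_ge0 // ltW.
have wn0 := H_neq0 w0; have nw0 : 0 < nrm w by rewrite nrm_gt0.
have sl := sinc2_lower w0 wh; have s0 : sinc2 w != 0.
  by rewrite -nrm_gt0; apply: lt_le_trans sl.
rewrite csc_sinc2 //; pose x : C := 'i%C * pi%:C * w.
have nx : nrm x = pi * nrm w by rewrite !nrmM nrm_i mul1r nrmC gtr0_norm.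
have x2 : (tpi ^+ 2)%:C * w ^+ 2 = - (2 * x) ^+ 2.
  have ii : 'i%C ^+ 2 = -1 :> C by exact: sqr_i.
  rewrite /x !CM -natC.
  have -> : - (2 * ('i%C * pi%:C * w)) ^+ 2 = - ('i%C ^+ 2) * (2 * pi%:C * (2 * pi%:C)) * w ^+ 2 by ring.
  by rewrite ii opprK mul1r.
(* With x = i pi w, sinc2 w - 2 x is O(w^3), as the even Taylor terms cancel, and sinc2 w + 2 x is
   O(w), while the denominator is at least |w|^4: the double poles cancel. *)
have -> : (tpi ^+ 2)%:C / sinc2 w ^+ 2 + w ^- 2 =
  (sinc2 w - 2 * x) * (sinc2 w + 2 * x) / (sinc2 w ^+ 2 * w ^+ 2).
  have -> : (sinc2 w - 2 * x) * (sinc2 w + 2 * x) =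
     sinc2 w ^+ 2 + (tpi ^+ 2)%:C * w ^+ 2 by rewrite x2; ring.
  by field; rewrite s0 wn0.
have d1 : nrm (sinc2 w - 2 * x) <= K * nrm w ^+ 3.
  have -> : sinc2 w - 2 * x = (cexp x - 1 - x - x ^+ 2 / 2) -
     (cexp (- x) - 1 - - x - (- x) ^+ 2 / 2).
    by rewrite /sinc2 /ex -/x cexpN; ring.
  apply: le_trans (nrmB _ _) _.
  have := cexp_taylor3 x; have := cexp_taylor3 (- x); rewrite nrmN nx => a1 a2.
  have a3 : (pi * nrm w) ^+ 3 * expR (pi * nrm w) <= pi ^+ 3 * expR pi * nrm w ^+ 3.
    rewrite exprMn mulrAC ler_wpM2r ?exprn_ge0 ?nrm_ge0 //.
    rewrite ler_wpM2l ?exprn_ge0 ?(ltW p0) // ler_expR.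
    by rewrite ger_pMr.
  rewrite /K; lra.
have d2 : nrm (sinc2 w + 2 * x) <= (K + 4 * pi) * nrm w.
  have -> : sinc2 w + 2 * x = (sinc2 w - 2 * x) + 4 * x by ring.
  apply: le_trans (nrmD _ _) _; rewrite [nrm (4 * x)]nrmM nrm_nat nx.
  have -> : (K + 4 * pi) * nrm w = K * nrm w + 4 * (pi * nrm w) by ring.
  rewrite lerD2r.
  by apply: le_trans d1 _; rewrite ler_wpM2l // -[leRHS]expr1 ler_wiXn2l // nrm_ge0.
rewrite nrmM nrmV !nrmM.
rewrite ler_pdivrMr; last by rewrite -!nrmM !nrm_gt0 !mulf_neq0.
apply: le_trans (ler_pM (nrm_ge0 _) (nrm_ge0 _) d1 d2) _.
have -> : K * nrm w ^+ 3 * ((K + 4 * pi) * nrm w) = M * nrm w ^+ 4 by rewrite /M; ring.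
have M0 : 0 <= M by rewrite mulr_ge0 // addr_ge0 // mulr_ge0 // ltW.
rewrite ler_wpM2l //.
have -> : nrm w ^+ 4 = nrm w ^+ 2 * nrm w ^+ 2 by ring.
rewrite -!expr2 ler_wpM2r ?exprn_ge0 ?nrm_ge0 //.
by rewrite lerXn2r ?nnegrE ?nrm_ge0.
Qed.

Lemma center_shift (x : R) : exists n : nat, `|x - n%:R| <= 2^-1 \/ `|x + n%:R| <= 2^-1.
Proof.
pose m := Num.floor (x + 2^-1).
have h1 : m%:~R <= x + 2^-1 := floor_le _.
have h2 : x + 2^-1 < m%:~R + 1 by rewrite -intrD1 floorD1_gt.
case: m h1 h2 => n h1 h2.
  by exists n; left; rewrite ler_norml; apply/andP; split; rewrite -pmulrn in h1 h2; lra.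
exists n.+1; right; rewrite NegzE mulrNz -pmulrn in h1 h2.
by rewrite ler_norml; apply/andP; split; lra.
Qed.

Lemma periodic_center (f : C -> C) : (forall w, 0 < Im w -> f (w + 1) = f w) ->
  forall w, 0 < Im w -> exists w', [/\ 0 < Im w', `|Re w'| <= 2^-1 & f w' = f w].
Proof.
move=> per.
have pern n w : 0 < Im w -> f (w + n%:R) = f w.
  move=> w0; elim: n => [|n IH]; first by rewrite addr0.
  by rewrite -natr1 addrA per // ImD Im_nat addr0.
move=> w w0; have [n [hn|hn]] := center_shift (Re w).
  have w'0 : 0 < Im (w - n%:R) by rewrite ImD ImN Im_nat subr0.
  exists (w - n%:R); split; rewrite ?ReD ?ReN ?Re_nat //.
  by rewrite -(pern n _ w'0) subrK.
exists (w + n%:R); split; rewrite ?ReD ?Re_nat //; last exact: pern.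
by rewrite ImD Im_nat addr0.
Qed.

(** By periodicity |Re w| <= 1/2 may be assumed. For |w| <= 1 the double poles of [Lip] and [csc] at
    0 cancel; for |w| > 1 the two functions are bounded separately. *)
Lemma lip_csc_bounded : exists M : R, forall w, 0 < Im w -> nrm (Lip w + csc w) <= M.
Proof.
have [M M0 hM] := csc_bound; have [_ [B hB]] := bsum_b32.
have B0 : 0 <= B by have := hB 0%N; rewrite big_geq.
have t0 := tpi_gt0.
exists (8 * B + 1 + tpi ^+ 2 + M) => w w0.
have [w' [w'0 w'h <-]] := @periodic_center (fun w => Lip w + csc w)
  (fun w h => f_equal2 +%R (Lip_add1 h) (csc_add1 w)) w w0.
have wn0 := H_neq0 w'0.
have h1 : nrm (Lip w' - w' ^- 2) <= 8 * B.
  apply: (@bsum_le_cser _ _ _ (fun n => 8 * b32 n)) (cser_lipt w'0) _; last first.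
    by move=> n; rewrite -mulr_sumr ler_pM2l.
  have hh (v : C) n : n.+1%:R <= 2 * nrm v -> nrm (v ^- 2) <= 4 * b32 n.
    move=> a1; apply: le_trans (_ : 4 * (n.+1%:R ^+ 2)^-1 <= _); last first.
      by rewrite ler_pM2l // inv_sqr_b32.
    have n0 : 0 < n.+1%:R :> R by rewrite ltr0n.
    rewrite nrmV nrmX.
    have -> : 4 * (n.+1%:R ^+ 2)^-1 = ((n.+1%:R / 2) ^+ 2)^-1 :> R.
      by field; rewrite gt_eqF.
    rewrite lef_pV2 ?posrE ?exprn_gt0 ?divr_gt0 //; last by lra.
    by rewrite lerXn2r ?nnegrE ?nrm_ge0 ?divr_ge0 //; lra.
  move=> n; apply: le_trans (nrmD _ _) _.
  have n1 : 1 <= n.+1%:R :> R by rewrite ler1n.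
  have -> : 8 * b32 n = 4 * b32 n + 4 * b32 n by ring.
  move: w'h; rewrite ler_norml => /andP[a1 a2].
  apply: lerD; apply: hh.
    have := nrm_Re (w' + n.+1%:R); rewrite ReD Re_nat ler_norml => /andP[_ b2]; lra.
  have := nrm_Re (w' - n.+1%:R); rewrite ReD ReN Re_nat ler_norml => /andP[b1 _]; lra.
have tp2 : 0 <= tpi ^+ 2 by rewrite exprn_ge0 // ltW.
have [w1|w1] := leP (nrm w') 1.
  have -> : Lip w' + csc w' = (Lip w' - w' ^- 2) + (csc w' + w' ^- 2) by ring.
  apply: le_trans (nrmD _ _) _; have := hM _ w'0 w'h w1; lra.
have -> : Lip w' + csc w' = (Lip w' - w' ^- 2) + w' ^- 2 + csc w' by ring.
have n1 : nrm (w' ^- 2) <= 1.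
  by rewrite nrmV nrmX invf_le1 ?exprn_gt0 ?exprn_ege1 ?ltW //; lra.
have n2 : nrm (csc w') <= tpi ^+ 2.
  rewrite csc_sinc2 // nrmM nrmV nrmX nrmC ger0_norm // ger_pMr ?exprn_gt0 //.
  have s1 : 1 <= nrm (sinc2 w') by apply: le_trans (sinc2_lower w'0 w'h); exact: ltW.
  by rewrite invf_le1 ?exprn_gt0 ?exprn_ege1 //; lra.
apply: le_trans (nrmD _ _) _; have := nrmD (Lip w' - w' ^- 2) (w' ^- 2); lra.
Qed.

(* Herglotz: the bounded function Lip + csc satisfies
   4 D(w) = D(w/2) + D((w+1)/2), hence vanishes. *)
Lemma lip_csc w : 0 < Im w -> Lip w = - csc w.
Proof.
move=> w0; have [M hM] := lip_csc_bounded.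
pose S : set R := [set r | exists2 v, 0 < Im v & r = nrm (Lip v + csc v)].
have hS : has_sup S.
  by split; [exists (nrm (Lip w + csc w)), w | exists M => _ [v v0 ->]; exact: hM].
have ub v : 0 < Im v -> nrm (Lip v + csc v) <= sup S.
  by move=> v0; apply: sup_upper_bound => //; exists v.
have : sup S <= sup S / 2.
  apply: ge_sup; first exact: hS.1.
  move=> _ [v v0 ->].
  have h2 : (2^-1 : C) = (2^-1 : R)%:C by rewrite CV -natC.
  have v10 : 0 < Im (v / 2) by rewrite mulrC h2 H_scale // invr_gt0.
  have v20 : 0 < Im ((v + 1) / 2).
    by rewrite mulrC h2 H_scale ?invr_gt0 // ImD /= addr0.
  have -> : Lip v + csc v = 4^-1 * ((Lip (v / 2) + csc (v / 2)) +
      (Lip ((v + 1) / 2) + csc ((v + 1) / 2))).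
    have E4 : (4^-1 * 4 : C) = 1 by rewrite mulVf // pnatr_eq0.
    by rewrite (addrACA (Lip (v / 2))) (Lip_double v0) (csc_double v0) -mulrDr mulrA E4 mul1r.
  rewrite nrmM nrmV nrm_nat; have := ub _ v10; have := ub _ v20.
  have := nrmD (Lip (v / 2) + csc (v / 2)) (Lip ((v + 1) / 2) + csc ((v + 1) / 2)).
  lra.
move=> hs; have := ub w w0 => h; apply/eqP; rewrite -addr_eq0 -nrm_eq0.
by rewrite eq_le nrm_ge0 andbT; lra.
Qed.

Lemma growth_nat : growth (fun n => n%:R : C).
Proof.
have := growthM_nat (growth_cst (1 : C)).
by under eq_fun do rewrite mulr1.
Qed.

(** The sums g of q^n and s of n q^n satisfy g = 1 + q g and s = q (s + g), whence s = q / (1 -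
    q)^2. *)
Lemma csc_qsum w : 0 < Im w -> csc w = (tpi ^+ 2)%:C * qsum tpi (fun n => n%:R) w.
Proof.
move=> w0; rewrite /csc; congr (_ * _); set q := ex tpi w.
have q1 : 1 - q != 0 by apply: sub1_neq0; apply: nrm_ex_lt1 => //; exact: tpi_gt0.
have hs := qsumP tpi_gt0 growth_nat w0; set s := qsum _ _ _ in hs *.
have hg := qsumP tpi_gt0 (growth_cst (1 : C)) w0; set g := qsum _ _ _ in hg.
have hs' : cser (fun n => n%:R * q ^+ n) s.
  by apply: cser_ext hs => n; rewrite /qterm exXn.
have hg' : cser (fun n => q ^+ n) g.
  by apply: cser_ext hg => n; rewrite /qterm exXn mul1r.
have Eg : g = 1 + q * g.
  apply: (cser_unique hg'); rewrite -[1](expr0 q); apply: cser_shift.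
  by apply: cser_ext (cserZ q hg') => n; rewrite exprS.
have Es : s = 0 + q * (s + g).
  apply: (cser_unique hs'); rewrite -[0](mul0r (q ^+ 0)).
  apply: (@cser_shift _ (fun n => n%:R * q ^+ n)).
  apply: cser_ext (cserZ q (cserD hs' hg')) => n.
  by rewrite exprS -natr1; ring.
have Es' : (1 - q) * s = q * g by rewrite mulrBl mul1r {1}Es; ring.
have Eg' : (1 - q) * g = 1 by rewrite mulrBl mul1r {1}Eg addrK.
apply: (mulfI q1); rewrite Es'; apply: (mulfI q1); rewrite [RHS]mulrCA Eg' mulr1.
by field.
Qed.

End Lipschitz.

(** * The Eisenstein series of weight 2 and its behaviour under z -> -1/z *)

Section EisensteinTwo.
Variable R : realType.
Local Notation C := R[i].
Local Notation Re := (@complex.Re R).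
Local Notation Im := (@complex.Im R).
Local Notation tpi := (2 * pi : R).
Implicit Types (z w : C).

(** The divisor sum sigma(m), as the sum of the complementary divisors m / (c + 1): the shape in
    which it arises from the q-series at (c + 1) z. *)
Definition sig (m : nat) : C :=
  \sum_(0 <= c < m) spread c.+1 (fun n => n%:R : C) m.

Lemma nrm_spread_nat c m : nrm (spread c.+1 (fun n => n%:R : C) m) <= m%:R.
Proof.
rewrite /spread; case: ifP => _; last by rewrite nrm0.
by rewrite nrm_nat ler_nat leq_div.
Qed.

Lemma growth_sig : growth sig.
Proof.
apply: (@growth_le R sig (fun n => n%:R * n%:R)); last exact: growthM_nat (@growth_nat R).
move=> m.
apply: le_trans (nrm_sum _ _ _) _; rewrite nrmM nrm_nat.
apply: le_trans (_ : \sum_(0 <= c < m) m%:R <= _).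
  by apply: ler_sum => c _; exact: nrm_spread_nat.
by rewrite sumr_const_nat subn0 mulr_natl.
Qed.

Lemma spread_nat_small c m : (m <= c)%N -> spread c.+1 (fun n => n%:R : C) m = 0.
Proof.
move=> mc; rewrite /spread; case: ifP => // _.
by rewrite divn_small // ltnS.
Qed.

Lemma lambert z : 0 < Im z ->
  cser (fun c => qsum tpi (fun n => n%:R) (c.+1%:R * z)) (qsum tpi sig z).
Proof.
move=> z0; have t0 := tpi_gt0 R; have p0 := pi_gt0 R.
set f := fun c => qsum tpi (fun n => n%:R) (c.+1%:R * z).
pose a M c := \sum_(0 <= m < M) qterm tpi (spread c.+1 (fun n => n%:R : C)) z m.
(* [si] is the square root of |q|. A term that is not zero has m > c, so |q|^m = si^m si^m <= si^c
   si^m: one half decays in c, the other is summed over m. *)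
pose si := expR (- (pi * Im z)).
have [_ [S hS]] : bsum (fun m => m%:R * si ^+ m).
  have p20 : 0 < pi * Im z / 2 by rewrite divr_gt0 // mulr_gt0.
  have [B B0 hB] := @growth_nat R _ p20.
  apply: (@le_bsum _ _ (fun m => B * expR (- (pi * Im z / 2)) ^+ m)).
    move=> m; rewrite mulr_ge0 ?exprn_ge0 ?expR_ge0 //=.
    have := hB m; rewrite nrm_nat => h.
    apply: le_trans (ler_wpM2r (exprn_ge0 _ (expR_ge0 _)) h) _.
    rewrite -!expRM_natr -[leLHS]mulrA ler_wpM2l // -expRD ler_expR.
    by rewrite le_eqVlt; apply/orP; left; apply/eqP; field.
  by apply: bsumZ => //; apply: bsum_geo; apply: expRN_itv.
have S0 : 0 <= S by have := hS 0%N; rewrite big_geq.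
have si01 : 0 <= si < 1 by apply: expRN_itv; rewrite mulr_gt0.
have qE m : expR (- (tpi * Im z)) ^+ m = si ^+ m * si ^+ m.
  by rewrite -exprMn /si -expRD; congr (expR _ ^+ _); ring.
have ab M c : nrm (a M c) <= S * si ^+ c.
  apply: le_trans (nrm_sum _ _ _) _.
  apply: le_trans (_ : \sum_(0 <= m < M) si ^+ c * (m%:R * si ^+ m) <= _); last first.
    by rewrite -mulr_sumr mulrC ler_wpM2r // exprn_ge0 // expR_ge0.
  apply: ler_sum => m _; rewrite nrm_qterm qE.
  have [mc|cm] := leqP m c.
    by rewrite spread_nat_small // nrm0 mul0r !mulr_ge0 // exprn_ge0 // expR_ge0.
  have e0 k : 0 <= si ^+ k by rewrite exprn_ge0 // expR_ge0.
  apply: le_trans (_ : m%:R * (si ^+ m * si ^+ m) <= _).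
    by rewrite ler_wpM2r ?nrm_spread_nat // mulr_ge0.
  have -> : si ^+ c * (m%:R * si ^+ m) = m%:R * (si ^+ m * si ^+ c) by ring.
  rewrite ler_wpM2l // ler_wpM2l // ler_wiXn2l //; first exact: expR_ge0.
    by move: si01 => /andP[_ /ltW].
  exact: ltnW.
have bb : bsum (fun c => S * si ^+ c) by apply: bsumZ => //; exact: bsum_geo.
have af c : cvC (a^~ c) (f c).
  have c0 : 0 < c.+1%:R :> R by rewrite ltr0n.
  have h1 := isq_affine 0 c0 (growth_isq t0 (@growth_nat R)).
  have h2 := isq_spread (ltn0Sn c) h1.
  have -> : a^~ c = (fun M => \sum_(0 <= m < M) qterm (tpi * c.+1%:R / c.+1%:R)
     (spread c.+1 (fun n => n%:R * ex (tpi * n%:R) 0%:C)) z m).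
    apply/funext => M; apply: eq_bigr => m _; rewrite /qterm mulfK ?gt_eqF //.
    congr (_ * _); rewrite /spread; case: ifP => // _.
    by rewrite /ex mulr0 cexp0 mulr1.
  have := h2.2 z z0; rewrite /f natC addr0; exact.
have [s' hs'] : exists s', cser f s'.
  apply: cser_abs bb => c; apply: cvC_le (af c) _ => M; exact: ab.
have hM M : cser (a M) (\sum_(0 <= m < M) qterm tpi sig z m).
  apply: (@eq_cvC _ M _ _ _ _ (cvC_cst _)) => K MK.
  rewrite /a exchange_big /= big_nat [RHS]big_nat; apply: eq_bigr => m /andP[_ mM].
  rewrite /qterm -mulr_suml; congr (_ * _).
  have mK : (m <= K)%N by apply: leq_trans MK; exact: ltnW.
  rewrite /sig [RHS](big_cat_nat (n := m)) //=.
  rewrite [X in _ = _ + X]big1_seq ?addr0 // => c.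
  by rewrite mem_index_iota => /andP[_ /andP[mc _]]; exact: spread_nat_small.
have := tannery ab bb af hM hs'.
move=> /(cvC_unique (qsumP t0 growth_sig z0)) ->; exact: hs'.
Qed.

Definition zeta2 : C := xget 0 [set l | cser (fun n => (n.+1%:R : C) ^- 2) l].

Lemma zeta2P : cser (fun n => (n.+1%:R : C) ^- 2) zeta2.
Proof.
suff [l hl] : exists l, cser (fun n => (n.+1%:R : C) ^- 2) l.
  exact: (@xgetPex _ 0 [set l | cser _ l] (ex_intro _ l hl)).
apply: cser_abs (bsum_inv_sqr R) => n.
by rewrite nrmV nrmX nrm_nat.
Qed.

Lemma cvC_Im0 (u : nat -> C) l : cvC u l -> (forall n, Im (u n) = 0) -> Im l = 0.
Proof.
move=> ul u0; apply/eqP; rewrite -normr_eq0 eq_le normr_ge0 andbT.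
apply/ler_addgt0Pr => e e0; have [N h] := ul e e0; rewrite add0r.
by have := le_trans (nrm_Im _) (h N (leqnn _)); rewrite ImD ImN u0 sub0r normrN.
Qed.

Lemma zeta2_real : zeta2 = (Re zeta2)%:C.
Proof.
apply: complexP => //=; apply: cvC_Im0 zeta2P _ => n; rewrite Im_sum big1 // => k _.
by rewrite natC -exprVn -CV -rmorphXn.
Qed.

Lemma zeta2_neq0 : zeta2 != 0.
Proof.
apply/eqP => E; have [N h] := zeta2P (ltac:(lra) : 0 < (2^-1 : R)).
have := h N.+1 (leqnSn _); rewrite E subr0 big_nat_recl // expr1n invr1.
move=> /(le_trans (nrm_Re _)); rewrite ReD Re_sum.
have : 0 <= \sum_(0 <= i < N) Re ((i.+2%:R : C) ^- 2).
  apply: sumr_ge0 => k _; rewrite natC -exprVn -CV -rmorphXn /=.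
  by rewrite exprn_ge0 // invr_ge0.
set S := \sum_(_ <= _ < _) _ => S0; have -> : Re 1 = 1 by [].
by rewrite ger0_norm; lra.
Qed.

(** Half the sum of (c z + d)^(-2), taken over d first and then over c; classically zeta(2)
    E_2(z). *)
Definition gei z : C := zeta2 - (tpi ^+ 2)%:C * qsum tpi sig z.

Lemma gei_Lip z : 0 < Im z -> cser (fun c => Lip (c.+1%:R * z)) (gei z - zeta2).
Proof.
move=> z0.
have -> : gei z - zeta2 = - (tpi ^+ 2)%:C * qsum tpi sig z by rewrite /gei; ring.
apply: cser_ext (cserZ (- (tpi ^+ 2)%:C) (lambert z0)) => c.
have cz0 := H_scalen c z0.
by rewrite (lip_csc cz0) (csc_qsum cz0); ring.
Qed.

(** The difference 1/(w + d) - 1/(w + d + 1) agrees with (w + d + 1)^(-2) up to third order.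
    Subtracting differences of [ust] from the pairs [sst] thus leaves [rst], which is absolutely
    summable over c and d. *)
Definition ust z c d : C := (c.+1%:R * z + d%:R)^-1 - (c.+1%:R * z - d%:R)^-1.
Definition sst z c d : C := (c.+1%:R * z + d.+1%:R) ^- 2 + (c.+1%:R * z - d.+1%:R) ^- 2.
Definition rst z c d : C := sst z c d - (ust z c d - ust z c d.+1).

Lemma rstE z c d : 0 < Im z ->
  rst z c d = (c.+1%:R * z - d.+1%:R) ^- 2 * (c.+1%:R * z - d%:R)^-1
            - (c.+1%:R * z + d.+1%:R) ^- 2 * (c.+1%:R * z + d%:R)^-1.
Proof.
move=> z0; have cz0 := H_scalen c z0; rewrite /rst /sst /ust.
have n1 := H_addn_neq0 d cz0; have n2 := H_addn_neq0 d.+1 cz0.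
have n3 := H_subn_neq0 d cz0; have n4 := H_subn_neq0 d.+1 cz0.
move: n1 n2 n3 n4; rewrite -[d.+1%:R]natr1; move: (c.+1%:R * z) (d%:R : C) => w m.
by move=> n1 n2 n3 n4; field; rewrite n1 n2 n3 n4.
Qed.

Lemma rst_bound z : 0 < Im z -> exists2 K : R, 0 <= K &
  forall c d, nrm (rst z c d) <= (K * b32 R c) * (K * b32 R d).
Proof.
move=> z0; have [k k0 hk] := lattice_lower z0.
pose K0 := 4 / k ^+ 3; have K00 : 0 <= K0 by rewrite divr_ge0 // exprn_ge0 // ltW.
exists (K0 + 1) => [|c d]; first by rewrite addr_ge0.
rewrite rstE //; pose s : R := c.+1%:R + d.+1%:R.
have c1 : 1 <= c.+1%:R :> R by rewrite ler1n.
have d1 : 1 <= d.+1%:R :> R by rewrite ler1n.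
have s0 : 0 < s by rewrite /s; lra.
have low (m : R) : `|m| = d.+1%:R -> k * s <= nrm (c.+1%:R * z + m%:C).
  by move=> hm; have := hk c.+1%:R m (ler0n _ _); rewrite hm -natC.
have low' (m : R) : `|m| = d%:R -> k * (s / 2) <= nrm (c.+1%:R * z + m%:C).
  move=> hm; have := hk c.+1%:R m (ler0n _ _); rewrite hm -natC; apply: le_trans.
  by rewrite ler_pM2l // /s -[d.+1%:R]natr1; have : 0 <= d%:R :> R by []; lra.
have ks : 0 < k * s by rewrite mulr_gt0.
have ks2 : 0 < k * (s / 2) by rewrite mulr_gt0 // divr_gt0.
have bd (v v' : C) : k * s <= nrm v -> k * (s / 2) <= nrm v' ->
    nrm (v ^- 2 * v'^-1) <= 2 / (k ^+ 3 * s ^+ 3).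
  move=> h1 h2; rewrite nrmM !nrmV nrmX.
  have -> : 2 / (k ^+ 3 * s ^+ 3) = ((k * s) ^+ 2)^-1 * (k * (s / 2))^-1.
    by field; rewrite !gt_eqF.
  apply: ler_pM; rewrite ?invr_ge0 ?exprn_ge0 ?nrm_ge0 //.
    rewrite lef_pV2 ?posrE ?exprn_gt0 //; last by apply: lt_le_trans h1.
    by rewrite lerXn2r ?nnegrE ?nrm_ge0 // ltW.
  by rewrite lef_pV2 ?posrE //; apply: lt_le_trans h2.
have nn n : `|- n%:R| = n%:R :> R by rewrite normrN normr_nat.
apply: le_trans (nrmB _ _) _.
have e1 : nrm ((c.+1%:R * z - d.+1%:R) ^- 2 * (c.+1%:R * z - d%:R)^-1) <= 2 / (k ^+ 3 * s ^+ 3).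
  by apply: bd; [rewrite (natC R d.+1) -CN; apply: low | rewrite (natC R d) -CN; apply: low'].
have e2 : nrm ((c.+1%:R * z + d.+1%:R) ^- 2 * (c.+1%:R * z + d%:R)^-1) <= 2 / (k ^+ 3 * s ^+ 3).
  by apply: bd; [rewrite (natC R d.+1); apply: low | rewrite (natC R d); apply: low']; rewrite normr_nat.
apply: le_trans (lerD e1 e2) _.
have -> : 2 / (k ^+ 3 * s ^+ 3) + 2 / (k ^+ 3 * s ^+ 3) = K0 * (s ^+ 3)^-1.
  by rewrite /K0; field; rewrite !gt_eqF.
(* The inequality x y <= x^2 + y^2 for the square roots x, y of c + 1 and d + 1, cubed. *)
have b1 : (s ^+ 3)^-1 <= b32 R c * b32 R d.
  rewrite /b32 -invfM -exprMn; set x := Num.sqrt _; set y := Num.sqrt _.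
  have x0 : 0 < x by rewrite sqrtr_gt0 ltr0n.
  have y0 : 0 < y by rewrite sqrtr_gt0 ltr0n.
  have xE : x ^+ 2 = c.+1%:R by rewrite sqr_sqrtr.
  have yE : y ^+ 2 = d.+1%:R by rewrite sqr_sqrtr.
  rewrite lef_pV2 ?posrE ?exprn_gt0 ?mulr_gt0 // lerXn2r ?nnegrE ?mulr_ge0 ?ltW //.
  by rewrite /s -xE -yE; have := sqr_ge0 (x - y); nra.
have := b32_ge0 R c; have := b32_ge0 R d.
set x := b32 R c in b1 *; set y := b32 R d in b1 * => y0 x0.
have xy0 : 0 <= x * y by rewrite mulr_ge0.
apply: le_trans (ler_wpM2l K00 b1) _.
have -> : (K0 + 1) * x * ((K0 + 1) * y) = (K0 + 1) ^+ 2 * (x * y) by ring.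
rewrite ler_wpM2r //; nra.
Qed.

(** The telescoping sum starts at [ust z c 0] = 0, so the correction leaves the sums over d
    unchanged; only the sums over c see it. *)
Lemma cser_t z c : 0 < Im z -> cser (fun d => ust z c d - ust z c d.+1) 0.
Proof.
move=> z0; have cz0 := H_scalen c z0.
have -> : (0 : C) = ust z c 0 by rewrite /ust addr0 subr0 subrr.
apply: cser_tele; have [K K0 h] := shift_inv_bound cz0.
apply: cvC_squeeze (@nat_small R (2 * K)) => n; rewrite subr0.
apply: le_trans (nrmB _ _) _; have [h1 h2] := h n.
have -> : 2 * K / n.+1%:R = K / n.+1%:R + K / n.+1%:R by ring.
exact: lerD.
Qed.

Definition delta z : C := z ^- 2 * gei (- z^-1) - gei z.

Lemma H_Ninv z : 0 < Im z -> 0 < Im (- z^-1).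
Proof.
move=> z0; have n0 : 0 < nrm z ^+ 2 by rewrite exprn_gt0 // nrm_gt0 H_neq0.
have -> : - z^-1 = - (((nrm z ^+ 2)^-1)%:C * (z^*)%C).
  have zz : z * (z^*)%C = (nrm z ^+ 2)%:C.
    by apply: complexP; rewrite nrm_sqr !ReImE; ring.
  congr (- _); apply: (mulfI (H_neq0 z0)); rewrite mulfV ?H_neq0 //.
  by rewrite mulrCA zz -CM mulVf // gt_eqF.
by rewrite !ReImE mul0r addr0 mulrN opprK mulr_gt0 ?invr_gt0.
Qed.

(* The sums over c and over d may be exchanged after subtracting the telescoping
   terms; the defect of modularity is what the telescoping terms leave behind. *)
Lemma delta_lim z : 0 < Im z -> exists2 U : nat -> C,
  (forall M, cser (fun c => ust z c M) (U M)) & cvC U (- delta z).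
Proof.
move=> z0; have zn0 := H_neq0 z0; have w0 := H_Ninv z0; set w := - z^-1 in w0.
pose S c : C := Lip (c.+1%:R * z) - (c.+1%:R * z) ^- 2.
(* Summed over c, the pairs [sst] form a Lipschitz sum at multiples of w = -1/z, since m w + c = (c
   z - m) / z. *)
pose S' d : C := z ^- 2 * Lip (d.+1%:R * w) - (d.+1%:R : C) ^- 2.
have hS c : cser (sst z c) (S c) by exact: cser_lipt (H_scalen c z0).
have hS' d : cser (fun c => sst z c d) (S' d).
  have dw0 := H_scalen d w0.
  have h := cserZ (z ^- 2) (cser_lipt dw0).
  have -> : S' d = z ^- 2 * (Lip (d.+1%:R * w) - (d.+1%:R * w) ^- 2).
    have dn0 : (d.+1%:R : C) != 0 by rewrite pnatr_eq0.
    rewrite /S' mulrBr /w; congr (_ - _).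
    by move: (d.+1%:R : C) dn0 => m dn0; field; rewrite zn0 dn0.
  apply: cser_ext h => c; rewrite /lipt /sst.
  have n1 := H_addn_neq0 c.+1 dw0; have n2 := H_subn_neq0 c.+1 dw0.
  have E1 : d.+1%:R * w + c.+1%:R = (c.+1%:R * z - d.+1%:R) / z.
    by rewrite /w; field.
  have E2 : d.+1%:R * w - c.+1%:R = - (c.+1%:R * z + d.+1%:R) / z.
    by rewrite /w; field.
  have cz0 := H_scalen c z0.
  have n3 := H_addn_neq0 d.+1 cz0; have n4 := H_subn_neq0 d.+1 cz0.
  rewrite E1 E2; move: (c.+1%:R * z) (d.+1%:R : C) n3 n4 => v m n3 n4.
  by field; rewrite zn0 n3 n4.
have [K K0 rb] := rst_bound z0.
have bb : bsum (fun n => K * b32 R n) by apply: bsumZ => //; exact: bsum_b32.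
have hr c : cser (rst z c) (S c) by rewrite -[S c]subr0; apply: cserB (hS c) (cser_t c z0).
have [B hB] := bb.2; have B0 : 0 <= B by have := hB 0%N; rewrite big_geq.
have /choice [rho' hr'] : forall d, exists l, cser (fun c => rst z c d) l.
  move=> d; apply: (@cser_abs _ _ (fun c => (K * b32 R d) * (K * b32 R c))).
    by move=> c; rewrite mulrC; exact: rb.
  by apply: bsumZ => //; exact: bb.1.
have hz2 : cser (fun c => (c.+1%:R * z) ^- 2) (z ^- 2 * zeta2).
  apply: cser_ext (cserZ (z ^- 2) zeta2P) => c.
  have -> : (c.+1%:R * z) ^+ 2 = c.+1%:R ^+ 2 * z ^+ 2 by rewrite exprMn.
  by rewrite [RHS]invfM [LHS]mulrC.
have hX : cser S (gei z - zeta2 - z ^- 2 * zeta2) by exact: cserB (gei_Lip z0) hz2.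
have hY : cser S' (z ^- 2 * (gei w - zeta2) - zeta2).
  by apply: cserB zeta2P; apply: cserZ; exact: gei_Lip.
have hX' := double_series rb bb hr hr' hX.
exists (fun M => - \sum_(0 <= d < M) (S' d - rho' d)); last first.
  have -> : delta z = z ^- 2 * (gei w - zeta2) - zeta2 - (gei z - zeta2 - z ^- 2 * zeta2).
    by rewrite /delta -/w; ring.
  exact: cvCN (cserB hY hX').
elim=> [|M IH].
  rewrite big_geq // oppr0; apply: cvC_ext (@cvC_cst _ 0) => n.
  by rewrite big1 // => c _; rewrite /ust addr0 subr0 subrr.
rewrite big_nat_recr //= opprD.
apply: cser_ext (cserD IH (cserN (cserB (hS' M) (hr' M)))) => c.
by rewrite /rst; ring.
Qed.

(** With k = n + 1, the telescoping terms of k z of index k M are those of z of index M divided by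
    k, and passing to a subsequence keeps the limit in [delta_lim]. *)
Lemma delta_scale z n : 0 < Im z -> delta (n.+1%:R * z) = delta z / n.+1%:R.
Proof.
move=> z0; have nz0 := H_scalen n z0; have n0 : (n.+1%:R : C) != 0 by rewrite pnatr_eq0.
have [U hU cU] := delta_lim z0; have [V hV cV] := delta_lim nz0.
have E M : V (n.+1 * M)%N = U M / n.+1%:R.
  apply: (cser_unique (hV _)); rewrite [U M / _]mulrC.
  apply: cser_ext (cserZ (n.+1%:R^-1) (hU M)) => c; rewrite /ust natrM.
  have cz0 := H_scalen c z0.
  have n3 := H_addn_neq0 M cz0; have n4 := H_subn_neq0 M cz0.
  move: n3 n4; rewrite [c.+1%:R * (n.+1%:R * z)]mulrCA.
  move: (c.+1%:R * z) (M%:R : C) (n.+1%:R : C) n0 => v m k k0 n3 n4.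
  have -> : k * v + k * m = k * (v + m) by ring.
  have -> : k * v - k * m = k * (v - m) by ring.
  by field; rewrite k0 n3 n4.
apply: oppr_inj; have h1 := @cvC_subseq _ (fun M => n.+1 * M)%N _ _ (fun M => leq_pmull M (ltn0Sn n)) cV.
apply: (cvC_unique h1); rewrite -mulNr [- delta z / _]mulrC.
by apply: cvC_ext (cvCZ (n.+1%:R^-1) cU) => M; rewrite E mulrC.
Qed.

Lemma qder_gei z : 0 < Im z -> exists d, qder gei z d.
Proof.
move=> z0; have h := qder_qsum (tpi_gt0 R) growth_sig z0.
eexists; apply: qderB; first exact: qder_cst.
by apply: qderZ; exact: h.
Qed.

Lemma qder_Ninv z : z != 0 -> qder (fun w => - w^-1) z (z ^- 2).
Proof. by move=> z0; rewrite -[z ^- 2]opprK; apply: qderN; exact: qder_inv. Qed.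

Definition phi z : C := z * delta z.

Lemma qder_phi z : 0 < Im z -> exists d, qder phi z d.
Proof.
move=> z0; have zn0 := H_neq0 z0; have [d hd] := qder_gei z0.
have [e he] := qder_gei (H_Ninv z0).
have h1 := qder_comp (qder_Ninv zn0) he.
have h2 := qderM (qder_inv zn0) (qder_inv zn0).
have E : (fun w : C => w^-1 * w^-1) = (fun w => w ^- 2).
  by apply/funext => w; rewrite -invfM.
rewrite E in h2.
have h3 := qderB (qderM h2 h1) hd.
by eexists; apply: qderM (qder_id z) h3.
Qed.

Lemma phi_scale z n : 0 < Im z -> phi (n.+1%:R * z) = phi z.
Proof.
move=> z0; have n0 : (n.+1%:R : C) != 0 by rewrite pnatr_eq0.
by rewrite /phi delta_scale //; field.
Qed.

(** [phi] takes the same value at z and at z (n + 2) / (n + 1), both being integer multiples of z /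
    (n + 1). These points tend to z, so the derivative, which exists by [qder_phi], is 0. *)
Lemma qder_phi0 z : 0 < Im z -> qder phi z 0.
Proof.
move=> z0; have [d hd] := qder_phi z0; suff d0 : d = 0 by rewrite -d0.
have zn0 := H_neq0 z0; have nz : 0 < nrm z by rewrite nrm_gt0.
have [K [r [r0 H]]] := hd.
apply/eqP; rewrite -nrm_eq0 eq_le nrm_ge0 andbT; apply: le_eps_nrm => e e0.
have r20 : 0 < r / 2 by rewrite divr_gt0.
have [N hN] := nat_small (nrm z) r20; have [N' hN'] := nat_small (K * nrm z) e0.
pose n := maxn N N'; have n0 : (n.+1%:R : C) != 0 by rewrite pnatr_eq0.
have nR : 0 < n.+1%:R :> R by rewrite ltr0n.
pose h := z / n.+1%:R.
have nh : nrm h = nrm z / n.+1%:R by rewrite nrmM nrmV nrm_nat.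
have zn : 0 < Im (n.+1%:R^-1 * z).
  by rewrite natC -CV H_scale // invr_gt0.
have E : phi (z + h) = phi z.
  have -> : z + h = n.+2%:R * (n.+1%:R^-1 * z).
    by rewrite /h -[n.+2%:R]natr1; field.
  rewrite phi_scale // -(phi_scale n zn); congr phi; by field.
have hr : nrm h < r.
  have hn : nrm z / n.+1%:R <= r / 2 := hN n (leq_maxl _ _).
  have r2 : r / 2 < r by lra.
  by rewrite nh; apply: le_lt_trans hn r2.
have := H h hr; rewrite E subrr sub0r nrmN nrmM nh => a1.
have a2 : K * nrm z / n.+1%:R <= e := hN' n (leq_maxr _ _).
rewrite add0r; have hp : 0 < nrm z / n.+1%:R by rewrite divr_gt0.
rewrite -(ler_pM2r hp); apply: le_trans a1 _.
have -> : K * (nrm z / n.+1%:R) ^+ 2 = K * nrm z / n.+1%:R * (nrm z / n.+1%:R) by ring.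
by rewrite ler_wpM2r // ltW.
Qed.

(** [phi] is constant by [qder_phi0], and its value at i, the fixed point of z -> -1/z, is -2 i
    gei(i). *)
Lemma gei_S z : 0 < Im z -> z ^- 2 * gei (- z^-1) = gei z - 2 * 'i%C * gei 'i%C / z.
Proof.
move=> z0; have zn0 := H_neq0 z0.
have i0 : 0 < Im ('i%C : C) by rewrite /= ltr01.
have := qder_const_H qder_phi0 z0 i0; rewrite /phi.
have ii : ('i%C : C) ^+ 2 = -1 by exact: sqr_i.
have iv : - ('i%C : C)^-1 = 'i%C.
  by apply: (mulfI (H_neq0 i0)); rewrite mulrN mulfV ?H_neq0.
rewrite {2}/delta iv ii invrN1 => E.
have -> : z ^- 2 * gei (- z^-1) = delta z + gei z by rewrite /delta; ring.
have -> : delta z = (z * delta z) / z by field.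
by rewrite E; field.
Qed.

(** At z = i the variable q = exp(-2 pi) is real. *)
Lemma gei_i_real : gei 'i%C = (Re (gei 'i%C))%:C.
Proof.
apply: complexP => //=; rewrite /gei ImD ImN !ReImE.
have -> : Im zeta2 = 0 by rewrite zeta2_real.
have i0 : 0 < Im ('i%C : C) by rewrite /= ltr01.
suff -> : Im (qsum tpi sig 'i%C) = 0 by rewrite mulr0 mul0r addr0 subr0.
apply: cvC_Im0 (qsumP (tpi_gt0 R) growth_sig i0) _ => n; rewrite Im_sum big1 // => k _.
rewrite /qterm ImM.
have -> : Im (sig k) = 0.
  rewrite Im_sum big1 // => c _; rewrite /spread; case: ifP => // _; exact: Im_nat.
suff -> : Im (ex (tpi * k%:R) 'i%C) = 0 by rewrite mulr0 mul0r addr0.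
have -> : ex (tpi * k%:R) 'i%C = (expR (- (tpi * k%:R)))%:C.
  rewrite /ex /cexp.
  have -> : Re ('i%C * (tpi * k%:R)%:C * 'i%C) = - (tpi * k%:R) by rewrite !ReImE; ring.
  have -> : Im ('i%C * (tpi * k%:R)%:C * 'i%C) = 0 by rewrite !ReImE; ring.
  by rewrite cos0 sin0 mulr1.
by [].
Qed.

End EisensteinTwo.

(** * Moebius action and generators of SL_2(Z) *)

Section Moebius.
Variable R : realType.
Local Notation C := R[i].
Local Notation Re := (@complex.Re R).
Local Notation Im := (@complex.Im R).
Implicit Types (A B M : 'M[int]_2) (z : C).

Lemma ord2_lift : lift ord0 ord0 = 1 :> 'I_2.
Proof. exact/val_inj. Qed.

Lemma mulmx2 A B i j : (A *m B) i j = A i 0 * B 0 j + A i 1 * B 1 j.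
Proof. by rewrite mxE big_ord_recl big_ord1 ord2_lift. Qed.

Lemma det2 A : \det A = A 0 0 * A 1 1 - A 0 1 * A 1 0.
Proof.
rewrite (expand_det_row _ 0) big_ord_recl big_ord1 /cofactor !det_mx11 !mxE ord2_lift.
rewrite /= expr0 mul1r expr1 mulN1r mulrN.
have -> : lift 1 0 = 0 :> 'I_2 by exact/val_inj.
by [].
Qed.

Lemma SL2P A : SL2Z A -> A 0 0 * A 1 1 - A 0 1 * A 1 0 = 1.
Proof. by rewrite -det2. Qed.

Lemma SL2Z_mul A B : SL2Z A -> SL2Z B -> SL2Z (A *m B).
Proof. by rewrite /SL2Z /= det_mulmx => -> ->; rewrite mulr1. Qed.

Lemma SL2Z_opp A : SL2Z A -> SL2Z (- A).
Proof. by rewrite /SL2Z /= !det2 !mxE => <-; ring. Qed.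

Definition mx2 (a b c d : int) : 'M[int]_2 := \matrix_(i, j)
  if i == 0 then if j == 0 then a else b else if j == 0 then c else d.

Lemma mx2E a b c d : [/\ mx2 a b c d 0 0 = a, mx2 a b c d 0 1 = b,
  mx2 a b c d 1 0 = c & mx2 a b c d 1 1 = d].
Proof. by rewrite /mx2 !mxE. Qed.

Lemma matrix2P A B : A 0 0 = B 0 0 -> A 0 1 = B 0 1 -> A 1 0 = B 1 0 ->
  A 1 1 = B 1 1 -> A = B.
Proof.
move=> h1 h2 h3 h4; apply/matrixP => i j.
have o2 (k : 'I_2) : k = 0 \/ k = 1.
  by case: k => -[|[|//]] hk; [left | right]; exact/val_inj.
by case: (o2 i) => ->; case: (o2 j) => ->.
Qed.

Definition den A z : C := (A 1 0)%:~R * z + (A 1 1)%:~R.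
Definition mob A z : C := ((A 0 0)%:~R * z + (A 0 1)%:~R) / den A z.

Lemma slashE k f A z : slash k f A z = f (mob A z) / den A z ^+ k.
Proof. by []. Qed.

Lemma den_neq0 A z : SL2Z A -> 0 < Im z -> den A z != 0.
Proof.
move=> /SL2P dA z0; apply/eqP => E.
have := congr1 Im E; have := congr1 Re E; rewrite /den !intC !ReImE /= => hr hi.
have c0 : A 1 0 = 0.
  apply/eqP; rewrite -(intr_eq0 R); have : (A 1 0)%:~R * Im z = 0 by lra.
  by move/eqP; rewrite mulf_eq0 (gt_eqF z0) orbF.
move: hr; rewrite c0 !mul0r subr0 add0r => /eqP; rewrite intr_eq0 => /eqP d0.
by move: dA; rewrite c0 d0 !mulr0 subr0.
Qed.

Lemma mob_Im A z : SL2Z A -> 0 < Im z ->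
  Im (mob A z) = Im z / nrm (den A z) ^+ 2.
Proof.
move=> hA z0; have d0 := den_neq0 hA z0.
have n0 : 0 < nrm (den A z) ^+ 2 by rewrite exprn_gt0 // nrm_gt0.
have zz : den A z * (den A z)^*%C = (nrm (den A z) ^+ 2)%:C.
  by apply: complexP; rewrite nrm_sqr !ReImE; ring.
have -> : mob A z = ((nrm (den A z) ^+ 2)^-1)%:C *
    (((A 0 0)%:~R * z + (A 0 1)%:~R) * (den A z)^*%C).
  apply: (mulfI d0); rewrite /mob mulrCA mulfV // mulr1.
  rewrite [RHS](_ : _ = ((nrm (den A z) ^+ 2)^-1)%:C * (den A z * (den A z)^*%C) *
     ((A 0 0)%:~R * z + (A 0 1)%:~R)); last by ring.
  by rewrite zz -CM mulVf ?gt_eqF // mul1r.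
have dR : (A 0 0)%:~R * (A 1 1)%:~R - (A 0 1)%:~R * (A 1 0)%:~R = 1 :> R.
  by rewrite -!intrM -intrB SL2P.
rewrite ImM ReC ImC mul0r addr0 mulrC; congr (_ / _).
rewrite /den !intC !ReImE.
transitivity (((A 0 0)%:~R * (A 1 1)%:~R - (A 0 1)%:~R * (A 1 0)%:~R) * Im z); first by ring.
by rewrite dR mul1r.
Qed.

Lemma mob_H A z : SL2Z A -> 0 < Im z -> 0 < Im (mob A z).
Proof.
move=> hA z0; rewrite mob_Im // divr_gt0 // exprn_gt0 // nrm_gt0.
exact: den_neq0.
Qed.

Lemma den_mul A B z : den B z != 0 -> den (A *m B) z = den A (mob B z) * den B z.
Proof.
move=> h; rewrite /den /mob !mulmx2 -/(den B z) !intrD !intrM.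
by rewrite [RHS]mulrDl -[_ * _ * den B z]mulrA divfK // /den; ring.
Qed.

Lemma mob_mul A B z : SL2Z A -> SL2Z B -> 0 < Im z ->
  mob (A *m B) z = mob A (mob B z).
Proof.
move=> hA hB z0; have d0 := den_neq0 hB z0.
have dA := den_neq0 hA (mob_H hB z0).
rewrite /mob den_mul // -/(mob B z) !mulmx2 !intrD !intrM.
have -> : ((A 0 0)%:~R * (B 0 0)%:~R + (A 0 1)%:~R * (B 1 0)%:~R) * z +
  ((A 0 0)%:~R * (B 0 1)%:~R + (A 0 1)%:~R * (B 1 1)%:~R) =
  ((A 0 0)%:~R * mob B z + (A 0 1)%:~R) * den B z.
  by rewrite [RHS]mulrDl -[_ * _ * den B z]mulrA /mob divfK // /den; ring.
by field; rewrite dA d0.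
Qed.

Lemma slash_mul k f A B z : SL2Z A -> SL2Z B -> 0 < Im z ->
  slash k f (A *m B) z = slash k f A (mob B z) / den B z ^+ k.
Proof.
move=> hA hB z0; rewrite !slashE mob_mul // den_mul ?den_neq0 //.
by rewrite exprMn invfM mulrA.
Qed.

Lemma den_opp A z : den (- A) z = - den A z.
Proof. by rewrite /den !mxE !intrN; ring. Qed.

Lemma mob_opp A z : mob (- A) z = mob A z.
Proof.
rewrite /mob den_opp !mxE !intrN invrN mulrN.
have -> : - (A 0 0)%:~R * z - (A 0 1)%:~R = - ((A 0 0)%:~R * z + (A 0 1)%:~R) :> C by ring.
by rewrite mulNr opprK.
Qed.

Lemma slash2_opp f A z : slash 2 f (- A) z = slash 2 f A z.
Proof. by rewrite !slashE mob_opp den_opp sqrrN. Qed.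

Definition Smx := mx2 0 (-1) 1 0.
Definition Tmx (k : int) := mx2 1 k 0 1.

Lemma SL2Z_S : SL2Z Smx.
Proof. by rewrite /SL2Z /= det2; have [-> -> -> ->] := mx2E 0 (-1) 1 0. Qed.

Lemma SL2Z_T k : SL2Z (Tmx k).
Proof.
rewrite /SL2Z /= det2; have [-> -> -> ->] := mx2E 1 k 0 1.
by rewrite mulr0 subr0 mulr1.
Qed.

Lemma den_S z : den Smx z = z.
Proof. by rewrite /den; have [_ _ -> ->] := mx2E 0 (-1) 1 0; rewrite mul1r addr0. Qed.

Lemma mob_S z : mob Smx z = - z^-1.
Proof.
rewrite /mob den_S; have [-> -> _ _] := mx2E 0 (-1) 1 0.
by rewrite mul0r add0r mulN1r.
Qed.

Lemma den_T k z : den (Tmx k) z = 1.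
Proof. by rewrite /den; have [_ _ -> ->] := mx2E 1 k 0 1; rewrite mul0r add0r. Qed.

Lemma mob_T k z : mob (Tmx k) z = z + k%:~R.
Proof.
rewrite /mob den_T; have [-> -> _ _] := mx2E 1 k 0 1.
by rewrite mul1r divr1.
Qed.

Lemma periodic_int (f : C -> C) : (forall w, 0 < Im w -> f (w + 1) = f w) ->
  forall (k : int) w, 0 < Im w -> f (w + k%:~R) = f w.
Proof.
move=> per.
have pern n w : 0 < Im w -> f (w + n%:R) = f w.
  move=> w0; elim: n => [|n IH]; first by rewrite addr0.
  by rewrite -natr1 addrA per // ImD Im_nat addr0.
case=> n w w0; first by rewrite -pmulrn pern.
rewrite NegzE mulrNz -pmulrn -[in RHS](subrK n.+1%:R w) pern //.
by rewrite ImD ImN Im_nat subr0.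
Qed.

(** The Euclidean algorithm on the first column (a, c): with k the quotient of a by c, the matrix S
    T^(-k) A has lower left entry a mod c, and c = 0 leaves only powers of T up to sign. *)
Lemma SL2Z_ind (P : 'M[int]_2 -> Prop) :
  (forall A B, SL2Z A -> SL2Z B -> P A -> P B -> P (A *m B)) ->
  P Smx -> (forall k, P (Tmx k)) -> (forall A, P A -> P (- A)) ->
  forall A, SL2Z A -> P A.
Proof.
move=> PM PS PT PN A; have [n] := ubnP (absz (A 1 0)).
elim: n A => // n IH A; rewrite ltnS => cn hA.
have dA := SL2P hA.
have [c0|c0] := eqVneq (A 1 0) 0.
  have ad : A 0 0 * A 1 1 = 1 by move: dA; rewrite c0 mulr0 subr0.
  have [[a1 d1]|[a1 d1]] : A 0 0 = 1 /\ A 1 1 = 1 \/ A 0 0 = -1 /\ A 1 1 = -1.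
    move: (A 0 0) (A 1 1) ad => a d ad.
    have := congr1 absz ad; rewrite abszM => /eqP; rewrite muln_eq1 => /andP[/eqP h1 _].
    have [E|E] : a = 1 \/ a = -1 by lia.
      by left; split => //; move: ad; rewrite E mul1r.
    by right; split => //; move: ad; rewrite E mulN1r => <-; rewrite opprK.
  have -> : A = Tmx (A 0 1); last exact: PT.
    by have [e1 e2 e3 e4] := mx2E 1 (A 0 1) 0 1; apply: matrix2P; rewrite ?e1 ?e2 ?e3 ?e4.
  have -> : A = - Tmx (- A 0 1); last by apply: PN; exact: PT.
  have [e1 e2 e3 e4] := mx2E 1 (- A 0 1) 0 1.
  by apply: matrix2P; rewrite mxE ?e1 ?e2 ?e3 ?e4 ?opprK ?oppr0.
pose k := divz (A 0 0) (A 1 0); pose A' := Smx *m (Tmx (- k) *m A).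
have hA' : SL2Z A' by apply: SL2Z_mul SL2Z_S (SL2Z_mul (SL2Z_T _) hA).
have [s1 s2 s3 s4] := mx2E 0 (-1) 1 0; have [t1 t2 t3 t4] := mx2E 1 (- k) 0 1.
have [u1 u2 u3 u4] := mx2E 1 k 0 1.
have E10 : A' 1 0 = modz (A 0 0) (A 1 0).
  by rewrite !mulmx2 s3 s4 t1 t2 mul1r mul0r addr0 mul1r /modz mulNr.
have PA' : P A'.
  apply: IH => //; rewrite E10; apply: leq_trans cn.
  by rewrite -ltz_nat gez0_abs ?modz_ge0 // abszE ltz_mod.
have o10 : (0 == 1 :> 'I_2) = false by [].
have SS : - Smx *m Smx = 1%:M.
  by apply: matrix2P; rewrite mulmx2 !(mxE, s1, s2, s3, s4).
have TT : Tmx k *m Tmx (- k) = 1%:M.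
  apply: matrix2P; rewrite mulmx2 ?t1 ?t2 ?t3 ?t4 ?u1 ?u2 ?u3 ?u4 [RHS]mxE /=; ring.
have -> : A = Tmx k *m (- Smx *m A').
  by rewrite /A' [- Smx *m _]mulmxA SS mul1mx mulmxA TT mul1mx.
apply: (PM _ _ (SL2Z_T _) _ (PT _)); first exact: SL2Z_mul (SL2Z_opp SL2Z_S) hA'.
by apply: PM => //; [exact: SL2Z_opp SL2Z_S | exact: PN].
Qed.

End Moebius.

(** * Invariance of the completed Eisenstein series and of its potential *)

Section EisensteinInvariance.
Variable R : realType.
Local Notation C := R[i].
Local Notation Re := (@complex.Re R).
Local Notation Im := (@complex.Im R).
Local Notation tpi := (2 * pi : R).
Local Notation gei := (@gei R).
Local Notation zeta2 := (@zeta2 R).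
Implicit Types (A B M : 'M[int]_2) (z : C).

Definition ge : R := Re (gei 'i%C).

(** The usual non-holomorphic completion zeta(2) (E_2 - 3 / (pi y)), of weight 2 for SL_2(Z). *)
Definition estar z : C := gei z - (ge / Im z)%:C.

(** The series of sigma(n)/n q^n is minus the sum of the log(1 - q^n), so [Lam] is 2 pi times the
    logarithm of the product of the 1 - q^n. The coefficient at n = 0 is 0. *)
Definition lam (n : nat) : C := - tpi%:C * (sig R n / n%:R).

Lemma growth_lam : growth lam.
Proof.
apply: growthZ; apply: (@growth_le R _ (sig R)); last exact: growth_sig.
move=> n; rewrite nrmM nrmV nrm_nat; case: n => [|n].
  by rewrite invr0 mulr0 nrm_ge0.
by rewrite mulrC ler_piMl ?nrm_ge0 // invf_le1 ?ltr0n ?ler1n.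
Qed.

Definition Lam z : C := qsum tpi lam z.

Lemma qsumZ l c (a : nat -> C) z : 0 < l -> growth a -> 0 < Im z ->
  qsum l (fun n => c * a n) z = c * qsum l a z.
Proof. by move=> l0 ga z0; rewrite -(isqE (isqZ c (growth_isq l0 ga)) z0). Qed.

Lemma qder_Lam z : 0 < Im z -> qder Lam z ('i%C * (gei z - zeta2)).
Proof.
move=> z0; have t0 := tpi_gt0 R; have := qder_qsum t0 growth_lam z0.
have -> : (fun n => n%:R * lam n) = (fun n => - tpi%:C * sig R n).
  apply/funext => -[|n]; first by rewrite mul0r /sig big_geq // mulr0.
  have n0 : (n.+1%:R : C) != 0 by rewrite pnatr_eq0.
  by rewrite /lam mulrCA; congr (_ * _); rewrite mulrCA mulfV // mulr1.
rewrite qsumZ //; last exact: growth_sig.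
have -> // : 'i%C * tpi%:C * (- tpi%:C * qsum tpi (sig R) z) = 'i%C * (gei z - zeta2).
by rewrite /gei rmorphXn; ring.
Qed.

Lemma qsum_add1 (a : nat -> C) z : qsum tpi a (z + 1) = qsum tpi a z.
Proof.
rewrite /qsum; have -> // : qterm tpi a (z + 1) = qterm tpi a z.
by apply/funext => n; rewrite /qterm exDr exXn exXn ex_tpi1 expr1n mulr1.
Qed.

(** With ge = pi / 2 this is (pi / 2) log(y |eta(z)|^4), the function of Kronecker's limit
    formula. *)
Definition Hf z : R := - Re zeta2 * Im z + Re (Lam z) + ge * ln (Im z).

Lemma Im_Ninv z : 0 < Im z -> Im (- z^-1) = Im z / nrm z ^+ 2.
Proof. by move=> z0; rewrite -mob_S (mob_Im SL2Z_S z0) den_S. Qed.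

Lemma estar_S z : 0 < Im z -> estar (- z^-1) = z ^+ 2 * estar z.
Proof.
move=> z0; have zn0 := H_neq0 z0; rewrite /estar Im_Ninv //.
have -> : gei (- z^-1) = z ^+ 2 * (z ^- 2 * gei (- z^-1)) by rewrite mulrA mulfV ?mul1r // expf_neq0.
rewrite gei_S // gei_i_real -/ge.
have y0 : (Im z)%:C != 0 by rewrite C_eq0 gt_eqF.
(* As conj z = z - 2 i y, the correction ge |z|^2 / y at -1/z equals z^2 ge / y - 2 i z ge, and its
   last term cancels the defect in [gei_S]. *)
have E : (nrm z ^+ 2)%:C = z * (z - 2 * 'i%C * (Im z)%:C).
  by apply: complexP; rewrite nrm_sqr !ReImE; ring.
set n2 := nrm z ^+ 2 in E *.
have -> : (ge / (Im z / n2))%:C = ge%:C * n2%:C / (Im z)%:C.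
  by rewrite invf_div mulrA !CM CV.
have -> : (ge / Im z)%:C = ge%:C / (Im z)%:C by rewrite CM CV.
rewrite E; move: (gei z) => e; by field; rewrite y0 zn0.
Qed.

Definition Lf z : C := 'i%C * zeta2 * z + Lam z.

Lemma qder_Lf z : 0 < Im z -> qder Lf z ('i%C * gei z).
Proof.
move=> z0; have := qderD (qderZ ('i%C * zeta2) (qder_id z)) (qder_Lam z0).
by rewrite mulr1 -mulrDr [zeta2 + _]addrC subrK.
Qed.

Lemma Re_Lf z : Re (Lf z) = - Re zeta2 * Im z + Re (Lam z).
Proof.
rewrite /Lf ReD; congr (_ + _); rewrite {1}zeta2_real !ReImE.
by ring.
Qed.

(** The derivative of Lf(-1/w) - Lf(w) is 2 ge / w. In place of a complex logarithm, real parts are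
    compared along the segment from i, which the inversion fixes, to z: there q(t) = |i + t v|^2,
    and ge * ln q(t) has the same derivative. *)
Lemma Re_Lf_S z : 0 < Im z -> Re (Lf (- z^-1)) = Re (Lf z) + ge * ln (nrm z ^+ 2).
Proof.
move=> z0; have i0 : 0 < Im ('i%C : C) by rewrite /= ltr01.
pose K w := Lf (- w^-1) - Lf w; pose v := z - 'i%C.
have dK w : 0 < Im w -> qder K w ((2 * ge)%:C / w).
  move=> w0; have wn0 := H_neq0 w0.
  have := qderB (qder_comp (qder_Ninv wn0) (qder_Lf (H_Ninv w0))) (qder_Lf w0).
  have -> // : 'i%C * gei (- w^-1) * w ^- 2 - 'i%C * gei w = (2 * ge)%:C / w.
  have -> : 'i%C * gei (- w^-1) * w ^- 2 = 'i%C * (w ^- 2 * gei (- w^-1)) by ring.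
  rewrite gei_S // gei_i_real -/ge CM -natC.
  have ii : 'i%C * 'i%C = -1 :> C by rewrite -expr2 sqr_i.
  have -> : 'i%C * (gei w - 2 * 'i%C * ge%:C / w) - 'i%C * gei w =
    - ('i%C * 'i%C) * 2 * ge%:C / w by ring.
  by rewrite ii opprK mul1r.
pose q (t : R) := (t * Re v) ^+ 2 + (1 + t * Im v) ^+ 2.
have hp t : 0 <= t <= 1 -> 0 < 1 + t * Im v.
  by move=> /andP[t0 t1]; rewrite /v ImD ImN Im_i; nra.
have q0 t : 0 <= t <= 1 -> 0 < q t.
  by move=> /hp h; rewrite /q ltr_wpDl ?sqr_ge0 // exprn_gt0.
have := @mvt_bound R (fun t => Re (K ('i%C + t%:C * v)) - ge * ln (q t)) (fun=> 0) 0.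
have dq (t : R) : is_derive t 1 q (2 * (t * Re v) * Re v + 2 * (1 + t * Im v) * Im v).
  by apply: is_derive_eq; rewrite /GRing.scale /=; ring.
have Ep t : Re ('i%C + t%:C * v) = t * Re v /\ Im ('i%C + t%:C * v) = 1 + t * Im v.
  by rewrite !ReImE; split; ring.
move=> /(_ _ _) H; have {H} : `|Re (K ('i%C + 1%:C * v)) - ge * ln (q 1) -
    (Re (K ('i%C + 0%:C * v)) - ge * ln (q 0))| <= 0.
  apply: H => [t t01|t _]; last by rewrite normr0.
  have qt := q0 t t01; have [e1 e2] := Ep t.
  have p0 : 0 < Im ('i%C + t%:C * v) by rewrite e2 hp.
  have d1 := is_derive_Re_path (dK _ p0).
  have d2 := @is_derive1_comp _ (@ln R) q t _ _ (is_derive1_ln qt) (dq t).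
  have d3 : is_derive t 1 (fun t => ge * ln (q t))
     (ge * ((q t)^-1 * (2 * (t * Re v) * Re v + 2 * (1 + t * Im v) * Im v))).
    by apply: is_derive_eq; rewrite /GRing.scale /=; ring.
  apply: is_derive_eq; set p := 'i%C + _ in e1 e2 p0 *; clearbody p v.
  have -> : (2 * ge)%:C / p * v = (2 * ge / q t)%:C * ((p^*)%C * v).
    apply: (mulfI (H_neq0 p0)).
    have pp : p * (p^*)%C = (q t)%:C.
      by apply: complexP; rewrite !ReImE e1 e2 /q; ring.
    have pn := H_neq0 p0.
    have -> : p * ((2 * ge)%:C / p * v) = (2 * ge)%:C * v by field.
    rewrite [RHS](_ : _ = (2 * ge / q t)%:C * (p * (p^*)%C) * v); last by ring.
    by rewrite pp -CM divfK // gt_eqF.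
  rewrite !ReImE e1 e2; by field; rewrite gt_eqF.
rewrite normr_le0 subr_eq0 => /eqP.
have -> : 'i%C + 1%:C * v = z by rewrite /v mul1r; ring.
have -> : 'i%C + 0%:C * v = 'i%C by rewrite mul0r addr0.
have -> : q 1 = nrm z ^+ 2.
  by rewrite nrm_sqr /q /v !ReImE; ring.
have -> : q 0 = 1 by rewrite /q; ring.
have ii : ('i%C : C) ^+ 2 = -1 by exact: sqr_i.
have iv : - ('i%C : C)^-1 = 'i%C.
  by apply: (mulfI (H_neq0 i0)); rewrite mulrN mulfV ?H_neq0.
have KE : Re (K z) = Re (Lf (- z^-1)) - Re (Lf z) by rewrite /K ReD ReN.
have Ki : Re (K 'i%C) = 0 by rewrite /K iv subrr.
by rewrite KE Ki ln1; lra.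
Qed.

Lemma Hf_S z : 0 < Im z -> Hf (- z^-1) = Hf z.
Proof.
move=> z0; rewrite /Hf -!Re_Lf Re_Lf_S // Im_Ninv //.
have n0 : 0 < nrm z ^+ 2 by rewrite exprn_gt0 // nrm_gt0 H_neq0.
by rewrite ln_div ?posrE //; ring.
Qed.

Lemma eis_inv A : SL2Z A -> forall z, 0 < Im z ->
  Hf (mob A z) = Hf z /\ estar (mob A z) = den A z ^+ 2 * estar z.
Proof.
move: A; apply: SL2Z_ind.
- move=> A B hA hB PA PB z z0; have Bz := mob_H hB z0.
  have [h1 h2] := PA _ Bz; have [h3 h4] := PB z z0.
  rewrite mob_mul // den_mul ?den_neq0 //; split; first by rewrite h1.
  by rewrite h2 h4 exprMn mulrA.
- by move=> z z0; rewrite mob_S den_S Hf_S // estar_S.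
- move=> k z z0; rewrite mob_T den_T expr1n mul1r /Hf /estar.
  have -> : Im (z + k%:~R) = Im z by rewrite intC ImD ImC addr0.
  rewrite (@periodic_int R Lam) ?(@periodic_int R gei) //.
    by move=> w _; rewrite /gei qsum_add1.
  by move=> w _; rewrite /Lam qsum_add1.
- move=> A PA z z0; have [h1 h2] := PA z z0.
  by rewrite mob_opp den_opp sqrrN.
Qed.

(* [diag(d, 1) A = B * (u b; 0 v)] with [B] in [SL_2(Z)], [u = gcd(d, A 1 0)], [v = d / u]. *)
Lemma eis_triangular (d : nat) A : (0 < d)%N -> SL2Z A -> exists b : R,
  let u := gcdn d (absz (A 1 0)) in let r : R := u%:R / (d %/ u)%:R in
  forall z, 0 < Im z -> let w := r%:C * z + b%:C in
   Hf (d%:R * mob A z) = Hf w /\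
   d%:R * estar (d%:R * mob A z) / den A z ^+ 2 = r%:C * estar w.
Proof.
move=> d0 hA; set c := A 1 0; set u := gcdn d (absz c); set v := (d %/ u)%N.
have dA := SL2P hA; rewrite -/c in dA.
have u0 : (0 < u)%N by rewrite gcdn_gt0 d0.
have duv : d = (u * v)%N by rewrite mulnC divnK ?dvdn_gcdl.
have v0 : (0 < v)%N by move: d0; rewrite duv muln_gt0 => /andP[].
have /dvdzP [c' cE] : (u%:Z %| c)%Z by rewrite dvdzE /= dvdn_gcdr.
(* diag(d, 1) A has first column (d a, c) = u (v a, c') with a = A 0 0. The column (v a, c') is
   primitive, so Bezout completes it to [B]. *)
have cop : coprimez (v%:Z * A 0 0) c'.
  rewrite coprimezMl; apply/andP; split.
    have : (u * gcdn v (absz c') = u * 1)%N.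
      rewrite muln_gcdr -duv muln1 /u; congr gcdn.
      by rewrite -/u [X in _ = absz X]cE abszM mulnC.
    by move/eqP; rewrite eqn_pmul2l.
  apply/coprimezP; exists (A 1 1, - A 0 1 * u%:Z) => /=.
  by rewrite -dA cE; ring.
have [[x y] /= xy] := coprimezP _ _ cop.
pose B00 := v%:Z * A 0 0; pose B11 := x; pose B01 := - y; pose B10 := c'.
pose bi := B11 * d%:Z * A 0 1 - B01 * A 1 1.
have E0 : B10 * d%:Z * A 0 1 - B00 * A 1 1 + v%:Z = 0.
  rewrite /B10 /B00 duv PoszM.
  have -> : c' * (u%:Z * v%:Z) * A 0 1 - v%:Z * A 0 0 * A 1 1 + v%:Z =
    v%:Z * (1 - (A 0 0 * A 1 1 - A 0 1 * (c' * u%:Z))) by ring.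
  by rewrite -cE dA subrr mulr0.
have detB : B00 * B11 - B01 * B10 = 1 by rewrite -xy /B00 /B11 /B01 /B10; ring.
have F1 : B00 * bi + B01 * v%:Z = d%:Z * A 0 1.
  transitivity ((B00 * B11 - B01 * B10) * (d%:Z * A 0 1) +
    B01 * (B10 * d%:Z * A 0 1 - B00 * A 1 1 + v%:Z)); first by rewrite /bi; ring.
  by rewrite detB E0 mul1r mulr0 addr0.
have F2 : B10 * bi + B11 * v%:Z = A 1 1.
  transitivity ((B00 * B11 - B01 * B10) * A 1 1 +
    B11 * (B10 * d%:Z * A 0 1 - B00 * A 1 1 + v%:Z)); first by rewrite /bi; ring.
  by rewrite detB E0 mul1r mulr0 addr0.
have B00E : B00 = v%:Z * A 0 0 by [].
clearbody B00 bi.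
pose B := mx2 B00 B01 B10 B11; have [m1 m2 m3 m4] := mx2E B00 B01 B10 B11.
have hB : SL2Z B by rewrite /SL2Z /= det2 m1 m2 m3 m4.
exists (bi%:~R / v%:R) => /= z z0.
set w := _ + _; have vR : (v%:R : C) != 0 by rewrite pnatr_eq0 -lt0n.
have wE : w = (u%:R * z + bi%:~R) / v%:R.
  by rewrite /w !CM CV -!natC -intC; ring.
have w0 : 0 < Im w.
  by rewrite /w ImD ImC addr0 H_scale // divr_gt0 // ltr0n.
have dw : den B w * v%:R = den A z.
  rewrite /den m3 m4 wE mulrDl -[B10%:~R * _ * _]mulrA divfK // -F2 -/c cE.
  by rewrite !intrD !intrM -!pmulrn /B10; ring.
have dA0 := den_neq0 hA z0; have dB0 := den_neq0 hB w0.
have mw : mob B w = d%:R * mob A z.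
  rewrite /mob mulrA -dw m1 m2.
  have -> : B00%:~R * w + B01%:~R = d%:R * ((A 0 0)%:~R * z + (A 0 1)%:~R) / v%:R.
    apply: (mulIf vR); rewrite divfK // wE mulrDl -[B00%:~R * _ * _]mulrA divfK //.
    have := congr1 (fun m : int => m%:~R : C) F1; rewrite !intrD !intrM -!pmulrn => F1'.
    by rewrite mulrDr -addrA F1' B00E duv natrM intrM -pmulrn; ring.
  by field; rewrite vR dB0.
have [h1 h2] := eis_inv hB w0; rewrite -mw h1 h2; split => //.
rewrite -/v CM CV -!natC -dw.
have -> : (d%:R : C) = u%:R * v%:R by rewrite -natrM -duv.
by move: (estar w) (den B w) dB0 => e D dB0; field; rewrite vR dB0.
Qed.

End EisensteinInvariance.

(** * Sums over coset representatives *)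

Section CosetSums.
Variable V : nmodType.

Lemma same_coset_cancel N (A B M : 'M[int]_2) : SL2Z M ->
  same_coset (Gamma0 N) (A *m M) (B *m M) -> same_coset (Gamma0 N) A B.
Proof.
move=> hM [g Gg h]; exists g => //.
have MK X : X *m M *m \adj M = X by rewrite -mulmxA mul_mx_adj hM mulmx1.
case: h => /(congr1 (fun X => X *m \adj M)); rewrite MK => ->; [left | right].
  by rewrite mulmxA MK.
by rewrite mulNmx mulmxA MK.
Qed.

(** Right multiplication by M permutes the cosets: it induces an injective map from the finite list
    of representatives to itself, hence a permutation. *)
Lemma sum_coset N (F : 'M[int]_2 -> V) M : (0 < N)%N -> SL2Z M ->
  (forall A B, SL2Z A -> SL2Z B -> same_coset (Gamma0 N) A B -> F A = F B) ->
  \sum_(A <- coset_reps (Gamma0 N)) F (A *m M) =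
  \sum_(A <- coset_reps (Gamma0 N)) F A.
Proof.
move=> N0 hM hF; have [us sS sU sC] := coset_reps_Gamma0 N0.
set s := coset_reps _ in us sS sU sC *.
have /choice [rho hr] : forall A, exists B, A \in s ->
    B \in s /\ same_coset (Gamma0 N) (A *m M) B.
  move=> A; case: (boolP (A \in s)) => [As|]; last by exists A.
  by have [B Bs h] := sC _ (SL2Z_mul (sS _ As) hM); exists B.
have inj : {in s &, injective rho}.
  move=> A B As Bs E; apply: sU => //; apply: (same_coset_cancel hM).
  apply: (same_coset_trans (hr A As).2); rewrite E.
  exact: same_coset_sym (hr B Bs).2.
have ums : uniq (map rho s) by rewrite map_inj_in_uniq.
have sub : {subset map rho s <= s} by move=> _ /mapP[A As ->]; exact: (hr A As).1.
have [_ eqs] := uniq_min_size ums sub (eq_leq (esym (size_map _ _))).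
rewrite -[RHS](perm_big _ (uniq_perm ums us eqs)) big_map /=.
rewrite big_seq [RHS]big_seq; apply: eq_bigr => A As; have [h1 h2] := hr A As.
by apply: hF => //; [apply: SL2Z_mul => //; exact: sS | exact: sS].
Qed.

End CosetSums.

(** * q-series as regular functions of x and y; limits and Fourier expansions *)

Section RegularQSeries.
Variable R : realType.
Local Notation C := R[i].
Local Notation Re := (@complex.Re R).
Local Notation Im := (@complex.Im R).
Implicit Types (F : C -> C) (a : nat -> C) (l : R).

Lemma measurable_Re_qterm l a n : measurable_fun [set: R * R]
  (fun p : R * R => Re (qterm l a (p.1 +i* p.2) n)).
Proof.
have -> : (fun p : R * R => Re (qterm l a (p.1 +i* p.2) n)) =
  (fun p => expR (- (l * n%:R) * p.2) *
    (Re (a n) * cos (l * n%:R * p.1) - Im (a n) * sin (l * n%:R * p.1))).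
  apply/funext => -[x y]; rewrite [(x, y).1]/= [(x, y).2]/= /qterm /ex /cexp.
  have -> : Re ('i%C * (l * n%:R)%:C * (x +i* y)) = - (l * n%:R) * y.
    by rewrite !ReImE; ring.
  have -> : Im ('i%C * (l * n%:R)%:C * (x +i* y)) = l * n%:R * x.
    by rewrite !ReImE; ring.
  by rewrite !ReImE; ring.
have mx := @measurable_fst _ _ R R; have my := @measurable_snd _ _ R R.
apply: measurable_funM.
  apply: (@measurableT_comp _ _ _ _ _ _ (@expR R)); first exact: measurable_expR.
  by apply: measurable_funM => //; exact: measurable_cst.
apply: measurable_funB; apply: measurable_funM; try exact: measurable_cst.
  apply: (@measurableT_comp _ _ _ _ _ _ (@cos R)).
    by apply: continuous_measurable_fun; exact: continuous_cos.
  by apply: measurable_funM => //; exact: measurable_cst.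
apply: (@measurableT_comp _ _ _ _ _ _ (@sin R)).
  by apply: continuous_measurable_fun; exact: continuous_sin.
by apply: measurable_funM => //; exact: measurable_cst.
Qed.

Lemma cont2_Re F : (forall z, 0 < Im z -> exists d, qder F z d) ->
  cont2 (fun x y => Re (F (x +i* y))).
Proof.
move=> hF x y y0 e e0; have [d hd] := hF (x +i* y) y0.
have [K [r [r0 K0 H]]] := qder_lip hd.
pose s := Num.min (r / 2) (e / (2 * (K + 1))).
have K1 : 0 < K + 1 by lra.
exists s; first by rewrite lt_min !divr_gt0 // mulr_gt0.
move=> x' y' hx hy; pose hx' : R := x' - x; pose hy' : R := y' - y; pose h : C := hx' +i* hy'.
have nh : nrm h < 2 * s.
  by apply: le_lt_trans (nrm_le_ReIm _) _; rewrite /h !ReImE /hx' /hy'; lra.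
have s1 : s <= r / 2 by rewrite ge_min lexx.
have s2 : s <= e / (2 * (K + 1)) by rewrite ge_min lexx orbT.
have -> : x' +i* y' = (x +i* y) + h :> C.
  by apply: complexP; rewrite /h !ReImE /hx' /hy'; ring.
rewrite -ReN -ReD; apply: le_trans (nrm_Re _) _.
have hr : nrm h < r by lra.
apply: le_trans (H h hr) _.
move: s2; rewrite ler_pdivlMr ?mulr_gt0 // => s2.
apply: le_trans (_ : (K + 1) * (2 * s) <= _); last by lra.
by rewrite ler_pM ?nrm_ge0 ?(ltW nh) //; lra.
Qed.

Lemma meas2_Re_isq l a F : isq l a F -> meas2 (fun x y => Re (F (x +i* y))).
Proof.
move=> h; apply: (@measurable_fun_cvg _ _ _ _
  (fun n (p : R * R) => \sum_(0 <= k < n) Re (qterm l a (p.1 +i* p.2) k))).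
  move=> n; apply: measurable_funTS; apply: measurable_sum => k.
  exact: measurable_Re_qterm.
move=> [x y] y0; apply/cvgrPdist_le => e e0.
have [N hN] := h.2 (x +i* y) y0 e e0.
exists N => // n /= Nn; rewrite -Re_sum -ReN -ReD; apply: le_trans (nrm_Re _) _.
by rewrite nrmBC; exact: hN.
Qed.

Lemma reg_Re_isq l a F : isq l a F -> reg (fun x y => Re (F (x +i* y))).
Proof.
move=> h; split; last exact: meas2_Re_isq h.
  by apply: cont2_Re => z z0; eexists; exact: isq_qder h z0.
move=> T; have [K K0 hK] := isq_bound h.
exists (nrm (a 0%N) + K); first by rewrite addr_ge0 ?nrm_ge0.
move=> x y _ /andP[hy _]; apply: le_trans (nrm_Re _) _.
have hz : 1 / 2 <= Im (x +i* y) by rewrite Im_pair div1r.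
have := hK _ hz; set Fz := F _ => h1.
have -> : Fz = a 0%N + (Fz - a 0%N) by ring.
apply: le_trans (nrmD _ _) _; rewrite lerD2l; apply: le_trans h1 _.
rewrite ler_piMr // -[leRHS]expR0 ler_expR oppr_le0 mulr_ge0 ?(ltW h.1) //.
by apply: le_trans hz; rewrite div1r invr_ge0.
Qed.

Lemma Im_Re w : Im w = Re (- 'i%C * w).
Proof. by rewrite !ReImE; ring. Qed.

Lemma reg_Im_isq l a F : isq l a F -> reg (fun x y => Im (F (x +i* y))).
Proof.
move=> h; apply: reg_ext (reg_Re_isq (isqZ (- 'i%C) h)) => x y _.
by rewrite -Im_Re.
Qed.

Definition dq l a z : C := 'i%C * l%:C * qsum l (fun n => n%:R * a n) z.

Lemma isq_dq l a F : isq l a F -> isq l (fun n => 'i%C * l%:C * (n%:R * a n)) (dq l a).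
Proof.
by move=> h; apply: isqZ; apply: growth_isq h.1 (growthM_nat (isq_growth h)).
Qed.

Lemma derive_x F d (x y : R) : qder F (x +i* y) d ->
  is_derive x 1 (fun x => Re (F (x +i* y))) (Re d) /\
  is_derive x 1 (fun x => Im (F (x +i* y))) (Im d).
Proof.
move=> h; have E (t : R) : t +i* y = (0 +i* y) + t%:C * 1 :> C.
  by apply: complexP; rewrite mulr1 !ReImE; ring.
have h' : qder F ((0 +i* y) + x%:C * 1) d by rewrite -E.
split.
  have := is_derive_Re_path h'; rewrite mulr1.
  have FE : (fun t => Re (F (0 +i* y + t%:C * 1))) = (fun t => Re (F (t +i* y))).
    by apply/funext => t; rewrite (E t).
  by rewrite FE.
have := is_derive_Im_path h'; rewrite mulr1.
have FE : (fun t => Im (F (0 +i* y + t%:C * 1))) = (fun t => Im (F (t +i* y))).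
  by apply/funext => t; rewrite (E t).
by rewrite FE.
Qed.

Lemma derive_y F d (x y : R) : qder F (x +i* y) d ->
  is_derive y 1 (fun y => Re (F (x +i* y))) (- Im d) /\
  is_derive y 1 (fun y => Im (F (x +i* y))) (Re d).
Proof.
move=> h; have E (t : R) : x +i* t = (x +i* 0) + t%:C * 'i%C :> C.
  by apply: complexP; rewrite !ReImE; ring.
have h' : qder F ((x +i* 0) + y%:C * 'i%C) d by rewrite -E.
have e1 : Re (d * 'i%C) = - Im d by rewrite !ReImE; ring.
have e2 : Im (d * 'i%C) = Re d by rewrite !ReImE; ring.
split.
  have := is_derive_Re_path h'; rewrite e1.
  have FE : (fun t => Re (F (x +i* 0 + t%:C * 'i%C))) = (fun t => Re (F (x +i* t))).
    by apply/funext => t; rewrite (E t).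
  by rewrite FE.
have := is_derive_Im_path h'; rewrite e2.
have FE : (fun t => Im (F (x +i* 0 + t%:C * 'i%C))) = (fun t => Im (F (x +i* t))).
  by apply/funext => t; rewrite (E t).
by rewrite FE.
Qed.

Lemma C1_Re_isq l a F : isq l a F -> C1 (fun x y => Re (F (x +i* y)))
  (fun x y => Re (dq l a (x +i* y))) (fun x y => - Im (dq l a (x +i* y))).
Proof.
move=> h; split; [exact: reg_Re_isq h | exact: reg_Re_isq (isq_dq h)
  | exact: regN (reg_Im_isq (isq_dq h)) | |] => x y y0.
  by have [] := derive_x (isq_qder h (y0 : 0 < Im (x +i* y))).
by have [] := derive_y (isq_qder h (y0 : 0 < Im (x +i* y))).
Qed.

Lemma C1_Im_isq l a F : isq l a F -> C1 (fun x y => Im (F (x +i* y)))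
  (fun x y => Im (dq l a (x +i* y))) (fun x y => Re (dq l a (x +i* y))).
Proof.
move=> h; split; [exact: reg_Im_isq h | exact: reg_Im_isq (isq_dq h)
  | exact: reg_Re_isq (isq_dq h) | |] => x y y0.
  by have [] := derive_x (isq_qder h (y0 : 0 < Im (x +i* y))).
by have [] := derive_y (isq_qder h (y0 : 0 < Im (x +i* y))).
Qed.

Lemma C1_height (c : R) : C1 (fun _ y => c * y) (fun _ _ => 0) (fun _ _ => c).
Proof.
split; try exact: reg_cst; first by apply: regM; [exact: reg_cst | exact: reg_y].
  by move=> x y _; exact: is_derive_cst.
by move=> x y _; apply: is_derive_eq; rewrite /GRing.scale /=; ring.
Qed.

Lemma C1_sum_in (I : eqType) (r : seq I) (u ux uy : I -> R -> R -> R) :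
  (forall i, i \in r -> C1 (u i) (ux i) (uy i)) ->
  C1 (fun x y => \sum_(i <- r) u i x y) (fun x y => \sum_(i <- r) ux i x y)
     (fun x y => \sum_(i <- r) uy i x y).
Proof.
elim: r => [|i r IH] h.
  by apply: C1_ext (C1_cst 0) _ _ _ => *; rewrite big_nil.
have hi : C1 (u i) (ux i) (uy i) by apply: h; rewrite mem_head.
have hr : forall j, j \in r -> C1 (u j) (ux j) (uy j).
  by move=> j jr; apply: h; rewrite in_cons jr orbT.
by apply: C1_ext (C1D hi (IH hr)) _ _ _ => *; rewrite big_cons.
Qed.

Lemma cvCP (u : nat -> C) (s : C) :
  ((u : nat -> C^o) @ \oo --> (s : C^o)) <-> cvC u s.
Proof.
split.
  move=> /cvgrPdist_le h e e0; have [N _ hN] := h (e%:C : C) ltac:(by rewrite ltcR).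
  exists N => n Nn.
  by have := hN n Nn; rewrite normE lecR nrmBC.
move=> h; apply/cvgrPdist_le => /= e e0.
have [eI eR] : Im e = 0 /\ 0 < Re e by move: e0; rewrite ltcE /= => /andP[/eqP].
have [N hN] := h _ eR; exists N => // n /= Nn.
by rewrite normE nrmBC lecE /= eI eqxx /=; exact: hN.
Qed.

Definition cvT (F : R -> C) (s : C) := forall e : R, 0 < e ->
  exists T0, forall T, T0 <= T -> nrm (F T - s) <= e.

Lemma cvTP (F : R -> C) (s : C) : cvT F s -> lim ((F T : C^o) @[T --> +oo%R]) = s.
Proof.
move=> h; apply: (@cvg_lim C^o) => //; apply/cvgrPdist_le => /= e e0.
have [eI eR] : Im e = 0 /\ 0 < Re e by move: e0; rewrite ltcE /= => /andP[/eqP].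
have [T0 hT] := h _ eR; near=> T.
rewrite normE nrmBC lecE /= eI eqxx /=; apply: hT.
by near: T; exact: nbhs_pinfty_ge (num_real T0).
Unshelve. all: by end_near. Qed.

Lemma fourier_isq (h : C -> C) w a : fourier_expansion h w a ->
  isq (2 * pi / w%:R) a h.
Proof.
move=> [w0 hz]; split; first by rewrite divr_gt0 ?mulr_gt0 ?pi_gt0 ?ltr0n.
move=> z z0; have /cvCP := hz z z0; apply: cvC_ext => n; apply: eq_bigr => k _.
by rewrite /qterm /ex !CM CV -!natC; congr (_ * cexp _); ring.
Qed.

Lemma isq_fourier (h : C -> C) w a : (0 < w)%N -> isq (2 * pi / w%:R) a h ->
  fourier_expansion h w a.
Proof.
move=> w0 [_ hz]; split => // z z0; apply/cvCP; apply: cvC_ext (hz z z0) => n.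
apply: eq_bigr => k _.
by rewrite /qterm /ex !CM CV -!natC; congr (_ * cexp _); ring.
Qed.

(** [a0] chooses an arbitrary expansion: one has to exist, and [isq_a0_unique] then identifies its
    constant term with that of any other q-series for h. *)
Lemma a0_fourier (h : C -> C) w a l b : fourier_expansion h w a -> isq l b h ->
  a0 h = b 0%N.
Proof.
move=> hw hb; rewrite /a0.
have /(xgetPex 0) : exists c, [set c | exists w a, fourier_expansion h w a /\ a 0%N = c] c.
  by exists (a 0%N), w, a.
move=> [w' [a' [h' <-]]].
by apply: isq_a0_unique (fourier_isq h') hb _.
Qed.

End RegularQSeries.

(** * Green's formula for an Eisenstein series paired with a modular form *)

Section Pairing.
Variable R : realType.
Local Notation C := R[i].
Local Notation Re := (@complex.Re R).
Local Notation Im := (@complex.Im R).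
Local Notation mu := (@lebesgue_measure R).
Local Notation area := (mu \x mu)%E.
Implicit Types (A B M : 'M[int]_2) (z : C) (f g : C -> C).

Lemma norm_ge1 (x y : R) : (1 <= `|x +i* y|) = (1 <= x ^+ 2 + y ^+ 2).
Proof.
rewrite normE -[1]/(1%:C) lecR -[RHS](_ : (1 ^+ 2 <= nrm (x +i* y) ^+ 2) = _).
  by rewrite ler_pXn2r // nnegrE ?ler01 ?nrm_ge0.
by rewrite nrm_sqr expr1n.
Qed.

Lemma FT_Fdom (T : R) : [set p : R * R | FT T (p.1 +i* p.2)] = Fdom T.
Proof.
by apply/seteqP; split=> -[x y] [/= h1 h2 h3 h4]; split => //=; move: h2;
  rewrite ?norm_ge1 // -norm_ge1.
Qed.

Lemma hyp_integral_tr (T : R) (t : C -> C) :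
  hyp_integral (FT T) (fun z => (Im z ^+ 2)%:C * t z) =
  (\int[area]_(p in Fdom T) Re (t (p.1 +i* p.2)))
  +i* (\int[area]_(p in Fdom T) Im (t (p.1 +i* p.2))).
Proof.
rewrite /hyp_integral FT_Fdom.
have E p : p \in Fdom T ->
    (Im (p.1 +i* p.2) ^+ 2)%:C * t (p.1 +i* p.2) / (p.2 ^+ 2)%:C = t (p.1 +i* p.2).
  rewrite inE => -[p0 _ _ _]; rewrite Im_pair mulrAC mulfV ?mul1r //.
  by rewrite C_eq0 expf_neq0 // gt_eqF.
by congr (_ +i* _); apply: eq_Rintegral => p /E ->.
Qed.

Lemma Gamma0_SL N A : Gamma0 N A -> SL2Z A. Proof. by case. Qed.

(* On [H], [f] is the derivative [h_x - i h_y] of the invariant function [h]; at the cusp [A],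
   [- kap A * y + beta A] is the non-decaying part of [h]. *)
Definition eisenstein_datum N (h : C -> R) f (kap beta : 'M[int]_2 -> R) :=
  (forall A z, Gamma0 N A -> 0 < Im z -> h (mob A z) = h z) /\
  forall A, SL2Z A -> exists l a F, [/\ isq l a F, a 0%N = 0,
    forall z, 0 < Im z -> h (mob A z) = - kap A * Im z + Re (F z) + beta A &
    forall z, 0 < Im z -> slash 2 f A z = dq l a z + 'i%C * (kap A)%:C].

Lemma modular_slash_isq N g A : modular_form 2 (Gamma0 N) g -> SL2Z A ->
  exists l b, isq l b (slash 2 g A) /\ a0 (slash 2 g A) = b 0%N.
Proof.
move=> [_ _ hg] hA; have [w [b hw]] := hg A hA; have hq := fourier_isq hw.
by exists (2 * pi / w%:R), b; split => //; exact: a0_fourier hw hq.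
Qed.

(** The trace of h conj(g). It satisfies (d/dx - i d/dy) Phi = tr(f conj(g)), because f = h_x - i
    h_y and conj(g) is antiholomorphic. With Phi = P + i Q the two parts are P_x + Q_y and Q_x -
    P_y, divergences to which [green] applies. *)
Definition Phi N (h : C -> R) g z : C :=
  \sum_(A <- coset_reps (Gamma0 N)) (h (mob A z))%:C * (slash 2 g A z)^*%C.

Lemma slash_coset N g A B z : modular_form 2 (Gamma0 N) g -> SL2Z B ->
  same_coset (Gamma0 N) A B -> 0 < Im z -> slash 2 g A z = slash 2 g B z.
Proof.
move=> [_ inv _] hB [G GG E] z0; have hG := Gamma0_SL GG.
have -> : slash 2 g A z = slash 2 g (G *m B) z by case: E => ->; rewrite ?slash2_opp.
by rewrite slash_mul // inv //; apply: mob_H.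
Qed.

Lemma mob_coset N (h : C -> R) A B z :
  (forall A z, Gamma0 N A -> 0 < Im z -> h (mob A z) = h z) -> SL2Z B ->
  same_coset (Gamma0 N) A B -> 0 < Im z -> h (mob A z) = h (mob B z).
Proof.
move=> inv hB [G GG E] z0; have hG := Gamma0_SL GG.
have -> : mob A z = mob (G *m B) z by case: E => ->; rewrite ?mob_opp.
by rewrite mob_mul // inv //; apply: mob_H.
Qed.

Lemma Phi_mob N h g M z : (0 < N)%N -> modular_form 2 (Gamma0 N) g ->
  (forall A z, Gamma0 N A -> 0 < Im z -> h (mob A z) = h z) ->
  SL2Z M -> 0 < Im z -> Phi N h g (mob M z) = (den M z)^*%C ^+ 2 * Phi N h g z.
Proof.
move=> N0 hg inv hM z0.
have dM := den_neq0 hM z0.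
rewrite -[Phi N h g z](sum_coset N0 hM) => [|A B hA hB AB]; last first.
  by rewrite (mob_coset inv hB AB z0) (slash_coset hg hB AB z0).
have [us sS _ _] := coset_reps_Gamma0 N0.
rewrite /Phi mulr_sumr big_seq [RHS]big_seq; apply: eq_bigr => A /sS hA.
rewrite mob_mul // slash_mul //; move: (slash 2 g A (mob M z)) => S.
have d0 : (den M z)^*%C != 0 by rewrite conjc_eq0.
have -> : (S / den M z ^+ 2)^*%C = S^*%C / (den M z)^*%C ^+ 2.
  by rewrite rmorphM fmorphV rmorphXn.
by move: (S^*%C) ((den M z)^*%C) d0 => S' d d0; field.
Qed.

Lemma Phi_add1 N h g z : (0 < N)%N -> modular_form 2 (Gamma0 N) g ->
  (forall A z, Gamma0 N A -> 0 < Im z -> h (mob A z) = h z) ->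
  0 < Im z -> Phi N h g (z + 1) = Phi N h g z.
Proof.
move=> N0 hg inv z0; have := Phi_mob N0 hg inv (SL2Z_T 1) z0.
by rewrite mob_T den_T conjc1 expr1n mul1r.
Qed.

Lemma Phi_circle N h g (x x' y : R) : x' = - x -> (0 < N)%N -> modular_form 2 (Gamma0 N) g ->
  (forall A z, Gamma0 N A -> 0 < Im z -> h (mob A z) = h z) ->
  0 < y -> x ^+ 2 + y ^+ 2 = 1 ->
  Phi N h g (x' +i* y) = (x +i* y)^*%C ^+ 2 * Phi N h g (x +i* y).
Proof.
move=> xE N0 hg inv y0 E; have z0 : 0 < Im (x +i* y) by [].
have := Phi_mob N0 hg inv SL2Z_S z0; rewrite mob_S den_S => <-; congr Phi.
apply: (mulfI (H_neq0 z0)); rewrite mulrN mulfV ?H_neq0 //.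
have r1 : Re (1 : C) = 1 by [].
have i1 : Im (1 : C) = 0 by [].
apply: complexP; rewrite !ReImE ?r1 ?i1 xE; last by ring.
by rewrite -E; ring.
Qed.

Lemma integral_seg_approx (q : R -> R) (c e : R) : 0 <= e ->
  (forall x, {for x, continuous q}) -> (forall x, `|x| <= 2^-1 -> `|q x - c| <= e) ->
  `|\int[mu]_(x in `[- 2^-1, 2^-1]) q x - c| <= e.
Proof.
move=> e0 cq he; have iq : mu.-integrable `[- 2^-1, 2^-1] (EFin \o q).
  by apply: integrable_seg => x _; exact: cq.
have ic k : mu.-integrable `[- 2^-1, 2^-1] (EFin \o (fun _ : R => k)).
  by apply: integrable_seg => x _; exact: cvg_cst.
have vol k : \int[mu]_(x in `[- 2^-1, 2^-1]) (k : R) = k.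
  rewrite Rintegral_cst //= lebesgue_measure_itv /= lte_fin.
  have -> : - 2^-1 < 2^-1 :> R by lra.
  by rewrite -EFinB /=; lra.
have hx x : x \in `[- 2^-1, 2^-1]%classic -> - e <= q x - c <= e.
  by rewrite inE /= in_itv /= -!ler_norml; exact: he.
rewrite ler_norml; apply/andP; split.
  rewrite lerBrDr -(vol (- e + c)); apply: le_Rintegral => // x /mem_set/hx; lra.
rewrite lerBlDr -(vol (e + c)); apply: le_Rintegral => // x /mem_set/hx; lra.
Qed.

(** Half of the exponential absorbs the linear factor, by y exp(- l y / 2) <= 2 / l; the other half
    tends to 0. *)
Lemma height_exp_small l (a b K e : R) : 0 < l -> 0 <= a -> 0 <= b -> 0 <= K -> 0 < e ->
  exists2 Y : R, 2 <= Y & forall y, Y <= y -> (a * y + b) * (K * expR (- (l * y))) <= e.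
Proof.
move=> l0 a0 b0 K0 e0; have l20 : 0 < l / 2 by rewrite divr_gt0.
pose K' := (a * (2 / l) + b) * K.
have K'0 : 0 <= K' by rewrite mulr_ge0 // addr_ge0 // mulr_ge0 // divr_ge0 // ltW.
have [Y Y2 hY] := expR_small l20 K'0 e0; exists Y => // y yY.
apply: le_trans (hY y yY); rewrite /K' mulrA [_ * K * _]mulrAC [X in _ <= X]mulrAC.
rewrite ler_wpM2r //.
have y0 : 0 <= y by apply: le_trans yY; apply: le_trans Y2.
have -> : - (l * y) = - (l / 2 * y) + - (l / 2 * y) by field.
rewrite expRD; set E := expR (- (l / 2 * y)).
have E0 : 0 <= E := expR_ge0 _.
have E1 : E <= 1 by rewrite /E -[leRHS]expR0 ler_expR oppr_le0 mulr_ge0 // ltW.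
have yE : y * E <= 2 / l.
  rewrite /E expRN ler_pdivrMr ?expR_gt0 // -ler_pdivrMl ?divr_gt0 // invf_div.
  exact: le_expR.
rewrite mulrA ler_wpM2r // mulrDl lerD //; last by rewrite ler_piMr.
by rewrite -mulrA ler_wpM2l.
Qed.

Section PairingProof.
Variables (N : nat) (h : C -> R) (f g : C -> C) (kap beta : 'M[int]_2 -> R).
Hypotheses (N0 : (0 < N)%N) (hdat : eisenstein_datum N h f kap beta).
Hypothesis hg : modular_form 2 (Gamma0 N) g.
Let s := coset_reps (Gamma0 N).

Let sS A : A \in s -> SL2Z A.
Proof. by have [_ hs _ _] := coset_reps_Gamma0 N0; exact: hs. Qed.

Lemma height_C1 A : SL2Z A -> exists hx hy u,
  [/\ C1 u hx hy, forall x y, 0 < y -> u x y = h (mob A (x +i* y)) &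
   forall x y, 0 < y -> slash 2 f A (x +i* y) = hx x y +i* (- hy x y)].
Proof.
move=> hA; have [l [a [F [hF a00 hm hs]]]] := hdat.2 A hA.
have c1 := C1D (C1D (C1_height (- kap A)) (C1_Re_isq hF)) (C1_cst (beta A)).
do 3 eexists; split; first exact: c1.
  by move=> x y y0; rewrite hm //.
move=> x y y0; rewrite hs //; apply: complexP; rewrite !ReImE; ring.
Qed.

(** [green] is applied to (P, Q) for the real part and to (Q, -P) for the imaginary part; the second
    pair belongs to -i Phi, which has the same symmetries as Phi. *)
Lemma pairing_integral (T : R) : 1 < T -> [/\
  hyp_integral (FT T) (fun z => (Im z ^+ 2)%:C * tr_prod 2 (Gamma0 N) f g z) =
  (\int[mu]_(x in `[- 2^-1, 2^-1]) Im (Phi N h g (x +i* T)))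
  +i* (- \int[mu]_(x in `[- 2^-1, 2^-1]) Re (Phi N h g (x +i* T))),
  forall x, {for x, continuous (fun x => Re (Phi N h g (x +i* T)))} &
  forall x, {for x, continuous (fun x => Im (Phi N h g (x +i* T)))}].
Proof.
move=> T1; rewrite hyp_integral_tr.
(* The expansion data are chosen for all matrices at once, with zero as default outside SL_2(Z). *)
have /choice [D hD] : forall A, exists D : (R -> R -> R) * (R -> R -> R) *
   (R -> R -> R) * (R * (nat -> C)), SL2Z A ->
  [/\ C1 D.1.2 D.1.1.1 D.1.1.2,
    forall x y, 0 < y -> D.1.2 x y = h (mob A (x +i* y)),
    forall y x, 0 < y -> slash 2 f A (x +i* y) = D.1.1.1 x y +i* (- D.1.1.2 x y)
  & isq D.2.1 D.2.2 (slash 2 g A)].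
  move=> A; have [hA|nA] := pselect (SL2Z A); last first.
    by exists (fun _ _ => 0, fun _ _ => 0, fun _ _ => 0, (0, fun=> 0)).
  have [hx [hy [u [c1 e1 e2]]]] := height_C1 hA.
  have [l [b [hb _]]] := modular_slash_isq hg hA.
  by exists (hx, hy, u, (l, b)) => _; split => // y x; exact: e2.
pose u A := (D A).1.2; pose ux A := (D A).1.1.1; pose uy A := (D A).1.1.2.
pose gr A x y := Re (slash 2 g A (x +i* y)).
pose gi A x y := Im (slash 2 g A (x +i* y)).
pose dg A x y := dq (D A).2.1 (D A).2.2 (x +i* y).
have cP A : A \in s -> C1 (fun x y => u A x y * gr A x y)
    (fun x y => ux A x y * gr A x y + u A x y * Re (dg A x y))
    (fun x y => uy A x y * gr A x y + u A x y * - Im (dg A x y)).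
  by move=> /sS /hD [c1 _ _ hq]; exact: C1M c1 (C1_Re_isq hq).
have cQ A : A \in s -> C1 (fun x y => - 1 * (u A x y * gi A x y))
    (fun x y => - 1 * (ux A x y * gi A x y + u A x y * Im (dg A x y)))
    (fun x y => - 1 * (uy A x y * gi A x y + u A x y * Re (dg A x y))).
  move=> /sS /hD [c1 _ _ hq].
  by apply: C1_ext (C1M (C1_cst (- 1)) (C1M c1 (C1_Im_isq hq))) _ _ _ => [x y //|x y _|x y _]; rewrite mul0r add0r.
have CP := C1_sum_in cP; have CQ := C1_sum_in cQ.
set P := (fun x y => \sum_(A <- s) u A x y * gr A x y) in CP.
set Q := (fun x y => \sum_(A <- s) - 1 * (u A x y * gi A x y)) in CQ.
set Px := (fun x y => \sum_(A <- s) (ux A x y * gr A x y + u A x y * Re (dg A x y))) in CP.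
set Py := (fun x y => \sum_(A <- s) (uy A x y * gr A x y + u A x y * - Im (dg A x y))) in CP.
set Qx := (fun x y => \sum_(A <- s) _) in CQ.
set Qy := (fun x y => \sum_(A <- s) - 1 * (uy A x y * gi A x y + u A x y * Re (dg A x y))) in CQ.
have PhiE x y : 0 < y -> Phi N h g (x +i* y) = P x y +i* Q x y.
  move=> y0; apply: complexP; rewrite /Phi ?Re_sum ?Im_sum ?Re_pair ?Im_pair /P /Q
    big_seq [RHS]big_seq; apply: eq_bigr => A /sS /hD [_ e1 _ _];
    by rewrite -e1 // -/(u A) /gr /gi; move: (slash 2 g A (x +i* y)) (u A x y) => S v;
    rewrite !ReImE; ring.
have trE p : p \in Fdom T -> tr_prod 2 (Gamma0 N) f g (p.1 +i* p.2) =
   (Px p.1 p.2 + Qy p.1 p.2) +i* (Qx p.1 p.2 + - 1 * Py p.1 p.2).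
  rewrite inE => -[p0 _ _ _]; rewrite /tr_prod /Px /Py /Qx /Qy mulr_sumr -!big_split /=.
  apply: complexP; rewrite ?Re_sum ?Im_sum ?Re_pair ?Im_pair big_seq [RHS]big_seq;
    apply: eq_bigr => A /sS /hD [_ _ e2 _]; rewrite /gr /gi;
    have e3 := congr1 Re (e2 _ p.1 p0); have e4 := congr1 Im (e2 _ p.1 p0);
    move: e3 e4; rewrite Re_pair Im_pair -/(ux A) -/(uy A);
    move: (slash 2 f A _) (slash 2 g A _) => F' G' e3 e4; rewrite !ReImE e3 e4; ring.
have Pper y : 0 < y -> P 2^-1 y = P (- 2^-1) y /\ Q 2^-1 y = Q (- 2^-1) y.
  move=> y0; have z0 : 0 < Im ((- 2^-1 : R) +i* y) by [].
  have := Phi_add1 N0 hg hdat.1 z0.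
  have r1 : Re (1 : C) = 1 by [].
  have i1 : Im (1 : C) = 0 by [].
  have -> : (- 2^-1 : R) +i* y + 1 = (2^-1 : R) +i* y :> C.
    apply: complexP; first by rewrite ReD !Re_pair ?r1; lra.
    by rewrite ImD !Im_pair ?i1 addr0.
  by rewrite !PhiE // => -[-> ->].
have PS x y : 0 < y -> x ^+ 2 + y ^+ 2 = 1 ->
   P (- x) y = P x y * (x ^+ 2 - y ^+ 2) + 2 * x * y * Q x y /\
   Q (- x) y = Q x y * (x ^+ 2 - y ^+ 2) - 2 * x * y * P x y.
  move=> y0 E; have := Phi_circle erefl N0 hg hdat.1 y0 E; rewrite !PhiE // => H.
  have h1 := congr1 Re H; have h2 := congr1 Im H; move: h1 h2.
  move: (P (- x) y) (Q (- x) y) (P x y) (Q x y) => p q p' q'.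
  by rewrite !ReImE => -> ->; split; ring.
have CQ' : C1 (fun x y => - 1 * P x y) (fun x y => - 1 * Px x y) (fun x y => - 1 * Py x y).
  by apply: C1_ext (C1M (C1_cst (- 1)) CP) _ _ _ => * //; ring.
have g1 := @green R P Px Py Q Qx Qy T CP CQ T1 (fun y y0 => (Pper y y0).1)
  (fun x y y0 E => (PS x y y0 E).1) (fun x y y0 E => (PS x y y0 E).2).
have g2 := @green R Q Qx Qy (fun x y => - 1 * P x y) (fun x y => - 1 * Px x y)
  (fun x y => - 1 * Py x y) T CQ CQ' T1 (fun y y0 => (Pper y y0).2).
have T0 : 0 < T by apply: lt_trans T1.
have ER : (fun x => Re (Phi N h g (x +i* T))) = P^~ T.
  by apply/funext => t; rewrite PhiE.
have EI : (fun x => Im (Phi N h g (x +i* T))) = Q^~ T.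
  by apply/funext => t; rewrite PhiE.
have cR x : {for x, continuous (fun x => Re (Phi N h g (x +i* T)))}.
  have [[cP' _ _] _ _ _ _] := CP; rewrite ER.
  by apply: (@cont2_comp _ P id (cst T)) => //; exact: cvg_cst.
have cI x : {for x, continuous (fun x => Im (Phi N h g (x +i* T)))}.
  have [[cQ' _ _] _ _ _ _] := CQ; rewrite EI.
  by apply: (@cont2_comp _ Q id (cst T)) => //; exact: cvg_cst.
split => //; congr (_ +i* _).
  transitivity (\int[area]_(p in Fdom T) (Px p.1 p.2 + Qy p.1 p.2)).
    by apply: eq_Rintegral => p /trE ->.
  by rewrite g1; apply: eq_Rintegral => x _; rewrite PhiE.
transitivity (\int[area]_(p in Fdom T) (Qx p.1 p.2 + - 1 * Py p.1 p.2)).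
  by apply: eq_Rintegral => p /trE ->.
rewrite g2 => [|x y y0 E|x y y0 E].
- rewrite -[RHS]mulN1r -RintegralZl //; last first.
    by apply: (@integrable_seg _ (fun x => Re (Phi N h g (x +i* T)))) => x _.
  by apply: eq_Rintegral => x _; rewrite PhiE.
- by have [e1 e2] := PS x y y0 E; rewrite e2; ring.
- by have [e1 e2] := PS x y y0 E; rewrite e1; ring.
Qed.

End PairingProof.
End Pairing.

(** * The regularised limit and the sum rule for constant terms *)

Section PairingLimit.
Variable R : realType.
Local Notation C := R[i].
Local Notation Re := (@complex.Re R).
Local Notation Im := (@complex.Im R).
Implicit Types (A B M : 'M[int]_2) (z : C) (f g : C -> C).

Definition bracket N f g (T : R) : C :=
  hyp_integral (FT T) (fun z => (Im z ^+ 2)%:C * tr_prod 2 (Gamma0 N) f g z)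
  - a0_prod 2 (Gamma0 N) f g * (T ^+ (2 - 1) / (2 - 1)%:R)%:C.

Lemma petersson_cvT N f g s : cvT (bracket N f g) s ->
  petersson 2 (Gamma0 N) f g = (psl2_index (Gamma0 N))%:R^-1 * s.
Proof. by move=> h; rewrite /petersson; congr (_ * _); exact: cvTP. Qed.

Lemma sum_approx (I : eqType) (r : seq I) (u : I -> R -> R -> C) (c : I -> R -> C) :
  (forall i, i \in r -> forall e, 0 < e -> exists2 Y : R, 2 <= Y &
     forall x y, Y <= y -> nrm (u i x y - c i y) <= e) ->
  forall e, 0 < e -> exists2 Y : R, 2 <= Y & forall x y, Y <= y ->
     nrm (\sum_(i <- r) u i x y - \sum_(i <- r) c i y) <= e.
Proof.
elim: r => [|i r IH] h e e0.
  by exists 2 => // x y _; rewrite !big_nil subrr nrm0 ltW.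
have e20 : 0 < e / 2 by rewrite divr_gt0.
have [Y Y2 hY] := h i (mem_head _ _) _ e20.
have [Z Z2 hZ] : exists2 Y : R, 2 <= Y & forall x y, Y <= y ->
     nrm (\sum_(i <- r) u i x y - \sum_(i <- r) c i y) <= e / 2.
  by apply: IH => // j jr; apply: h; rewrite in_cons jr orbT.
exists (Num.max Y Z); first by rewrite le_max Y2.
move=> x y; rewrite ge_max => /andP[yY yZ]; rewrite !big_cons.
have := hY x y yY; have := hZ x y yZ.
set S := \sum_(_ <- _) _; set S' := \sum_(_ <- _) _ => h1 h2.
have -> : u i x y + S - (c i y + S') = (u i x y - c i y) + (S - S') by ring.
by apply: le_trans (nrmD _ _) _; lra.
Qed.

(** At height T each summand of [Phi] is (- kap T + beta) conj(a0 g) up to an exponentially small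
    error. The part linear in T cancels the regularising term, since T^(k-1) / (k-1) = T for k = 2
    and a0 f = i kap; the part with beta is left. *)
Lemma pairing_limit N (h : C -> R) f g kap beta : (0 < N)%N ->
  eisenstein_datum N h f kap beta -> modular_form 2 (Gamma0 N) g ->
  (forall A, SL2Z A -> a0 (slash 2 f A) = 'i%C * (kap A)%:C) ->
  cvT (bracket N f g)
    (- 'i%C * \sum_(A <- coset_reps (Gamma0 N)) (beta A)%:C * (a0 (slash 2 g A))^*%C).
Proof.
move=> N0 hdat hg ha e e0; set s := coset_reps _.
have sS A : A \in s -> SL2Z A by have [_ hs _ _] := coset_reps_Gamma0 N0; exact: hs.
pose cc A (y : R) : C := (- kap A * y + beta A)%:C * (a0 (slash 2 g A))^*%C.
have e20 : 0 < e / 2 by rewrite divr_gt0.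
have [Y Y2 hY] : exists2 Y : R, 2 <= Y & forall x y, Y <= y ->
   nrm (Phi N h g (x +i* y) - \sum_(A <- s) cc A y) <= e / 2.
  apply: (@sum_approx _ s (fun A x y => (h (mob A (x +i* y)))%:C *
     (slash 2 g A (x +i* y))^*%C) cc) => // A As d d0.
  have hA := sS A As; have [l [a [F [hF a00 hm _]]]] := hdat.2 A hA.
  have [l' [b [hb a0b]]] := modular_slash_isq hg hA.
  have [K K0 hK] := isq_bound hF; have [K' K'0 hK'] := isq_bound hb.
  have d20 : 0 < d / 2 by rewrite divr_gt0.
  have c0 : 0 <= nrm (b 0%N) + K' by rewrite addr_ge0 ?nrm_ge0.
  have [Y Y2 hY] := height_exp_small hF.1 (lexx 0) c0 K0 d20.
  have [Z Z2 hZ] := height_exp_small hb.1 (normr_ge0 (kap A)) (normr_ge0 (beta A)) K'0 d20.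
  exists (Num.max Y Z); first by rewrite le_max Y2.
  move=> x y; rewrite ge_max => /andP[yY yZ].
  have y2 : 2 <= y by apply: le_trans yY.
  have y0 : 0 < Im (x +i* y) by rewrite Im_pair; lra.
  have yh : 1 / 2 <= Im (x +i* y) by rewrite Im_pair; lra.
  rewrite hm // Im_pair /cc a0b.
  have := hK _ yh; have := hK' _ yh; have := hY _ yY; have := hZ _ yZ.
  rewrite a00 subr0 Im_pair mul0r add0r; set G := slash 2 g A _; set Fz := F _.
  set E := K * _; set E' := K' * _; set b0 := b 0%N => h1 h2 h3 h4.
  have E'1 : E' <= K'.
    by rewrite /E' ler_piMr // -[leRHS]expR0 ler_expR oppr_le0 mulr_ge0 ?(ltW hb.1) //; lra.
  (* A decaying factor times the bounded [G], plus a factor linear in y times the exponentially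
     small G - b0. *)
  have -> : (- kap A * y + Re Fz + beta A)%:C * G^*%C - (- kap A * y + beta A)%:C * b0^*%C =
    (Re Fz)%:C * G^*%C + (- kap A * y + beta A)%:C * (G - b0)^*%C.
    by rewrite rmorphB !CD /=; ring.
  apply: le_trans (nrmD _ _) _; rewrite !nrmM !nrmC !nrmJ.
  have nG : nrm G <= nrm b0 + K'.
    by have := nrmD (G - b0) b0; rewrite subrK; lra.
  have t1 : `|Re Fz| * nrm G <= (nrm b0 + K') * E.
    rewrite mulrC ler_pM ?nrm_ge0 //; exact: le_trans (nrm_Re _) h4.
  have t2 : `|- kap A * y + beta A| * nrm (G - b0) <= (`|kap A| * y + `|beta A|) * E'.
    rewrite ler_pM ?nrm_ge0 //; apply: le_trans (ler_normD _ _) _.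
    by rewrite lerD2r normrM normrN (ger0_norm (_ : 0 <= y)) //; lra.
  lra.
exists Y => T TY; have T1 : 1 < T by lra.
rewrite /bracket.
have [-> cR cI] := pairing_integral N0 hdat hg T1.
have -> : a0_prod 2 (Gamma0 N) f g = 'i%C * \sum_(A <- s) (kap A)%:C * (a0 (slash 2 g A))^*%C.
  rewrite /a0_prod mulr_sumr big_seq [RHS]big_seq; apply: eq_bigr => A /sS hA.
  by rewrite ha // mulrA.
set SK := \sum_(A <- s) (kap A)%:C * _; set SB := \sum_(A <- s) (beta A)%:C * _.
set c := \sum_(A <- s) cc A T in hY.
have cE : \sum_(A <- s) cc A T = - T%:C * SK + SB.
  rewrite /SK /SB mulr_sumr -big_split; apply: eq_bigr => A _ /=.
  by rewrite /cc CD CM CN; ring.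
have hT x : `|Re (Phi N h g (x +i* T)) - Re (\sum_(A <- s) cc A T)| <= e / 2 /\
            `|Im (Phi N h g (x +i* T)) - Im (\sum_(A <- s) cc A T)| <= e / 2.
  have hx := hY x T TY; split.
    by rewrite -ReN -ReD; apply: le_trans (nrm_Re _) _.
  by rewrite -ImN -ImD; apply: le_trans (nrm_Im _) _.
have iR := @integral_seg_approx R _ _ _ (ltW e20) cR (fun x _ => (hT x).1).
have iI := @integral_seg_approx R _ _ _ (ltW e20) cI (fun x _ => (hT x).2).
move: iR iI; rewrite cE.
set IR := (X in `|X - _|); set II := (X in _ -> `|X - _| <= _ -> _) => iR iI.
have -> : (2 - 1)%N = 1%N by []; rewrite expr1 divr1.
have -> : (II +i* (- IR)) - 'i%C * SK * T%:C - - 'i%C * SB =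
  (II - Im (- T%:C * SK + SB))%:C - 'i%C * (IR - Re (- T%:C * SK + SB))%:C.
  clear; clearbody SK SB IR II; pose nIR : R := - IR; rewrite -[- IR]/nIR.
  apply: complexP; rewrite !ReImE /nIR; ring.
apply: le_trans (nrmB _ _) _; rewrite nrmM nrm_i mul1r !nrmC.
lra.
Qed.

Lemma slash0 A z : slash 2 (fun=> 0) A z = 0 :> C.
Proof. by rewrite slashE mul0r. Qed.

Lemma a0_slash0 A : a0 (slash 2 (fun=> 0) A) = 0 :> C.
Proof.
have l0 : 0 < 2 * pi / 1%:R :> R by rewrite divr1 mulr_gt0 ?pi_gt0.
have h : isq (2 * pi / 1%:R) (fun=> 0) (slash 2 (fun=> 0 : C) A).
  by apply: isq_ext (isq0 l0) _ _ => // z _; rewrite slash0.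
exact: a0_fourier (isq_fourier (ltn0Sn 0) h) h.
Qed.

(** This is the residue theorem for g(z) dz: with f = 0 the bracket is 0 for every T, so the
    boundary sum that is its limit vanishes. *)
Lemma sum_a0_zero N g : (0 < N)%N -> modular_form 2 (Gamma0 N) g ->
  \sum_(A <- coset_reps (Gamma0 N)) a0 (slash 2 g A) = 0.
Proof.
move=> N0 hg.
have dat : @eisenstein_datum R N (fun=> 1) (fun=> 0) (fun=> 0) (fun=> 1).
  split=> // A hA; exists 1, (fun=> 0), (fun=> 0); split => //.
  - exact: isq0.
  - by move=> z _; rewrite oppr0 mul0r !add0r.
  - move=> z z0; rewrite slash0 /dq mulr0 addr0.
    have <- : 0 = qsum 1 (fun n => n%:R * 0) z; last by rewrite mulr0.
    transitivity (qsum 1 (fun=> 0 : C) z); first exact: (isqE (isq0 ltr01) z0).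
    by congr (qsum _ _ _); apply/funext => n; rewrite mulr0.
have az A : SL2Z A -> a0 (slash 2 (fun=> 0) A) = 'i%C * (0 : R)%:C.
  by move=> _; rewrite mulr0 a0_slash0.
have H := pairing_limit N0 dat hg az.
have E T : bracket N (fun=> 0) g T = 0.
  rewrite /bracket hyp_integral_tr.
  have -> : a0_prod 2 (Gamma0 N) (fun=> 0) g = 0.
    rewrite /a0_prod big1 // => A _.
    by rewrite a0_slash0 mul0r.
  have t0 z : tr_prod 2 (Gamma0 N) (fun=> 0) g z = 0.
    by rewrite /tr_prod big1 // => A _; rewrite slash0 mul0r.
  under eq_Rintegral do rewrite t0.
  under [X in _ +i* X]eq_Rintegral do rewrite t0.
  rewrite mul0r subr0 !Rintegral_cst ?mul0r //; exact: measurable_Fdom.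
have S0 : - 'i%C * \sum_(A <- coset_reps (Gamma0 N)) (1 : R)%:C * (a0 (slash 2 g A))^*%C = 0.
  apply/eqP; rewrite -nrm_eq0 eq_le nrm_ge0 andbT; apply: le_eps_nrm => e e0.
  by have [T0 /(_ T0 (lexx _))] := H e e0; rewrite E sub0r nrmN add0r.
move: S0 => /eqP; rewrite mulf_eq0 oppr_eq0 => /orP[/eqP/(congr1 Im)/=|/eqP S0].
  by move/eqP; rewrite oner_eq0.
apply/eqP; rewrite -conjc_eq0 rmorph_sum /=; apply/eqP; rewrite -[RHS]S0.
by apply: eq_bigr => A _; rewrite mul1r.
Qed.

End PairingLimit.

(** * Eisenstein series of level N *)

Section EisensteinSeries.
Variable R : realType.
Local Notation C := R[i].
Local Notation Re := (@complex.Re R).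
Local Notation Im := (@complex.Im R).
Local Notation tpi := (2 * pi : R).
Local Notation gei := (@gei R).
Local Notation zeta2 := (@zeta2 R).
Local Notation ge := (@ge R).
Implicit Types (A B M : 'M[int]_2) (z : C) (D : seq (R * nat)).

Lemma qder_unique (f : C -> C) z d e : qder f z d -> qder f z e -> d = e.
Proof.
case: z => x y hd he; have [hd1 hd2] := derive_x hd; have [he1 he2] := derive_x he.
by apply: complexP; [case: hd1 => _ <-; case: he1 => _ <- | case: hd2 => _ <-; case: he2 => _ <-].
Qed.

Lemma isq_cst l (c : C) : 0 < l -> isq l (fun n => if n is 0 then c else 0) (fun=> c).
Proof.
move=> l0; split => // z _; apply: (@eq_cvC _ 1 (fun=> c)); last exact: cvC_cst.
case=> // n _; rewrite big_nat_recl // big1 ?addr0 => [|k _]; last by rewrite /qterm mul0r.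
by rewrite /qterm mulr0 ex0 mulr1.
Qed.

Lemma sig0 : sig R 0 = 0. Proof. by rewrite /sig big_geq. Qed.

Definition eterm (d : nat) z : C := d%:R * ('i%C * gei (d%:R * z)).

(** This is gcd(d, c)^2 / d with c = A 1 0: by [eis_triangular], the factor by which z -> d z scales
    heights when seen from the cusp of A. *)
Definition cusp_ratio A (d : nat) : R :=
  (gcdn d (absz (A 1 0)))%:R / (d %/ gcdn d (absz (A 1 0)))%:R.

(* The non-holomorphic part of [eterm d | A]; it does not depend on [d]. *)
Definition anom A z : C :=
  'i%C * ((ge / Im (mob A z))%:C / den A z ^+ 2 - (ge / Im z)%:C).

Lemma cusp_ratio_gt0 A d : (0 < d)%N -> 0 < cusp_ratio A d.
Proof.
move=> d0; have u0 : (0 < gcdn d (absz (A 1%R 0%R)))%N by rewrite gcdn_gt0 d0.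
by rewrite divr_gt0 // ltr0n // divn_gt0 // dvdn_leq ?dvdn_gcdl.
Qed.

Lemma Im_natM d z : Im (d%:R * z) = d%:R * Im z.
Proof. by rewrite ImM Re_nat Im_nat mul0r addr0. Qed.

Lemma eterm_estar d (D z : C) : (0 < d)%N -> 0 < Im z ->
  eterm d z / D = 'i%C * (d%:R * estar (d%:R * z) / D) + 'i%C * ((ge / Im z)%:C / D).
Proof.
move=> d0 z0; rewrite /eterm /estar Im_natM.
have dn : (d%:R : R) != 0 by rewrite pnatr_eq0 -lt0n.
have -> : (ge / Im z)%:C = d%:R * (ge / (d%:R * Im z))%:C.
  by rewrite natC -CM; congr (_ %:C); field; rewrite dn gt_eqF.
ring.
Qed.

Lemma eis_term N d A : (0 < N)%N -> (d %| N)%N -> SL2Z A -> exists a F,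
  [/\ isq (tpi / N%:R) a F, a 0%N = 0,
   forall z, 0 < Im z -> Hf (d%:R * mob A z) =
     - Re zeta2 * cusp_ratio A d * Im z + Re (F z) + ge * ln (cusp_ratio A d) + ge * ln (Im z) &
   forall z, 0 < Im z -> slash 2 (eterm d) A z =
     dq (tpi / N%:R) a z + 'i%C * (Re zeta2 * cusp_ratio A d)%:C + anom A z].
Proof.
move=> N0 dN hA; have d0 : (0 < d)%N := dvdn_gt0 N0 dN.
have [b hb] := eis_triangular R d0 hA; move: hb => /=; rewrite -/(cusp_ratio A d) => hb.
have r0 := cusp_ratio_gt0 A d0; set u := gcdn d (absz (A 1 0)).
have u0 : (0 < u)%N by rewrite gcdn_gt0 d0.
have ud : (u %| d)%N by rewrite dvdn_gcdl.
(* m = N * cusp_ratio A d, an integer since d divides N. Spreading by m produces the frequency 2 pi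
   / N for every d, so that the expansions can be added. *)
pose m := (u * u * (N %/ d))%N.
have m0 : (0 < m)%N by rewrite !muln_gt0 u0 divn_gt0 // dvdn_leq.
have lE : tpi * cusp_ratio A d / m%:R = tpi / N%:R.
  have NE : (N%:R : R) = (N %/ d)%:R * (d %/ u)%:R * u%:R.
    by rewrite -!natrM -mulnA (divnK ud) divnK.
  have n1 : ((N %/ d)%:R : R) != 0 by rewrite pnatr_eq0 -lt0n divn_gt0 // dvdn_leq.
  have n2 : ((d %/ u)%:R : R) != 0 by rewrite pnatr_eq0 -lt0n divn_gt0 // dvdn_leq.
  have n3 : (u%:R : R) != 0 by rewrite pnatr_eq0 -lt0n.
  by rewrite NE /cusp_ratio -/u /m !natrM; field; rewrite n1 n2 n3.
have hF : isq (tpi / N%:R) (spread m (fun n => lam R n * ex (tpi * n%:R) b%:C))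
    (fun z => @Lam R ((cusp_ratio A d)%:C * z + b%:C)).
  rewrite -lE; apply: isq_spread => //; apply: isq_affine => //.
  by apply: growth_isq; [exact: tpi_gt0 | exact: growth_lam].
do 2 eexists; split; first exact: hF.
- by rewrite spread0 /lam sig0 mul0r mulr0 mul0r.
- move=> z z0; have [-> _] := hb z z0; rewrite /Hf.
  have -> : Im ((cusp_ratio A d)%:C * z + b%:C) = cusp_ratio A d * Im z.
    by rewrite ImD ImM !ImC ReC mul0r !addr0.
  by rewrite lnM ?posrE //; ring.
move=> z z0; have [_ h2] := hb z z0; rewrite slashE.
set w := (cusp_ratio A d)%:C * z + b%:C in h2.
have w0 : 0 < Im w by rewrite /w ImD ImC addr0 H_scale.
rewrite eterm_estar ?mob_H // h2 /anom /estar.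
have -> : (ge / Im z)%:C = (cusp_ratio A d)%:C * (ge / Im w)%:C.
  rewrite -CM; congr (_ %:C).
  have -> : Im w = cusp_ratio A d * Im z by rewrite /w ImD ImM !ImC ReC mul0r !addr0.
  by field; rewrite !gt_eqF.
have hw : qder (fun z => (cusp_ratio A d)%:C * z + b%:C) z ((cusp_ratio A d)%:C * 1 + 0).
  by apply: qderD; [apply: qderZ; exact: qder_id | exact: qder_cst].
(* Uniqueness of the derivative identifies the q-series [dq] with the chain rule for Lam(r z +
   b). *)
have := qder_unique (isq_qder hF z0) (qder_comp hw (qder_Lam w0)).
rewrite -/w -/(dq _ _ _) => ->; rewrite [(Re zeta2 * _)%:C]CM -zeta2_real; ring.
Qed.

(** Conjugation by diag(d, 1) divides the lower left entry by d, and d divides N, which divides that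
    entry. *)
Lemma Gamma0_conj N d A : (0 < N)%N -> (d %| N)%N -> Gamma0 N A ->
  exists2 A', SL2Z A' & forall z, 0 < Im z ->
    mob A' (d%:R * z) = d%:R * mob A z /\ den A' (d%:R * z) = den A z.
Proof.
move=> N0 dN [hA NA]; have d0 := dvdn_gt0 N0 dN.
have /dvdzP [k kE] : (d%:Z %| A 1%R 0%R)%Z.
  by apply: dvdz_trans NA; rewrite dvdzE.
have [m1 m2 m3 m4] := mx2E (A 0 0) (d%:Z * A 0 1) k (A 1 1).
exists (mx2 (A 0 0) (d%:Z * A 0 1) k (A 1 1)).
  by rewrite /SL2Z /= det2 m1 m2 m3 m4 -(SL2P hA) kE; ring.
move=> z z0.
have E : den (mx2 (A 0 0) (d%:Z * A 0 1) k (A 1 1)) (d%:R * z) = den A z.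
  by rewrite /den m3 m4 kE intrM -pmulrn mulrA.
by split=> //; rewrite /mob E m1 m2 intrM -pmulrn; ring.
Qed.

Lemma eis_term_inv N d A z : (0 < N)%N -> (d %| N)%N -> Gamma0 N A -> 0 < Im z ->
  Hf (d%:R * mob A z) = Hf (d%:R * z) /\
  slash 2 (eterm d) A z = eterm d z + anom A z.
Proof.
move=> N0 dN hA z0; have d0 := dvdn_gt0 N0 dN.
have [A' hA' h] := Gamma0_conj N0 dN hA; have [h1 h2] := h z z0.
have dz0 : 0 < Im (d%:R * z) by rewrite Im_natM mulr_gt0 // ltr0n.
have [e1 e2] := eis_inv hA' dz0; have hS := Gamma0_SL hA.
split; first by rewrite -h1.
have n0 := den_neq0 hS z0.
rewrite slashE eterm_estar ?mob_H // -h1 e2 h2 /anom.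
have := eterm_estar 1 d0 z0; rewrite !divr1 => ->.
move: (estar _) (den A z) n0 (ge / Im (mob A z))%:C (ge / Im z)%:C => E dn n0 g1 g2.
by field.
Qed.

(** [D] lists pairs of a coefficient c_d and its divisor d. *)
Definition fE D z : C := \sum_(i <- D) i.1%:C * eterm i.2 z.
Definition hE D z : R := \sum_(i <- D) i.1 * Hf (i.2%:R * z).
Definition kapE D A : R := Re zeta2 * \sum_(i <- D) i.1 * cusp_ratio A i.2.
Definition betaE D A : R := ge * \sum_(i <- D) i.1 * ln (cusp_ratio A i.2).

Lemma slash_fE D A z : slash 2 (fE D) A z = \sum_(i <- D) i.1%:C * slash 2 (eterm i.2) A z.
Proof. by rewrite slashE mulr_suml; apply: eq_bigr => i _; rewrite slashE mulrA. Qed.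

Section Datum.
Variables (N : nat) (D : seq (R * nat)).
Hypotheses (N0 : (0 < N)%N) (DN : all (fun i => i.2 %| N)%N D).
(** The factor [ge] lets this serve two cases: coefficients of sum 0 and, in the proof by
    contradiction of [ge_neq0], the single coefficient 1 under the assumption ge = 0. *)
Hypothesis D0 : ge * \sum_(i <- D) i.1 = 0.
Let l : R := tpi / N%:R.
Let l0 : 0 < l. Proof. by rewrite divr_gt0 ?tpi_gt0 ?ltr0n. Qed.
Let D0C A z : \sum_(i <- D) i.1%:C * anom A z = 0.
Proof.
rewrite -mulr_suml -(rmorph_sum (real_complex R)) /=.
have -> : anom A z = ge%:C * ('i%C * ((Im (mob A z))^-1%:C / den A z ^+ 2 - (Im z)^-1%:C)).
  by rewrite /anom !CM; ring.
by rewrite mulrA -CM mulrC [_ * ge]mulrC D0 mulr0.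
Qed.

Lemma eis_expansion A : SL2Z A -> exists a F, [/\ isq l a F, a 0%N = 0,
    forall z, 0 < Im z -> hE D (mob A z) = - kapE D A * Im z + Re (F z) + betaE D A &
    forall z, 0 < Im z -> slash 2 (fE D) A z = dq l a z + 'i%C * (kapE D A)%:C].
Proof.
move=> hA.
have /choice [aF haF] : forall d : nat, exists aF : (nat -> C) * (C -> C),
  [/\ isq l aF.1 aF.2, aF.1 0%N = 0 & (d %| N)%N ->
   (forall z, 0 < Im z -> Hf (d%:R * mob A z) =
     - Re zeta2 * cusp_ratio A d * Im z + Re (aF.2 z) + ge * ln (cusp_ratio A d) + ge * ln (Im z)) /\
   forall z, 0 < Im z -> slash 2 (eterm d) A z =
     dq l aF.1 z + 'i%C * (Re zeta2 * cusp_ratio A d)%:C + anom A z].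
  move=> d; have [dN|dN] := boolP (d %| N)%N; last first.
    by exists (fun=> 0, fun=> 0); split => //; exact: isq0.
  by have [a [F [h1 h2 h3 h4]]] := eis_term N0 dN hA; exists (a, F).
pose a n := \sum_(i <- D) i.1%:C * (aF i.2).1 n.
pose F z := \sum_(i <- D) i.1%:C * (aF i.2).2 z.
have hF : isq l a F.
  by apply: isq_sum => // i; apply: isqZ; have [] := haF i.2.
exists a, F; split => //.
- by rewrite /a big1 // => i _; have [_ -> _] := haF i.2; rewrite mulr0.
- move=> z z0; rewrite /hE.
  transitivity (\sum_(i <- D) (- (Re zeta2 * (i.1 * cusp_ratio A i.2)) * Im z +
      Re (i.1%:C * (aF i.2).2 z) + ge * (i.1 * ln (cusp_ratio A i.2)) + i.1 * (ge * ln (Im z)))).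
    rewrite big_seq [RHS]big_seq; apply: eq_bigr => i /(allP DN) iN.
    have [_ _ /(_ iN) [h _]] := haF i.2; rewrite h // ReM ReC ImC; ring.
  rewrite !big_split /= -[X in _ + X = _]mulr_suml mulrA [_ * ge]mulrC D0 mul0r addr0 -mulr_suml.
  by rewrite /kapE /betaE /F Re_sum !mulr_sumr sumrN.
move=> z z0; rewrite slash_fE.
have dF : dq l a z = \sum_(i <- D) i.1%:C * dq l (aF i.2).1 z.
  apply: qder_unique (isq_qder hF z0) _; apply: qder_sum => i; apply: qderZ.
  by have [h _ _] := haF i.2; exact: isq_qder h z0.
transitivity (\sum_(i <- D) (i.1%:C * dq l (aF i.2).1 z +
    'i%C * (Re zeta2 * (i.1 * cusp_ratio A i.2))%:C + i.1%:C * anom A z)).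
  rewrite big_seq [RHS]big_seq; apply: eq_bigr => i /(allP DN) iN.
  have [_ _ /(_ iN) [_ h]] := haF i.2; rewrite h // !CM; ring.
rewrite !big_split /= D0C addr0 -dF /kapE mulr_sumr rmorph_sum mulr_sumr.
by [].
Qed.

Lemma eisenstein_datum_E : eisenstein_datum N (hE D) (fE D) (kapE D) (betaE D).
Proof.
split=> [A z hA z0|A hA].
  rewrite /hE big_seq [RHS]big_seq; apply: eq_bigr => i /(allP DN) iN.
  by have [-> _] := eis_term_inv N0 iN hA z0.
by have [a [F h]] := eis_expansion hA; exists l, a, F.
Qed.

Lemma isq_slash_fE A : SL2Z A -> exists2 b, isq l b (slash 2 (fE D) A) &
  b 0%N = 'i%C * (kapE D A)%:C.
Proof.
move=> hA; have [a [F [hF a00 _ hs]]] := eis_expansion hA.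
exists (fun n => 'i%C * l%:C * (n%:R * a n) + if n is 0 then 'i%C * (kapE D A)%:C else 0).
  apply: isq_ext (isqD (isq_dq hF) (isq_cst _ l0)) _ _ => // z z0.
  by rewrite hs.
by rewrite mul0r mulr0 add0r.
Qed.

Lemma modular_E : modular_form 2 (Gamma0 N) (fE D).
Proof.
split=> [z z0|A z hA z0|A hA].
- have S1 : SL2Z (Tmx 0) := SL2Z_T 0.
  have [b hb _] := isq_slash_fE S1.
  apply: (@qder_derivable _ _ _ (dq l b z)); apply: (qder_eqH z0 _ (isq_qder hb z0)) => w w0.
  by rewrite slashE mob_T den_T addr0 expr1n divr1.
- transitivity (fE D z + \sum_(i <- D) i.1%:C * anom A z); last by rewrite D0C addr0.
  rewrite slash_fE /fE -big_split /=.
  rewrite big_seq [RHS]big_seq; apply: eq_bigr => i /(allP DN) iN.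
  by have [_ ->] := eis_term_inv N0 iN hA z0; rewrite mulrDr.
- by have [b hb _] := isq_slash_fE hA; exists N, b; apply: isq_fourier.
Qed.

Lemma a0_E A : SL2Z A -> a0 (slash 2 (fE D) A) = 'i%C * (kapE D A)%:C.
Proof.
by move=> hA; have [b hb <-] := isq_slash_fE hA; exact: a0_fourier (isq_fourier N0 hb) hb.
Qed.

End Datum.
End EisensteinSeries.

(** * Cusp ratios, the constant [ge], and degeneracy for composite N *)

Section Levels.
Variable R : realType.
Local Notation C := R[i].
Local Notation Re := (@complex.Re R).
Local Notation Im := (@complex.Im R).
Local Notation zeta2 := (@zeta2 R).
Local Notation ge := (@ge R).
Implicit Types (A B M : 'M[int]_2) (z : C) (f g : C -> C).

Lemma Re_zeta2_neq0 : Re zeta2 != 0.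
Proof. by have := zeta2_neq0 R; rewrite zeta2_real C_eq0. Qed.

Lemma cusp_ratio1 A : cusp_ratio R A 1 = 1.
Proof. by rewrite /cusp_ratio gcd1n divn1 divr1. Qed.

Lemma cusp_ratio_T0 d : (0 < d)%N -> cusp_ratio R (Tmx 0) d = d%:R.
Proof.
move=> d0; rewrite /cusp_ratio /Tmx; have [_ _ -> _] := mx2E 1 0 0 1.
by rewrite gcdn0 divnn d0 divr1.
Qed.

Lemma cusp_ratio_prime A p : prime p ->
  cusp_ratio R A p = if (p %| absz (A 1%R 0%R))%N then p%:R else p%:R^-1.
Proof.
move=> pp; rewrite /cusp_ratio; case: ifP => pc.
  by rewrite (gcdn_idPl pc) divnn prime_gt0 // divr1.
have : coprime p (absz (A 1%R 0%R)) by rewrite prime_coprime // pc.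
by rewrite /coprime => /eqP ->; rewrite divn1 mul1r.
Qed.

Lemma cusp_ratio_mul A p q : prime p -> prime q -> p != q ->
  cusp_ratio R A (p * q) = cusp_ratio R A p * cusp_ratio R A q.
Proof.
move=> pp pq npq; have cpq : coprime p q by rewrite prime_coprime // dvdn_prime2.
rewrite (cusp_ratio_prime A pp) (cusp_ratio_prime A pq) /cusp_ratio gcdnC; set c := absz _.
have p0 := prime_gt0 pp; have q0 := prime_gt0 pq.
case: ifP => pc; last first.
  have cp : coprime c p by rewrite coprime_sym prime_coprime // pc.
  rewrite (Gauss_gcdr _ cp) gcdnC; case: ifP => qc.
    by rewrite (gcdn_idPl qc) mulnK // mulrC.
  have : coprime q c by rewrite prime_coprime // qc.
  by rewrite /coprime => /eqP ->; rewrite divn1 natrM invfM mul1r.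
case: ifP => qc.
  have pqc : (p * q %| c)%N by rewrite Gauss_dvd // pc.
  by rewrite gcdnC (gcdn_idPl pqc) divnn muln_gt0 p0 q0 divr1 natrM.
have cq : coprime c q by rewrite coprime_sym prime_coprime // qc.
by rewrite (Gauss_gcdl _ cq) gcdnC (gcdn_idPl pc) mulKn.
Qed.

Lemma coset_reps_size N : (0 < N)%N -> (0 < size (coset_reps (Gamma0 N)))%N.
Proof.
move=> N0; have [_ _ _ hs] := coset_reps_Gamma0 N0.
by have [B] := hs _ SL2Z_S; case: coset_reps.
Qed.

(** Were ge = 0, the one-term list would give a form of level 1 all of whose constant terms equal i
    zeta(2), against [sum_a0_zero]. *)
Lemma ge_neq0 : ge != 0.
Proof.
have N0 : (0 < 1)%N by [].
apply/eqP => g0; pose D : seq (R * nat) := [:: (1, 1%N)].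
have DN : all (fun i => i.2 %| 1)%N D by [].
have D0 : ge * \sum_(i <- D) i.1 = 0 by rewrite g0 mul0r.
have := sum_a0_zero N0 (modular_E N0 DN D0).
have [_ sS _ _] := coset_reps_Gamma0 N0.
rewrite big_seq (eq_bigr (fun=> 'i%C * zeta2)) => [|A /sS hA]; last first.
  by rewrite (a0_E N0 DN D0 hA) /kapE big_seq1 cusp_ratio1 !mulr1 -zeta2_real.
rewrite -big_seq big_const_seq count_predT iter_addr_0 => /eqP.
rewrite mulrn_eq0 mulf_eq0 (negbTE (zeta2_neq0 R)) orbF => /orP[|].
  by rewrite -[_ == _]negbK -lt0n coset_reps_size.
by move/eqP/(congr1 Im)/eqP; rewrite Im_i oner_eq0.
Qed.

(** [pairing_limit] makes [fE D] orthogonal to every form. It is not zero: its constant term at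
    infinity is i * kapE D (Tmx 0), where [Tmx 0] is the identity. *)
Lemma petersson_degenerate_of N (D : seq (R * nat)) : (0 < N)%N ->
  all (fun i => i.2 %| N)%N D -> \sum_(i <- D) i.1 = 0 ->
  (forall A, betaE D A = 0) -> kapE D (Tmx 0) != 0 ->
  petersson_degenerate R 2 (Gamma0 N).
Proof.
move=> N0 DN DS b0 k0; have D0 : ge * \sum_(i <- D) i.1 = 0 by rewrite DS mulr0.
move=> /(_ (fE D) (modular_E N0 DN D0)) H.
have /H {}H g : modular_form 2 (Gamma0 N) g -> petersson 2 (Gamma0 N) (fE D) g = 0.
  move=> hg.
  have := pairing_limit N0 (eisenstein_datum_E N0 DN D0) hg (fun A hA => a0_E N0 DN D0 hA).
  move=> /petersson_cvT ->; rewrite big1 ?mulr0 // => A _; rewrite b0 mul0r //.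
have [b hb b0E] := isq_slash_fE N0 DN D0 (SL2Z_T 0).
have := isq_a0_unique hb (@isq0 R 1 ltr01).
rewrite b0E => /(_ _) E; have : 'i%C * (kapE D (Tmx 0))%:C = 0 :> C.
  apply: E => z z1; rewrite slashE mob_T den_T addr0 H ?mul0r //.
  by apply: lt_trans z1.
move/eqP; rewrite mulf_eq0 C_eq0 (negbTE k0) orbF => /eqP/(congr1 Im)/eqP.
by rewrite Im_i oner_eq0.
Qed.

Lemma degenerate_composite N : (1 < N)%N -> squarefree N -> ~~ prime N ->
  petersson_degenerate R 2 (Gamma0 N).
Proof.
move=> N1 sqf nN; have N0 : (0 < N)%N by apply: ltnW.
pose p := pdiv N; have pp : prime p := pdiv_prime N1.
have pN : (p %| N)%N := pdiv_dvd N.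
have m1 : (1 < N %/ p)%N.
  rewrite ltn_neqAle divn_gt0 ?prime_gt0 // dvdn_leq // andbT; apply/eqP => E.
  by move: nN; rewrite -(divnK pN) -E mul1n pp.
pose q := pdiv (N %/ p); have pq : prime q := pdiv_prime m1.
have qN : (p * q %| N)%N.
  by rewrite -[X in (_ %| X)%N](divnK pN) mulnC dvdn_pmul2r ?prime_gt0 // pdiv_dvd.
have npq : p != q.
  apply/eqP => E; move: qN; rewrite -E mulnn => /sqf p1.
  by move: pp; rewrite p1.
have p1 := prime_gt1 pp; have q1 := prime_gt1 pq.
have p0 := prime_gt0 pp; have q0 := prime_gt0 pq.
pose D : seq (R * nat) := [:: (1, 1%N); (- 1, p); (- 1, q); (1, (p * q)%N)].
apply: (@petersson_degenerate_of N D) => //.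
- by rewrite /= dvd1n pN qN (dvdn_trans (dvdn_mull p (dvdnn q)) qN).
- by rewrite /D !big_cons big_nil /=; ring.
- move=> A; rewrite /betaE /D !big_cons big_nil /= cusp_ratio1 ln1 cusp_ratio_mul //.
  by rewrite lnM ?posrE ?cusp_ratio_gt0 //; ring.
- rewrite /kapE mulf_neq0 ?Re_zeta2_neq0 // /D !big_cons big_nil /= !cusp_ratio_T0 ?muln_gt0 ?p0 //.
  have -> : 1 * 1%:R + (-1 * p%:R + (-1 * q%:R + (1 * (p * q)%:R + 0))) =
    (p%:R - 1) * (q%:R - 1) :> R by rewrite natrM; ring.
  by rewrite mulf_neq0 // subr_eq0 pnatr_eq1; apply/eqP => E; [move: p1 | move: q1]; rewrite E.
Qed.

Lemma slash_lin f g (c : C) A z :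
  slash 2 (fun w => f w + c * g w) A z = slash 2 f A z + c * slash 2 g A z.
Proof. by rewrite !slashE; ring. Qed.

Lemma slash_T0 f z : slash 2 f (Tmx 0) z = f z.
Proof. by rewrite slashE mob_T den_T addr0 expr1n divr1. Qed.

Lemma modular_isq N f : modular_form 2 (Gamma0 N) f -> exists l b, isq l b f.
Proof.
move=> hf; have [l [b [hb _]]] := modular_slash_isq hf (SL2Z_T 0).
by exists l, b; apply: isq_ext hb _ _ => // z _; exact: slash_T0.
Qed.

(** Expansions of periods w and v are spread to the common period w v before being added. *)
Lemma modular_lin N f g c : modular_form 2 (Gamma0 N) f -> modular_form 2 (Gamma0 N) g ->
  modular_form 2 (Gamma0 N) (fun z => f z + c * g z) /\
  forall A, SL2Z A -> a0 (slash 2 (fun z => f z + c * g z) A) =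
    a0 (slash 2 f A) + c * a0 (slash 2 g A).
Proof.
move=> hf hg.
have H A : SL2Z A -> exists w a, [/\ (0 < w)%N,
    isq (2 * pi / w%:R) a (slash 2 (fun z => f z + c * g z) A) &
    a 0%N = a0 (slash 2 f A) + c * a0 (slash 2 g A)].
  move=> hA; have [_ _ /(_ A hA) [w [a hw]]] := hf; have [_ _ /(_ A hA) [v [b hv]]] := hg.
  have v0 := hv.1; have w0 := hw.1.
  have hq := isq_spread v0 (fourier_isq hw); have hr := isq_spread w0 (fourier_isq hv).
  have wn : (w%:R : R) != 0 by rewrite pnatr_eq0 -lt0n.
  have vn : (v%:R : R) != 0 by rewrite pnatr_eq0 -lt0n.
  have E1 : 2 * pi / w%:R / v%:R = 2 * pi / (w * v)%:R :> R.
    by rewrite natrM; field; rewrite wn vn.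
  have E2 : 2 * pi / v%:R / w%:R = 2 * pi / (w * v)%:R :> R.
    by rewrite natrM; field; rewrite wn vn.
  rewrite E1 in hq; rewrite E2 in hr.
  exists (w * v)%N, (fun n => spread v a n + c * spread w b n); split.
  - by rewrite muln_gt0 w0 v0.
  - by apply: isq_ext (isqD hq (isqZ c hr)) _ _ => // z _; rewrite slash_lin.
  - by rewrite !spread0 (a0_fourier hw (fourier_isq hw)) (a0_fourier hv (fourier_isq hv)).
split; last first.
  by move=> A /H [w [a [w0 ha <-]]]; exact: a0_fourier (isq_fourier w0 ha) ha.
split=> [z z0|A z hA z0|A /H [w [a [w0 ha _]]]].
- have [l [a ha]] := modular_isq hf; have [m [b hb]] := modular_isq hg.
  exact: qder_derivable (qderD (isq_qder ha z0) (qderZ c (isq_qder hb z0))).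
- by rewrite slash_lin; have [_ -> // _] := hf; have [_ -> // _] := hg.
- by exists w, a; apply: isq_fourier.
Qed.

End Levels.

(** * Linearity of the bracket, monotone limits, and integrals of decaying functions *)

Section Nondegeneracy.
Variable R : realType.
Local Notation C := R[i].
Local Notation Re := (@complex.Re R).
Local Notation Im := (@complex.Im R).
Local Notation mu := (@lebesgue_measure R).
Local Notation area := (mu \x mu)%E.
Local Notation zeta2 := (@zeta2 R).
Local Notation ge := (@ge R).
Implicit Types (A B M : 'M[int]_2) (z : C) (f g : C -> C) (u v : R -> R -> R).

Lemma reg_sum_in (I : eqType) (r : seq I) (F : I -> R -> R -> R) :
  (forall i, i \in r -> reg (F i)) -> reg (fun x y => \sum_(i <- r) F i x y).
Proof.
elim: r => [|i r IH] h.
  by apply: reg_ext (reg_cst 0) => x y _; rewrite big_nil.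
apply: (@reg_ext _ (fun x y => F i x y + \sum_(j <- r) F j x y)).
  by move=> x y _; rewrite big_cons.
apply: regD; first by apply: h; rewrite mem_head.
by apply: IH => j jr; apply: h; rewrite in_cons jr orbT.
Qed.

Lemma reg_tr N f g : (0 < N)%N -> modular_form 2 (Gamma0 N) f ->
  modular_form 2 (Gamma0 N) g ->
  reg (fun x y => Re (tr_prod 2 (Gamma0 N) f g (x +i* y))) /\
  reg (fun x y => Im (tr_prod 2 (Gamma0 N) f g (x +i* y))).
Proof.
move=> N0 hf hg; have [_ sS _ _] := coset_reps_Gamma0 N0.
pose P A x y := Re (slash 2 f A (x +i* y)) * Re (slash 2 g A (x +i* y)) +
  Im (slash 2 f A (x +i* y)) * Im (slash 2 g A (x +i* y)).
pose Q A x y := Im (slash 2 f A (x +i* y)) * Re (slash 2 g A (x +i* y)) -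
  Re (slash 2 f A (x +i* y)) * Im (slash 2 g A (x +i* y)).
have h A : A \in coset_reps (Gamma0 N) -> reg (P A) /\ reg (Q A).
  move=> /sS hA; have [l [a [ha _]]] := modular_slash_isq hf hA.
  have [m [b [hb _]]] := modular_slash_isq hg hA.
  have fR := reg_Re_isq ha; have fI := reg_Im_isq ha.
  have gR := reg_Re_isq hb; have gI := reg_Im_isq hb.
  by split; [apply: regD | apply: regB]; apply: regM.
split.
  apply: reg_ext (reg_sum_in (fun A As => (h A As).1)) => x y _.
  rewrite /tr_prod Re_sum; apply: eq_bigr => A _; rewrite /P.
  by move: (slash 2 f A _) (slash 2 g A _) => a b; rewrite !ReImE; ring.
apply: reg_ext (reg_sum_in (fun A As => (h A As).2)) => x y _.
rewrite /tr_prod Im_sum; apply: eq_bigr => A _; rewrite /Q.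
by move: (slash 2 f A _) (slash 2 g A _) => a b; rewrite !ReImE; ring.
Qed.

Lemma RintegralF_lin u v (a : R) (T : R) : reg u -> reg v ->
  \int[area]_(p in Fdom T) (u p.1 p.2 + a * v p.1 p.2) =
  \int[area]_(p in Fdom T) u p.1 p.2 + a * \int[area]_(p in Fdom T) v p.1 p.2.
Proof.
move=> hu hv; rewrite RintegralD; [|exact: measurable_Fdom|exact: integrable_Fdom hu
  |exact: integrable_Fdom (regM (reg_cst a) hv)].
congr (_ + _); rewrite RintegralZl //; first exact: measurable_Fdom.
exact: integrable_Fdom hv.
Qed.

Lemma hyp_lin (t0 t1 : C -> C) (c : C) (T : R) :
  reg (fun x y => Re (t0 (x +i* y))) -> reg (fun x y => Im (t0 (x +i* y))) ->
  reg (fun x y => Re (t1 (x +i* y))) -> reg (fun x y => Im (t1 (x +i* y))) ->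
  hyp_integral (FT T) (fun z => (Im z ^+ 2)%:C * (t0 z + c * t1 z)) =
  hyp_integral (FT T) (fun z => (Im z ^+ 2)%:C * t0 z) +
  c * hyp_integral (FT T) (fun z => (Im z ^+ 2)%:C * t1 z).
Proof.
move=> r0 i0 r1 i1; rewrite !hyp_integral_tr.
have eR : \int[area]_(p in Fdom T) Re (t0 (p.1 +i* p.2) + c * t1 (p.1 +i* p.2)) =
  \int[area]_(p in Fdom T) Re (t0 (p.1 +i* p.2)) +
  Re c * \int[area]_(p in Fdom T) Re (t1 (p.1 +i* p.2)) +
  - Im c * \int[area]_(p in Fdom T) Im (t1 (p.1 +i* p.2)).
  rewrite -(RintegralF_lin _ _ r0 r1) -(RintegralF_lin _ _ (regD r0 (regM (reg_cst (Re c)) r1)) i1).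
  by apply: eq_Rintegral => p _; move: (t0 _) (t1 _) => a b; rewrite !ReImE; ring.
have eI : \int[area]_(p in Fdom T) Im (t0 (p.1 +i* p.2) + c * t1 (p.1 +i* p.2)) =
  \int[area]_(p in Fdom T) Im (t0 (p.1 +i* p.2)) +
  Re c * \int[area]_(p in Fdom T) Im (t1 (p.1 +i* p.2)) +
  Im c * \int[area]_(p in Fdom T) Re (t1 (p.1 +i* p.2)).
  rewrite -(RintegralF_lin _ _ i0 i1) -(RintegralF_lin _ _ (regD i0 (regM (reg_cst (Re c)) i1)) r1).
  by apply: eq_Rintegral => p _; move: (t0 _) (t1 _) => a b; rewrite !ReImE; ring.
move: eR eI; move: (\int[area]_(p in Fdom T) Re (t0 (p.1 +i* p.2) + c * t1 (p.1 +i* p.2)))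
  (\int[area]_(p in Fdom T) Im (t0 (p.1 +i* p.2) + c * t1 (p.1 +i* p.2))) => I1 I2.
move: (\int[area]_(p in Fdom T) Re (t0 (p.1 +i* p.2))) (\int[area]_(p in Fdom T) Im (t0 (p.1 +i* p.2)))
  (\int[area]_(p in Fdom T) Re (t1 (p.1 +i* p.2))) (\int[area]_(p in Fdom T) Im (t1 (p.1 +i* p.2))).
by move=> a b a' b' e1 e2; apply: complexP; rewrite !ReImE ?e1 ?e2; ring.
Qed.

(** Linearity is taken at finite T, because [lim] in [petersson] is additive only once both limits
    are known to exist. *)
Lemma bracket_lin N f0 f1 g (c : C) (T : R) : (0 < N)%N ->
  modular_form 2 (Gamma0 N) f0 -> modular_form 2 (Gamma0 N) f1 ->
  modular_form 2 (Gamma0 N) g ->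
  bracket N (fun z => f0 z + c * f1 z) g T = bracket N f0 g T + c * bracket N f1 g T.
Proof.
move=> N0 h0 h1 hg; have [r0 i0] := reg_tr N0 h0 hg; have [r1 i1] := reg_tr N0 h1 hg.
have [_ sS _ _] := coset_reps_Gamma0 N0; have [_ ha] := modular_lin c h0 h1.
rewrite /bracket.
have -> : a0_prod 2 (Gamma0 N) (fun z => f0 z + c * f1 z) g =
   a0_prod 2 (Gamma0 N) f0 g + c * a0_prod 2 (Gamma0 N) f1 g.
  rewrite /a0_prod mulr_sumr -big_split /= big_seq [RHS]big_seq.
  by apply: eq_bigr => A /sS hA; rewrite (ha A hA) mulrDl -mulrA.
have -> : (fun z => (Im z ^+ 2)%:C * tr_prod 2 (Gamma0 N) (fun z => f0 z + c * f1 z) g z) =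
  (fun z => (Im z ^+ 2)%:C * (tr_prod 2 (Gamma0 N) f0 g z + c * tr_prod 2 (Gamma0 N) f1 g z)).
  apply/funext => z; congr (_ * _); rewrite /tr_prod mulr_sumr -big_split /=.
  by apply: eq_bigr => A _; rewrite slash_lin mulrDl -mulrA.
rewrite (hyp_lin _ _ r0 i0 r1 i1).
move: (hyp_integral _ _) (hyp_integral _ _) (a0_prod _ _ f0 g) (a0_prod _ _ f1 g) => p q r s.
ring.
Qed.

Lemma cvTD (F G : R -> C) s t : cvT F s -> cvT G t -> cvT (fun T => F T + G T) (s + t).
Proof.
move=> hF hG e e0; have e20 : 0 < e / 2 by rewrite divr_gt0.
have [S hS] := hF _ e20; have [S' hS'] := hG _ e20.
exists (Num.max S S') => T; rewrite ge_max => /andP[/hS h1 /hS' h2].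
have -> : F T + G T - (s + t) = (F T - s) + (G T - t) by ring.
by apply: le_trans (nrmD _ _) _; lra.
Qed.

Lemma cvTZ (c : C) (F : R -> C) s : cvT F s -> cvT (fun T => c * F T) (c * s).
Proof.
move=> hF e e0; have c1 : 0 < nrm c + 1 by have := nrm_ge0 c; lra.
have e20 : 0 < e / (nrm c + 1) by rewrite divr_gt0.
have [S hS] := hF _ e20; exists S => T /hS h1.
rewrite -mulrBr nrmM; apply: (@le_trans _ _ ((nrm c + 1) * (e / (nrm c + 1)))).
  by rewrite ler_pM ?nrm_ge0 // lerDl.
by rewrite mulrC divfK // gt_eqF.
Qed.

Lemma cvT_ext (F G : R -> C) s : (forall T, F T = G T) -> cvT F s -> cvT G s.
Proof. by move=> E h e /h [S hS]; exists S => T /hS; rewrite E. Qed.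

Lemma cvT_mono (J : R -> R) (K : R) : (forall T T', T <= T' -> J T <= J T') ->
  (forall T, 1 < T -> J T <= K) -> exists2 S : R, cvT (fun T => (J T)%:C) S%:C &
  forall T, J T <= S.
Proof.
move=> Jm JK; pose E := [set J T | T in setT].
have JK' T : J T <= K.
  apply: le_trans (JK (Num.max T 2) _); first by apply: Jm; rewrite le_max lexx.
  by rewrite lt_max ltr1n orbT.
have hE : has_sup E.
  split; first by exists (J 0), 0.
  by exists K => _ [T _ <-].
have ub T : J T <= sup E by apply: sup_upper_bound => //; exists T.
exists (sup E) => // e e0; have [_ [T0 _ <-] h] := sup_adherent e0 hE.
exists T0 => T TT; rewrite -CN -CD nrmC distrC ger0_norm ?subr_ge0 //.
by have := Jm _ _ TT; lra.
Qed.

Lemma reg_expy (k : R) : 0 <= k -> reg (fun _ y => expR (- (k * y))).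
Proof.
move=> k0; split.
- move=> x y y0 e e0.
  have c : {for y, continuous (fun y => expR (- (k * y)))}.
    apply: continuous_comp; last exact: continuous_expR.
    apply: continuousN; apply: continuousM; [exact: cvg_cst | exact: cvg_id].
  have /cvgrPdist_le /(_ e e0) [r /= r0 h] := c.
  by exists r => // x' y' _ yy; rewrite distrC; apply: h; rewrite /= distrC.
- move=> T; exists 1 => // x y _ /andP[y1 _].
  rewrite ger0_norm ?expR_ge0 // -[leRHS]expR0 ler_expR oppr_le0 mulr_ge0 //.
  by apply: le_trans y1.
- have [_ _ my] := regM (reg_cst (- k)) (reg_y R).
  apply: (eq_measurable_fun (fun p : R * R => expR (- k * p.2))).
    by move=> p _; rewrite mulNr.
  by apply: (measurableT_comp (@measurable_expR R)); exact: my.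
Qed.

Lemma C1_expy (k : R) : 0 < k -> C1 (fun _ y => - k^-1 * expR (- (k * y)))
  (fun _ _ => 0) (fun _ y => expR (- (k * y))).
Proof.
move=> k0; have hr := reg_expy (ltW k0); split => //.
- by apply: regM => //; exact: reg_cst.
- exact: reg_cst.
- by move=> x y _; exact: is_derive_cst.
move=> x y _.
have d1 : is_derive y 1 (fun y : R => - (k * y)) (- k).
  have : is_derive y 1 (fun y : R => - k * y) (- k * 1) by exact: is_deriveZ.
  rewrite mulr1; have -> // : (fun y : R => - k * y) = (fun y : R => - (k * y)).
  by apply/funext => t; rewrite mulNr.
have d2 : is_derive y 1 (fun y : R => expR (- (k * y))) (expR (- (k * y)) * - k).
  exact: (@is_derive1_comp _ expR (fun y : R => - (k * y)) y _ _ (is_derive_expR _) d1).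
have : is_derive y 1 (fun y : R => - k^-1 * expR (- (k * y))) (- k^-1 * (expR (- (k * y)) * - k)).
  exact: is_deriveZ.
have -> // : - k^-1 * (expR (- (k * y)) * - k) = expR (- (k * y)).
by field; rewrite gt_eqF.
Qed.

(** exp(- k y) is the y-derivative of the function in [C1_expy], so [int_Qy] reduces the integral to
    one over x. *)
Lemma integral_expy (k T : R) : 0 < k -> 1 < T ->
  \int[area]_(p in Fdom T) expR (- (k * p.2)) <= k^-1.
Proof.
move=> k0 T1; have CQ := C1_expy k0; have T0 : 0 < T by apply: lt_trans T1.
rewrite (int_Qy CQ T1).
have vol c : \int[mu]_(x in `[- 2^-1, 2^-1]) (c : R) = c.
  rewrite Rintegral_cst //= lebesgue_measure_itv /= lte_fin.
  have -> : - 2^-1 < 2^-1 :> R by lra.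
  by rewrite -EFinB /=; lra.
rewrite -[leRHS]vol; apply: le_Rintegral => //.
- apply: (@integrable_seg _ (fun x => - k^-1 * expR (- (k * T)) - - k^-1 * expR (- (k * arc x)))).
  move=> x _; apply: continuousB; first exact: cvg_cst.
  apply: continuousM; first exact: cvg_cst.
  apply: continuous_comp; last exact: continuous_expR.
  apply: continuousN; apply: continuousM; [exact: cvg_cst | exact: continuous_arc].
- by apply: integrable_seg => x _; exact: cvg_cst.
move=> x _; have e1 := expR_ge0 (- (k * T)).
have a0 : 0 <= arc x by exact: sqrtr_ge0.
have e2 : expR (- (k * arc x)) <= 1.
  by rewrite -[leRHS]expR0 ler_expR oppr_le0 mulr_ge0 // ltW.
have k1 : 0 < k^-1 by rewrite invr_gt0.
by nra.
Qed.

End Nondegeneracy.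

(** * Cusp forms, the two cusps of prime level, and nondegeneracy *)

Section PrimeLevel.
Variable R : realType.
Local Notation C := R[i].
Local Notation Re := (@complex.Re R).
Local Notation Im := (@complex.Im R).
Local Notation mu := (@lebesgue_measure R).
Local Notation area := (mu \x mu)%E.
Local Notation zeta2 := (@zeta2 R).
Local Notation ge := (@ge R).
Implicit Types (A B M : 'M[int]_2) (z : C) (f g : C -> C) (u v : R -> R -> R).

Lemma Rintegral_Fdom u (T : R) : reg u ->
  (\int[area]_(p in Fdom T) u p.1 p.2)%:E = (\int[area]_(p in Fdom T) (u p.1 p.2)%:E)%E.
Proof.
move=> hu; rewrite /Rintegral fineK //; apply: integrable_fin_num.
  exact: measurable_Fdom.
exact: integrable_Fdom hu.
Qed.

Lemma measurable_fun_Fdom u (T : R) : reg u ->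
  measurable_fun (Fdom T) (fun p : R * R => (u p.1 p.2)%:E).
Proof.
move=> [_ _ m]; apply/measurable_EFinP.
by apply: (measurable_funS (@measurable_upper R) _ m) => p [].
Qed.

Lemma Rintegral_Fdom_mono u (T T' : R) : reg u -> (forall x y, 0 < y -> 0 <= u x y) ->
  T <= T' -> \int[area]_(p in Fdom T) u p.1 p.2 <= \int[area]_(p in Fdom T') u p.1 p.2.
Proof.
move=> hu u0 TT; rewrite -lee_fin !Rintegral_Fdom //.
apply: ge0_subset_integral; [exact: measurable_Fdom | exact: measurable_Fdom
 | exact: measurable_fun_Fdom | |].
  by move=> p [p0 _ _ _]; rewrite lee_fin u0.
by move=> p [h1 h2 h3 h4]; split => //; exact: lt_le_trans TT.
Qed.

Lemma Rintegral_Fdom_gt0 u (x0 y0 : R) : reg u -> (forall x y, 0 < y -> 0 <= u x y) ->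
  `|x0| <= 2^-1 -> 1 < y0 -> 0 < u x0 y0 ->
  exists T, 0 < \int[area]_(p in Fdom T) u p.1 p.2.
Proof.
move=> hu u0 hx0 hy0 up; have [cu _ _] := hu.
have y00 : 0 < y0 by lra.
have up2 : 0 < u x0 y0 / 2 by rewrite divr_gt0.
have [r r0 hr] := cu x0 y0 y00 _ up2.
pose d := Num.min r 4^-1; have d0 : 0 < d by rewrite lt_min r0 invr_gt0 ltr0n.
have dr : d <= r by rewrite ge_min lexx.
have d4 : d <= 4^-1 by rewrite ge_min lexx orbT.
(* The box extends to the left of a positive x0 and to the right otherwise, so that it stays within
   |x| <= 1/2; lying above y0 > 1, it avoids the unit disc. *)
clearbody d; pose a := if 0 < x0 then x0 - d else x0.
have ha x : a < x < a + d -> `|x - x0| < d /\ `|x| <= 2^-1.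
  move: hx0; rewrite /a ler_norml !ltr_norml !ler_norml; case: ifP => [h|/negbT].
    by move=> h1 h2; split; lra.
  by rewrite -leNgt => h h1 h2; split; lra.
pose T := y0 + d + 1; exists T.
pose B : set (R * R) := `]a, a + d[%classic `*` `]y0, y0 + d[%classic.
have BF : B `<=` Fdom T.
  move=> [x y] [/=]; rewrite !in_itv /= => /ha [h1 h2] /andP[h3 h4].
  split => //=; [lra | nra | rewrite /T; lra].
have mB : measurable B by apply: measurableX.
rewrite -lte_fin Rintegral_Fdom //.
have le1 : (\int[area]_(p in B) (u p.1 p.2)%:E <= \int[area]_(p in Fdom T) (u p.1 p.2)%:E)%E.
  apply: ge0_subset_integral => //; [exact: measurable_Fdom | exact: measurable_fun_Fdom |].
  by move=> p [p0 _ _ _]; rewrite lee_fin u0.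
apply: lt_le_trans le1.
have le2 : (\int[area]_(p in B) (u x0 y0 / 2)%:E <= \int[area]_(p in B) (u p.1 p.2)%:E)%E.
  apply: ge0_le_integral => //.
  - by move=> p _; rewrite lee_fin divr_ge0 // ltW.
  - by apply: measurable_funS (measurable_fun_Fdom (T := T) hu) => //; exact: measurable_Fdom.
  - move=> [x y] [/=]; rewrite !in_itv /= => /ha [h1 h2] /andP[h3 h4]; rewrite lee_fin.
    have hx : `|x - x0| < r by apply: lt_le_trans dr.
    have hy : `|y - y0| < r by rewrite ltr_norml; apply/andP; split; lra.
    by have := hr x y hx hy; rewrite ler_norml => /andP[]; lra.
have aB : (area B = mu `]a, (a + d)%R[%classic * mu `]y0, (y0 + d)%R[%classic)%E.
  exact: product_measure1E.
apply: lt_le_trans le2.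
apply: (@lt_le_trans _ _ ((u x0 y0 / 2)%:E * area B)%E); last by rewrite integral_cst.
rewrite aB.
rewrite !lebesgue_measure_itv /= !lte_fin !ltrDl d0 -!EFinB -!EFinM lte_fin.
have -> : a + d - a = d by ring.
have -> : y0 + d - y0 = d by ring.
by rewrite !mulr_gt0 // divr_gt0.
Qed.

Lemma tr_diag N f z : tr_prod 2 (Gamma0 N) f f z =
  (\sum_(A <- coset_reps (Gamma0 N)) nrm (slash 2 f A z) ^+ 2)%:C.
Proof.
rewrite (rmorph_sum (real_complex R)); apply: eq_bigr => A _ /=.
move: (slash 2 f A z) => S; rewrite nrm_sqr.
by apply: complexP; rewrite !ReImE; ring.
Qed.

Definition nsq N f x y : R :=
  \sum_(A <- coset_reps (Gamma0 N)) nrm (slash 2 f A (x +i* y)) ^+ 2.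

Lemma nsq_ge0 N f x y : 0 <= nsq N f x y.
Proof. by apply: sumr_ge0 => A _; rewrite sqr_ge0. Qed.

Lemma reg_nsq N f : (0 < N)%N -> modular_form 2 (Gamma0 N) f -> reg (nsq N f).
Proof.
by move=> N0 hf; apply: reg_ext (reg_tr N0 hf hf).1 => x y _; rewrite tr_diag.
Qed.

Lemma sum_exp_bound (I : eqType) (r : seq I) (V : I -> R -> R -> R) :
  (forall i, i \in r -> exists l K : R, [/\ 0 < l, 0 <= K &
     forall x y, 1 / 2 <= y -> V i x y <= K * expR (- (l * y))]) ->
  exists l K : R, [/\ 0 < l, 0 <= K &
     forall x y, 1 / 2 <= y -> \sum_(i <- r) V i x y <= K * expR (- (l * y))].
Proof.
elim: r => [|i r IH] h.
  by exists 1, 0; split => // x y _; rewrite big_nil mul0r.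
have [l [K [l0 K0 hK]]] := h i (mem_head _ _).
have [m [K' [m0 K'0 hK']]] := IH (fun j jr => h j (mem_behead (s := i :: r) jr)).
exists (Num.min l m), (K + K'); split; [by rewrite lt_min l0 | exact: addr_ge0 |].
move=> x y y1; rewrite big_cons mulrDl.
have y0 : 0 <= y by lra.
apply: lerD.
  apply: le_trans (hK x y y1) _; rewrite ler_wpM2l // ler_expR lerN2 ler_wpM2r //.
  by rewrite ge_min lexx.
apply: le_trans (hK' x y y1) _; rewrite ler_wpM2l // ler_expR lerN2 ler_wpM2r //.
by rewrite ge_min lexx orbT.
Qed.

(** Vanishing constant terms make every translate of f decay exponentially in y, so [integral_expy]
    bounds the integral uniformly in T. *)
Lemma nsq_bounded N f : (0 < N)%N -> modular_form 2 (Gamma0 N) f ->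
  (forall A, SL2Z A -> a0 (slash 2 f A) = 0) ->
  exists K : R, forall T, 1 < T -> \int[area]_(p in Fdom T) nsq N f p.1 p.2 <= K.
Proof.
move=> N0 hf ha; have [_ sS _ _] := coset_reps_Gamma0 N0.
have [l [K [l0 K0 hK]]] : exists l K : R, [/\ 0 < l, 0 <= K &
     forall x y, 1 / 2 <= y -> nsq N f x y <= K * expR (- (l * y))].
  apply: (@sum_exp_bound _ _ (fun A x y => nrm (slash 2 f A (x +i* y)) ^+ 2)).
  move=> A /sS hA; have [l [b [hb b0]]] := modular_slash_isq hf hA.
  move: b0; rewrite ha // => b0; have [K K0 hK] := isq_bound hb.
  exists (l + l), (K ^+ 2); split; [by rewrite addr_gt0 ?hb.1 | exact: sqr_ge0 |].
  move=> x y y1; have := hK (x +i* y) y1; rewrite -b0 subr0 Im_pair => h.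
  have -> : - ((l + l) * y) = - (l * y) + - (l * y) by ring.
  rewrite expRD !expr2 mulrACA; apply: ler_pM => //; exact: nrm_ge0.
exists (K / l) => T T1.
apply: (@le_trans _ _ (\int[area]_(p in Fdom T) (K * expR (- (l * p.2))))).
  apply: le_Rintegral; [exact: measurable_Fdom | exact: integrable_Fdom (reg_nsq N0 hf)
   | exact: integrable_Fdom (regM (reg_cst K) (reg_expy (ltW l0))) |].
  by move=> p /Fdom_y /andP[p1 _]; apply: hK; lra.
rewrite RintegralZl; [|exact: measurable_Fdom|exact: integrable_Fdom (reg_expy (ltW l0))].
by rewrite ler_wpM2l // integral_expy.
Qed.

(** Translation by j multiplies the n-th coefficient by exp(i l n j), which is 1 for n = 0. *)
Lemma a0_shift N g A B (j : int) : modular_form 2 (Gamma0 N) g -> SL2Z A -> SL2Z B ->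
  (forall z, 0 < Im z -> slash 2 g A z = slash 2 g B (z + j%:~R)) ->
  a0 (slash 2 g A) = a0 (slash 2 g B).
Proof.
move=> hg hA hB E; have [l [b [hb ->]]] := modular_slash_isq hg hB.
have hb' := isq_affine (j%:~R : R) ltr01 hb; have [_ _ /(_ A hA) [w [a hw]]] := hg.
have hb2 : isq (l * 1) (fun n => b n * ex (l * n%:R) (j%:~R : R)%:C) (slash 2 g A).
  by apply: isq_ext hb' _ _ => // z z0; rewrite mul1r -intC E.
by rewrite (a0_fourier hw hb2) mulr0 ex0 mulr1.
Qed.

Lemma a0_Gamma0 N g A : modular_form 2 (Gamma0 N) g -> Gamma0 N A ->
  a0 (slash 2 g A) = a0 (slash 2 g (Tmx 0)).
Proof.
move=> hg hA; apply: (@a0_shift N g A (Tmx 0) 0) => //; [exact: Gamma0_SL hA | exact: SL2Z_T |].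
by move=> z z0; rewrite addr0 slash_T0; have [_ -> // _] := hg.
Qed.

(** Such an A lies in Gamma_0(p) S T^j for some j: besides infinity, prime level has only the cusp
    0. *)
Lemma a0_coprime p g A : prime p -> modular_form 2 (Gamma0 p) g -> SL2Z A ->
  ~~ (p %| absz (A 1%R 0%R))%N -> a0 (slash 2 g A) = a0 (slash 2 g Smx).
Proof.
move=> pp hg hA pc.
have cop : coprimez (A 1%R 0%R) p%:Z.
  by rewrite /coprimez /gcdz /= eqz_nat -/(coprime _ _) coprime_sym prime_coprime.
have [[x y] /= xy] := coprimezP _ _ cop.
(* [V] is the inverse of S T^j. As x inverts c = A 1 0 modulo p, this j makes the lower left entry c
   j - A 1 1 of [G] divisible by p. *)
pose j := x * A 1%R 1%R; pose V := mx2 j 1 (-1) 0; pose G := A *m V.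
have [v1 v2 v3 v4] := mx2E j 1 (-1) 0; have [t1 t2 t3 t4] := mx2E 1 j 0 1.
have [s1 s2 s3 s4] := mx2E 0 (-1) 1 0.
have VK : V *m (Smx *m Tmx j) = 1%:M.
  by apply: matrix2P; rewrite !mulmx2 ?v1 ?v2 ?v3 ?v4 ?s1 ?s2 ?s3 ?s4 ?t1 ?t2 ?t3 ?t4 mxE /=; ring.
have AE : A = G *m (Smx *m Tmx j) by rewrite /G -mulmxA VK mulmx1.
have hV : SL2Z V by rewrite /SL2Z /= det2 v1 v2 v3 v4; ring.
have GG : Gamma0 p G.
  split; first exact: SL2Z_mul.
  have -> : G 1 0 = (- A 1 1 * y) * p%:Z.
    rewrite /G mulmx2 v1 v3 /j.
    have -> : A 1 0 * (x * A 1 1) + A 1 1 * -1 = A 1 1 * (x * A 1 0 - 1) by ring.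
    by rewrite -xy; ring.
  by rewrite dvdz_mull.
have hG := Gamma0_SL GG; have hST := SL2Z_mul SL2Z_S (SL2Z_T j).
apply: (@a0_shift p g A Smx j) => //; first exact: SL2Z_S.
move=> z z0; rewrite [in LHS]AE slash_mul //.
have [_ inv _] := hg; rewrite inv //; last exact: mob_H.
rewrite -slashE slash_mul //; [|exact: SL2Z_S|exact: SL2Z_T].
by rewrite mob_T den_T expr1n divr1.
Qed.

(** The constant term is 0 when p divides the lower left entry of A, and has a single value y
    otherwise. The sum rule then reads m y = 0, where m counts the representatives of the second
    kind; the coset of S is one of them, so m > 0. *)
Lemma a0_all_zero p g : prime p -> modular_form 2 (Gamma0 p) g ->
  a0 (slash 2 g (Tmx 0)) = 0 -> forall A, SL2Z A -> a0 (slash 2 g A) = 0.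
Proof.
move=> pp hg g0; have p0 := prime_gt0 pp; set y := a0 (slash 2 g Smx).
have cl A : SL2Z A -> a0 (slash 2 g A) = if ~~ (p %| absz (A 1%R 0%R))%N then y else 0.
  move=> hA; case: ifP => [h|/negbFE h]; first exact: (@a0_coprime p).
  by rewrite (@a0_Gamma0 p) //; split => //; rewrite dvdzE.
suff y0 : y = 0 by move=> A /cl ->; rewrite y0; case: ifP.
have := sum_a0_zero p0 hg; have [_ sS _ sC] := coset_reps_Gamma0 p0.
rewrite big_seq (eq_bigr _ (fun A As => cl A (sS A As))) -big_seq.
rewrite -big_mkcond big_const_seq iter_addr_0 => /eqP.
rewrite mulrn_eq0 => /orP[|/eqP //]; rewrite -[_ == _]negbK -lt0n -has_count => /negP[].
have [B Bs [G [hG pG] SE]] := sC _ SL2Z_S; apply/hasP; exists B => //.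
apply/negP => pB.
have pB' : (p%:Z %| B 1%R 0%R)%Z by rewrite dvdzE.
have : (p%:Z %| (G *m B) 1%R 0%R)%Z.
  by rewrite mulmx2; apply: rpredD; [exact: dvdz_mulr | exact: dvdz_mull].
have [_ _ s3 _] := mx2E 0 (-1) 1 0.
have -> : ((p%:Z %| (G *m B) 1%R 0%R) = (p%:Z %| Smx 1%R 0%R))%Z.
  have NE : (- (G *m B)) 1%R 0%R = - (G *m B) 1%R 0%R by rewrite mxE.
  by case: SE => E; rewrite [in RHS]E // NE rpredN.
rewrite s3 dvdzE /= dvdn1 => /eqP p1.
by move: pp; rewrite p1.
Qed.

Lemma sum_gt0 (I : eqType) (r : seq I) (F : I -> R) : (0 < size r)%N ->
  (forall i, i \in r -> 0 < F i) -> 0 < \sum_(i <- r) F i.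
Proof.
case: r => // i r _ h; rewrite big_cons ltr_pwDl //; first by apply: h; rewrite mem_head.
by rewrite big_seq sumr_ge0 // => j jr; rewrite ltW // h // in_cons jr orbT.
Qed.

Section PositiveCase.
Variables (p : nat) (f0 : C -> C).
Hypotheses (pp : prime p) (hf0 : modular_form 2 (Gamma0 p) f0).
Hypothesis a0f0 : forall A, SL2Z A -> a0 (slash 2 f0 A) = 0.
Let p0 : (0 < p)%N := prime_gt0 pp.

Lemma bracket_diag T : bracket p f0 f0 T = (\int[area]_(q in Fdom T) nsq p f0 q.1 q.2)%:C.
Proof.
have [_ sS _ _] := coset_reps_Gamma0 p0.
rewrite /bracket hyp_integral_tr.
have -> : a0_prod 2 (Gamma0 p) f0 f0 = 0.
  by rewrite /a0_prod big_seq big1 // => A /sS hA; rewrite a0f0 // mul0r.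
rewrite mul0r subr0; congr (_ +i* _); first by apply: eq_Rintegral => q _; rewrite tr_diag.
transitivity (\int[area]_(q in Fdom T) (0 : R)).
  by apply: eq_Rintegral => q _; rewrite tr_diag.
by rewrite Rintegral_cst ?mul0r //; exact: measurable_Fdom.
Qed.

(** The integrals over [Fdom T] increase to S. If S = 0 they all vanish, so f0 is 0 on |Re z| <=
    1/2, Im z > 1, then by translation for Im z > 1, and everywhere by [isq_zero]. *)
Lemma bracket_diag_cvT : exists2 S : R, cvT (bracket p f0 f0) S%:C &
  S = 0 -> forall z, 0 < Im z -> f0 z = 0.
Proof.
have hr := reg_nsq p0 hf0; have n0 x y : 0 < y -> 0 <= nsq p f0 x y by move=> _; exact: nsq_ge0.
have [K hK] := nsq_bounded p0 hf0 a0f0.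
have [S cS JS] := cvT_mono (fun T T' => @Rintegral_Fdom_mono _ T T' hr n0) hK.
exists S; first by apply: cvT_ext cS => T; rewrite bracket_diag.
move=> S0; have [l [a ha]] := modular_isq hf0; apply: (isq_zero ha) => z z1.
have box w : `|Re w| <= 2^-1 -> 1 < Im w -> f0 w = 0.
  case: w => x y /= hx hy; have y0 : 0 < y by lra.
  have [/eqP|np] := boolP (0 < nsq p f0 x y).
    move=> /eqP up; have [T] := Rintegral_Fdom_gt0 hr n0 hx hy up.
    by rewrite ltNge -S0 JS.
  have [_ sS _ sC] := coset_reps_Gamma0 p0.
  have [B Bs SB] := sC _ (SL2Z_T 0).
  have E := slash_coset hf0 (sS B Bs) SB (y0 : 0 < Im (x +i* y)).
  apply/eqP; rewrite -slash_T0 E -nrm_eq0 -sqrf_eq0.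
  have : nsq p f0 x y == 0 by rewrite eq_le nsq_ge0 leNgt np.
  rewrite /nsq psumr_eq0; last by move=> A _; rewrite sqr_ge0.
  by move=> /allP /(_ B Bs).
(* The shift by i carries the upper half-plane, on which [periodic_center] is stated, to Im z >
   1. *)
have per w : 0 < Im w -> f0 (w + 1 + 'i%C) = f0 (w + 'i%C).
  move=> w0; have wi : 0 < Im (w + 'i%C) by rewrite ImD Im_i addr_gt0.
  have TG : Gamma0 p (Tmx 1).
    by split; [exact: SL2Z_T | rewrite /Tmx; have [_ _ -> _] := mx2E 1 1 0 1; exact: dvdz0].
  have [_ inv _] := hf0; have := inv _ _ TG wi.
  by rewrite slashE mob_T den_T expr1n divr1 addrAC.
have z0 : 0 < Im (z - 'i%C) by rewrite ImD ImN Im_i subr_gt0.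
have [w [w0 wx]] := @periodic_center R (fun w => f0 (w + 'i%C)) per _ z0.
rewrite subrK => <-; apply: box; first by rewrite ReD Re_i addr0.
by rewrite ImD Im_i ltrDr.
Qed.

End PositiveCase.

Lemma nondegenerate_prime p : prime p -> petersson_nondegenerate R 2 (Gamma0 p).
Proof.
move=> pp f hf H; have p0 := prime_gt0 pp; have p1 := prime_gt1 pp.
have pR : 1 < p%:R :> R by rewrite ltr1n.
pose D : seq (R * nat) := [:: (1, 1%N); (- 1, p)].
have DN : all (fun i => i.2 %| p)%N D by rewrite /= dvd1n dvdnn.
have D0 : ge * \sum_(i <- D) i.1 = 0.
  by rewrite /D !big_cons big_nil /= addr0 subrr mulr0.
have kE A : kapE D A = Re zeta2 * (1 - cusp_ratio R A p).
  by rewrite /kapE /D !big_cons big_nil /= cusp_ratio1; congr (_ * _); ring.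
have bE A : betaE D A = - ge * ln (cusp_ratio R A p).
  by rewrite /betaE /D !big_cons big_nil /= cusp_ratio1 ln1; ring.
pose E := fE D; have hE : modular_form 2 (Gamma0 p) E := modular_E p0 DN D0.
have aE A : SL2Z A -> a0 (slash 2 E A) = 'i%C * (kapE D A)%:C := @a0_E _ _ _ p0 DN D0 A.
have pair g : modular_form 2 (Gamma0 p) g -> cvT (bracket p E g)
    (- 'i%C * \sum_(A <- coset_reps (Gamma0 p)) (betaE D A)%:C * (a0 (slash 2 g A))^*%C).
  by move=> hg; apply: (pairing_limit p0 (eisenstein_datum_E p0 DN D0) hg); exact: aE.
have i0 : 'i%C != 0 :> C by apply/eqP => /(congr1 Im)/eqP; rewrite Im_i oner_eq0.
have aE0 : a0 (slash 2 E (Tmx 0)) != 0.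
  rewrite aE ?mulf_neq0 ?C_eq0 ?kE ?cusp_ratio_T0 //; last exact: SL2Z_T.
  by rewrite mulf_neq0 ?Re_zeta2_neq0 // subr_eq0 lt_eqF.
pose c := a0 (slash 2 f (Tmx 0)) / a0 (slash 2 E (Tmx 0)).
pose f0 z := f z + - c * E z.
have [hf0 af0] : modular_form 2 (Gamma0 p) f0 /\ forall A, SL2Z A ->
    a0 (slash 2 f0 A) = a0 (slash 2 f A) + - c * a0 (slash 2 E A) := modular_lin (- c) hf hE.
have a0f0 : forall A, SL2Z A -> a0 (slash 2 f0 A) = 0.
  apply: (a0_all_zero pp hf0); rewrite af0; last exact: SL2Z_T.
  by rewrite /c mulNr divfK // subrr.
have fE0 : f = (fun z => f0 z + c * E z).
  by apply/funext => z; rewrite /f0 mulNr subrK.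
have [_ sS _ _] := coset_reps_Gamma0 p0.
have idx : ((psl2_index (Gamma0 p))%:R^-1 : C) != 0.
  by rewrite invr_eq0 pnatr_eq0 -lt0n coset_reps_size.
have [S cS SP] := bracket_diag_cvT pp hf0 a0f0.
have S0 : S = 0.
  have pf0 := pair f0 hf0; move: pf0; rewrite big_seq big1 => [|A /sS hA]; last first.
    by rewrite a0f0 // conjc0 mulr0.
  rewrite mulr0 => pf0.
  have := cvTD cS (cvTZ c pf0); rewrite mulr0 addr0 => cf.
  have /petersson_cvT : cvT (bracket p f f0) S%:C.
    by apply: cvT_ext cf => T; rewrite [in RHS]fE0 bracket_lin.
  rewrite H // => /esym/eqP; rewrite mulf_eq0 (negbTE idx) /= C_eq0.
  by move/eqP.
have f00 := SP S0.
have c0 : c = 0.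
  (* f0 is known to vanish only on the upper half-plane, which is all that the integrals over
     [Fdom T] see. *)
  have z1 T : bracket p f0 E T = 0.
    rewrite /bracket hyp_integral_tr.
    have -> : a0_prod 2 (Gamma0 p) f0 E = 0.
      by rewrite /a0_prod big_seq big1 // => A /sS hA; rewrite a0f0 // mul0r.
    have t0 q : q \in Fdom T -> tr_prod 2 (Gamma0 p) f0 E (q.1 +i* q.2) = 0.
      rewrite inE => -[q0 _ _ _]; rewrite /tr_prod big_seq big1 // => A /sS hA.
      by rewrite slashE f00 ?mul0r //; apply: mob_H.
    rewrite mul0r subr0; apply: complexP; rewrite ?Re_pair ?Im_pair.
      transitivity (\int[area]_(q in Fdom T) (0 : R)).
        by apply: eq_Rintegral => q /t0 ->.
      by rewrite Rintegral_cst ?mul0r //; exact: measurable_Fdom.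
    transitivity (\int[area]_(q in Fdom T) (0 : R)).
      by apply: eq_Rintegral => q /t0 ->.
    by rewrite Rintegral_cst ?mul0r //; exact: measurable_Fdom.
  have /petersson_cvT : cvT (bracket p f E)
      (c * (- 'i%C * \sum_(A <- coset_reps (Gamma0 p)) (betaE D A)%:C * (a0 (slash 2 E A))^*%C)).
    by apply: cvT_ext (cvTZ c (pair E hE)) => T; rewrite [in RHS]fE0 bracket_lin // z1 add0r.
  rewrite H // => /esym/eqP; rewrite mulf_eq0 (negbTE idx) /= mulf_eq0 => /orP[/eqP //|].
  rewrite mulf_eq0 oppr_eq0 (negbTE i0) /=.
  have lp : 0 < ln (p%:R : R) by rewrite ln_gt0.
  (* [pos A] is - (1 - r) ln r / ln p for r = cusp_ratio A p, which is p or 1 / p: both values are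
     positive. *)
  pose pos A : R := if (p %| absz (A 1%R 0%R))%N then p%:R - 1 else 1 - p%:R^-1.
  have pos0 A : 0 < pos A.
    rewrite /pos; case: ifP => _; first by rewrite subr_gt0.
    by rewrite subr_gt0 invf_lt1 // (lt_trans ltr01).
  have -> : \sum_(A <- coset_reps (Gamma0 p)) (betaE D A)%:C * (a0 (slash 2 E A))^*%C =
    - 'i%C * (ge * Re zeta2 * ln p%:R * \sum_(A <- coset_reps (Gamma0 p)) pos A)%:C.
    transitivity (\sum_(A <- coset_reps (Gamma0 p))
        - 'i%C * (ge * Re zeta2 * ln p%:R * pos A)%:C); last first.
      by rewrite -mulr_sumr -(rmorph_sum (real_complex R)) -mulr_sumr.
    rewrite big_seq [RHS]big_seq.
    apply: eq_bigr => A /sS hA; rewrite aE // kE bE cusp_ratio_prime // /pos.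
    have jE (x : R) : ('i%C * x%:C)^*%C = - 'i%C * x%:C :> C.
      by apply: complexP; rewrite !ReImE; ring.
    rewrite jE mulrCA -CM; congr (_ * _%:C); case: ifP => _; first by ring.
    by rewrite lnV ?posrE ?ltr0n //; ring.
  rewrite mulf_eq0 oppr_eq0 (negbTE i0) /= C_eq0 !mulf_eq0 (negbTE (ge_neq0 R)).
  rewrite (negbTE (Re_zeta2_neq0 R)) (gt_eqF lp) /= gt_eqF //.
  by apply: sum_gt0 => [|A _]; [exact: coset_reps_size | exact: pos0].
by move=> z z0; rewrite fE0 c0 mul0r addr0 f00.
Qed.

End PrimeLevel.

Theorem theorem2 (R : realType) (N : nat)
    (N_gt1 : (1 < N)%N) (N_sqfree : squarefree N) :
  (~~ prime N -> petersson_degenerate R 2 (Gamma0 N)) /\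
  (prime N -> petersson_nondegenerate R 2 (Gamma0 N)).
Proof.
by split; [exact: degenerate_composite | exact: nondegenerate_prime].
Qed.
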